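(* Let $\mu$ be a pseudo-positive signed moment measure on $\mathbb{R}^d$ with component measures $\mu_{k,l}$, and assume that $$\sum_{k=0}^{\infty}\sum_{l=1}^{a_k}\int_0^\infty r^{N}r^{-k}\,d\mu_{k,l}(r)<\infty\qquad\text{for all }N\in\mathbb{N}_0 .$$ Let $\psi:[0,\infty)\to[0,\infty)$, $\psi(t)=t^2$. Then $V_\mu$ contains exactly one element if and only if for all $k\in\mathbb{N}_0$, $l=1,\dots,a_k$, the image measure $\mu_{k,l}^{\psi}$ is determined in the sense of Stieltjes.
   Context: Fix $d\ge 1$. $\mathbb{S}^{d-1}$ is the unit sphere of $\mathbb{R}^d$ with surface measure $d\theta$. $\mathcal{H}_k(\mathbb{R}^d)$ is the space of harmonic homogeneous complex polynomials of degree $k$, $a_k=\dim\mathcal{H}_k(\mathbb{R}^d)$, and $Y_{k,l}:\mathbb{R}^d\to\mathbb{R}$, $l=1,\dots,a_k$, is a fixed basis of $\mathcal{H}_k(\mathbb{R}^d)$, orthonormal for $\langle f,g\rangle=\int_{\mathbb{S}^{d-1}}f\overline{g}\,d\theta$. A signed measure is a real-valued $\sigma$-additive set function on the Borel sets; it is a (signed) moment measure if all polynomials are integrable with respect to its total variation. A signed measure $\mu$ on $\mathbb{R}^d$ is pseudo-positive if $\int_{\mathbb{R}^d}h(|x|)Y_{k,l}(x)\,d\mu(x)\ge0$ for every continuous compactly supported $h:[0,\infty)\to[0,\infty)$ and all $k\in\mathbb{N}_0$, $l=1,\dots,a_k$. For a pseudo-positive moment measure $\mu$, the component measures $\mu_{k,l}$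 are the unique non-negative moment measures on $[0,\infty)$ with $\int_0^\infty h(t)\,d\mu_{k,l}(t)=\int_{\mathbb{R}^d}h(|x|)Y_{k,l}(x)\,d\mu(x)$ for all continuous polynomially bounded $h$ on $[0,\infty)$. $V_\mu$ is the set of all pseudo-positive signed moment measures $\sigma$ on $\mathbb{R}^d$ with $\int f\,d\sigma=\int f\,d\mu$ for all $f\in\mathbb{C}[x_1,\dots,x_d]$. The image measure is $\nu^{\psi}(B)=\nu(\psi^{-1}(B))$. A non-negative moment measure $\nu$ on $[0,\infty)$ is determined in the sense of Stieltjes if it is the only non-negative moment measure $\tau$ on $[0,\infty)$ with $\int_0^\infty r^m\,d\tau=\int_0^\infty r^m\,d\nu$ for all $m\in\mathbb{N}_0$. In the summability condition $r^Nr^{-k}=r^{N-k}$, with $0^0=1$ and $0^{-j}=+\infty$ for $j>0$. *)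

(* Defs.v *)
(* R^d is [d.-tuple R] with the library's measurable structure on tuples
   (generated by the coordinates), which is the Borel sigma-algebra of R^d. *)
From HB Require Import structures.
From mathcomp Require Import all_boot all_order all_algebra.
From mathcomp Require Import all_classical all_reals all_analysis.
From mathcomp Require Import measurable_realfun.
From mathcomp.real_closed Require complex.
From mathcomp.multinomials Require mpoly.
(* the names and notations of mpoly clash with those of analysis *)
Export (canonicals, coercions) mpoly.
Export (canonicals, coercions) complex.
Set Implicit Arguments.
Unset Strict Implicit.
Unset Printing Implicit Defensive.

Import Order.TTheory GRing.Theory Num.Theory.
Import numFieldNormedType.Exports.

Local Open Scope classical_set_scope.
Local Open Scope ring_scope.

Section euclidean_space.
Context {R : realType}.

Definition enorm (d : nat) (x : d.-tuple R) : R :=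
  Num.sqrt (\sum_(i < d) tnth x i ^+ 2).

(* x / |x|, and 0 for x = 0 *)
Definition direction (d : nat) (x : d.-tuple R) : d.-tuple R :=
  [tuple tnth x i / enorm x | i < d].

Definition sphere (d : nat) : set (d.-tuple R) := [set x | enorm x = 1].

Definition punctured_ball (d : nat) : set (d.-tuple R) :=
  [set x | 0 < enorm x <= 1].

Lemma measurable_enorm (d : nat) : measurable_fun setT (@enorm d).
Proof.
apply: (@measurableT_comp _ _ _ _ _ _ (@Num.sqrt R)).
  apply: continuous_measurable_fun => x; exact: sqrt_continuous.
apply: measurable_sum => i.
by apply: measurable_funX; exact: measurable_tnth.
Qed.

Lemma measurable_inv : measurable_fun setT (@GRing.inv R).
Proof.
rewrite -(setvU [set 0]).
apply/measurable_funU; [exact: measurableC|exact: measurable_set1|split].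
  apply: open_continuous_measurable_fun.
    rewrite openC; apply: accessible_closed_set1; apply: hausdorff_accessible.
    exact: Rhausdorff.
  by apply/in_setP => x /= /eqP x0; exact: inv_continuous.
exact: measurable_fun_set1.
Qed.

Lemma measurable_direction (d : nat) : measurable_fun setT (@direction d).
Proof.
apply/measurable_fun_tnthP => i.
rewrite (_ : _ \o _ = (fun x : d.-tuple R => tnth x i * (enorm x)^-1)).
  by apply: measurable_funM; [exact: measurable_tnth|
    exact: (measurableT_comp measurable_inv (@measurable_enorm d))].
by apply/funext => x /=; rewrite tnth_mktuple.
Qed.

Lemma measurable_punctured_ball (d : nat) : measurable (@punctured_ball d).
Proof.
have -> : @punctured_ball d = @enorm d @^-1` `]0, 1].
  by apply/seteqP; split => x /=; rewrite in_itv.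
rewrite -[X in measurable X]setTI; apply: measurable_enorm => //.
Qed.

End euclidean_space.
Arguments sphere : clear implicits.
Arguments punctured_ball : clear implicits.

Section lebesgue_measure_tuple.
Context {R : realType}.

Definition cons_pair (n : nat) (p : measurableTypeR R * n.-tuple R) :
  n.+1.-tuple R := [tuple of (p.1 : R) :: p.2].

Lemma measurable_cons_pair (n : nat) : measurable_fun setT (@cons_pair n).
Proof. exact: measurable_cons. Qed.

Definition lebesgue_cons (n : nat)
    (m : {sigma_finite_measure set (n.-tuple R) -> \bar R}) :
    set (n.+1.-tuple R) -> \bar R :=
  pushforward (@lebesgue_measure R \x m)%E (@cons_pair n).

Section lebesgue_cons.
Variables (n : nat) (m : {sigma_finite_measure set (n.-tuple R) -> \bar R}).

Let lc0 : lebesgue_cons m set0 = 0%E.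
Proof. by rewrite /lebesgue_cons /pushforward preimage_set0 measure0. Qed.

Let lc_ge0 A : (0 <= lebesgue_cons m A)%E.
Proof. by apply: measure_ge0; exact: measurable_cons_pair. Qed.

Let lc_sigma_additive : semi_sigma_additive (lebesgue_cons m).
Proof.
apply: measure_semi_sigma_additive.
exact: measurable_cons_pair.
Qed.

HB.instance Definition _ := isMeasure.Build _ _ _ (lebesgue_cons m)
  lc0 lc_ge0 lc_sigma_additive.

Let uncons (x : n.+1.-tuple R) : measurableTypeR R * n.-tuple R :=
  (thead x : measurableTypeR R, [tuple of behead x]).

Let cons_pairK : cancel (@cons_pair n) uncons.
Proof.
by move=> [r t]; rewrite /uncons /= theadE; congr pair; apply/val_inj.
Qed.

Let measurable_uncons : measurable_fun setT uncons.
Proof.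
apply/measurable_fun_pairP; split => /=; last exact: measurable_behead.
exact: (@measurable_tnth _ R n.+1 ord0).
Qed.

Let lc_sigma_finite : sigma_finite setT (lebesgue_cons m).
Proof.
have /sigma_finiteP[F [TF ndF Foo]] := sigma_finiteT (@lebesgue_measure R).
have /sigma_finiteP[G [TG ndG Goo]] := sigma_finiteT m.
exists (fun k => uncons @^-1` (F k `*` G k)).
  apply/seteqP; split => // x _.
  have [i _ Fi] : (\bigcup_k F k) (uncons x).1 by rewrite -TF.
  have [j _ Gj] : (\bigcup_k G k) (uncons x).2 by rewrite -TG.
  exists (maxn i j) => //=; split.
    by move: Fi; exact/subsetPset/ndF/leq_maxl.
  by move: Gj; exact/subsetPset/ndG/leq_maxr.
move=> k; have [? ?] := Foo k; have [? ?] := Goo k; split.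
  rewrite -[X in measurable X]setTI; apply: measurable_uncons => //.
  exact: measurableX.
rewrite /lebesgue_cons /pushforward (_ : _ @^-1` _ = F k `*` G k).
  by rewrite product_measure1E// lte_mul_pinfty// ge0_fin_numE.
by rewrite -comp_preimage (_ : uncons \o _ = id)//; apply/funext/cons_pairK.
Qed.

HB.instance Definition _ := Measure_isSigmaFinite.Build _ _ _ (lebesgue_cons m)
  lc_sigma_finite.

End lebesgue_cons.

Fixpoint lebesgue_tuple (n : nat) :
    {sigma_finite_measure set (n.-tuple R) -> \bar R} :=
  match n with
  | 0 => \d_([tuple] : 0.-tuple R)
  | n'.+1 => lebesgue_cons (lebesgue_tuple n')
  end.

End lebesgue_measure_tuple.


Section sphere_measure.
Context {R : realType} (d : nat).

(* The surface measure of the unit sphere as the cone measure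
   A |-> d * vol {x | 0 < |x| <= 1, x/|x| in A}; for d = 1 it is the counting
   measure of {-1, 1}. *)
Definition sphere_measure (A : set (d.-tuple R)) : \bar R :=
  (d%:R%:E * lebesgue_tuple d (@direction R d @^-1` A `&` punctured_ball R d))%E.

Let measurable_cone (A : set (d.-tuple R)) :
  measurable A -> measurable (@direction R d @^-1` A `&` punctured_ball R d).
Proof.
move=> mA; apply: measurableI; last exact: measurable_punctured_ball.
by rewrite -[X in measurable X]setTI; exact: measurable_direction.
Qed.

Let sm0 : sphere_measure set0 = 0%E.
Proof. by rewrite /sphere_measure preimage_set0 set0I measure0 mule0. Qed.

Let sm_ge0 A : (0 <= sphere_measure A)%E.
Proof. by apply: mule_ge0; rewrite ?lee_fin. Qed.

Let sm_sigma_additive : semi_sigma_additive sphere_measure.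
Proof.
move=> F mF tF mUF; rewrite /sphere_measure preimage_bigcup setI_bigcupl.
under eq_fun do rewrite -ge0_sume_distrr//.
apply: cvgeZl => //; apply: measure_semi_sigma_additive.
- by move=> k; exact: measurable_cone.
- apply/trivIsetP => i j _ _ ij; rewrite setIACA -preimage_setI.
  by move/trivIsetP : tF => /(_ _ _ Logic.I Logic.I ij) ->; rewrite preimage_set0 set0I.
- by rewrite -setI_bigcupl -preimage_bigcup; exact: measurable_cone.
Qed.

HB.instance Definition _ := isMeasure.Build _ _ _ sphere_measure
  sm0 sm_ge0 sm_sigma_additive.

End sphere_measure.
Arguments sphere_measure : clear implicits.

Section charge_integral.
Context {dT : measure_display} {T : measurableType dT} {R : realType}.
Implicit Type mu : {charge set T -> \bar R}.

Lemma hahn_sets mu :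
  {PN : set T * set T | hahn_decomposition mu PN.1 PN.2}.
Proof.
apply: cid; have [P [N PN]] := Hahn_decomposition mu.
by exists (P, N).
Qed.

(* The Jordan decomposition does not depend on the chosen Hahn decomposition
   (Hahn_decomposition_uniq). *)
Definition charge_pos mu := jordan_pos (svalP (hahn_sets mu)).
Definition charge_neg mu := jordan_neg (svalP (hahn_sets mu)).
Definition total_variation mu := charge_variation (svalP (hahn_sets mu)).

HB.instance Definition _ mu := FiniteMeasure.on (charge_pos mu).
HB.instance Definition _ mu := FiniteMeasure.on (charge_neg mu).
HB.instance Definition _ mu := Measure.on (total_variation mu).

Definition charge_integral mu (f : T -> R) : R :=
  \int[charge_pos mu]_x f x - \int[charge_neg mu]_x f x.

Definition charge_cintegral mu (f : T -> complex.complex R) :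
    complex.complex R :=
  complex.Complex (charge_integral mu (fun x => complex.Re (f x)))
                  (charge_integral mu (fun x => complex.Im (f x))).

Definition charge_eq mu (nu : {charge set T -> \bar R}) : Prop :=
  forall A, measurable A -> mu A = nu A.

End charge_integral.

Section spherical_harmonics.
Context {R : realType} {d : nat}.
Local Notation C := (complex.complex R).

Definition peval (p : mpoly.mpoly d R) (x : d.-tuple R) : R :=
  mpoly.meval (tnth x) p.

Definition cpeval (p : mpoly.mpoly d C) (x : d.-tuple R) : C :=
  mpoly.meval (fun i => complex.Complex (tnth x i) 0) p.

Definition complexify (p : mpoly.mpoly d R) : mpoly.mpoly d C :=
  mpoly.map_mpoly (fun c : R => complex.Complex c 0) p.

Definition laplacian (p : mpoly.mpoly d C) : mpoly.mpoly d C :=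
  \sum_(i < d) mpoly.mderiv i (mpoly.mderiv i p).

Definition harmonic_homogeneous (k : nat) (p : mpoly.mpoly d C) : Prop :=
  p \is mpoly.ishomog1 k mpoly.mdeg /\ laplacian p = 0.

(* [Y] is a basis of the complex vector space of harmonic homogeneous
   polynomials of degree k (so that n is its dimension), made of polynomials
   with real values, whence no conjugate in the inner product. *)
Definition orthonormal_harmonic_basis (k n : nat)
    (Y : 'I_n -> mpoly.mpoly d R) : Prop :=
  [/\ forall l, harmonic_homogeneous k (complexify (Y l)),
      forall p, harmonic_homogeneous k p ->
        exists! c : {ffun 'I_n -> C}, p = \sum_(l < n) c l *: complexify (Y l)
    & forall l l',
        \int[sphere_measure R d]_(x in sphere R d)
          (peval (Y l) x * peval (Y l') x) = (l == l')%:R].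

End spherical_harmonics.

Section moment_problem.
Context {R : realType} {d : nat}.
Variables (a : nat -> nat) (Y : forall k, 'I_(a k) -> mpoly.mpoly d R).
Implicit Types (mu sigma : {charge set (d.-tuple R) -> \bar R}).
Implicit Types (nu tau : {measure set R -> \bar R}).

Definition moment_measure mu : Prop :=
  forall p : mpoly.mpoly d (complex.complex R),
    (total_variation mu).-integrable setT
      (fun x => (complex.Re (cpeval p x))%:E) /\
    (total_variation mu).-integrable setT
      (fun x => (complex.Im (cpeval p x))%:E).

Definition pseudo_positive mu : Prop :=
  forall h : R -> R,
    {within `[0, +oo[%classic, continuous h} ->
    (forall t, 0 <= t -> 0 <= h t) ->
    (exists M, forall t, 0 <= t -> M <= t -> h t = 0) ->
    forall k l,
      0 <= charge_integral mu (fun x => h (enorm x) * peval (@Y k l) x).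

Definition V_set mu : set ({charge set (d.-tuple R) -> \bar R})%R :=
  [set sigma | [/\ moment_measure sigma, pseudo_positive sigma &
     forall p : mpoly.mpoly d (complex.complex R),
       charge_cintegral sigma (cpeval p) = charge_cintegral mu (cpeval p)]].

(* Measures on [0, oo[ are measures on R that vanish on ]-oo, 0[. *)
Definition half_line_moment_measure nu : Prop :=
  nu `]-oo, 0[%classic = 0%E /\
  forall p : {poly R}, nu.-integrable `[0, +oo[%classic (fun t => p.[t]%:E).

Definition component_measure mu k l nu : Prop :=
  half_line_moment_measure nu /\
  forall h : R -> R,
    {within `[0, +oo[%classic, continuous h} ->
    (exists p : {poly R}, forall t, 0 <= t -> `|h t| <= p.[t]) ->
    \int[nu]_(t in `[0, +oo[%classic) h t =
      charge_integral mu (fun x => h (enorm x) * peval (@Y k l) x).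

Definition stieltjes_determined nu : Prop :=
  half_line_moment_measure nu /\
  forall tau, half_line_moment_measure tau ->
    (forall m : nat, \int[tau]_(r in `[0, +oo[%classic) (r ^+ m) =
                     \int[nu]_(r in `[0, +oo[%classic) (r ^+ m)) ->
    forall A, measurable A -> tau A = nu A.

(* r^N r^(-k) with 0^0 = 1 and 0^(-j) = +oo for j > 0 *)
Definition shifted_power (N k : nat) (r : R) : \bar R :=
  if (k <= N)%N then (r ^+ (N - k))%:E
  else if r == 0 then +oo%E else (r ^- (k - N))%:E.

End moment_problem.

Section image_psi.
Context {R : realType}.

Definition psi (t : R) : R := t ^+ 2.

Lemma measurable_psi : measurable_fun setT psi.
Proof. exact: exprn_measurable. Qed.

Definition image_psi (nu : {measure set R -> \bar R}) : set R -> \bar R :=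
  pushforward nu psi.

Section measure.
Variable nu : {measure set R -> \bar R}.

Let ip0 : image_psi nu set0 = 0%E.
Proof. by rewrite /image_psi /pushforward preimage_set0 measure0. Qed.

Let ip_ge0 A : (0 <= image_psi nu A)%E.
Proof. by apply: measure_ge0; exact: measurable_psi. Qed.

Let ip_sigma_additive : semi_sigma_additive (image_psi nu).
Proof. by apply: measure_semi_sigma_additive; exact: measurable_psi. Qed.

HB.instance Definition _ := isMeasure.Build _ _ _ (image_psi nu)
  ip0 ip_ge0 ip_sigma_additive.

End measure.
End image_psi.

(* Main.v *)
(* Every element of V_mu has component measures, and the Gauss decomposition
   p = sum_i |x|^(2i) h_i with h_i harmonic shows that its moments amount to the
   even moments of these components, i.e. to the moments of their images under
   psi.  If these images are determined, the components, hence all integrals of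
   h(|x|) p(x) with h of compact support, are those of mu; polynomial
   approximation of products of indicators then gives the charge itself.

   Conversely let the image N of mu_{k,l} have a second solution of its moment
   problem.  By the summability condition r^(-k) is integrable for mu_{k,l} and N
   has no mass at 0.  The point is that N then has the moments of another measure
   supported in some [x, oo[ with x > 0.  For L(p) = int p dN, indeterminacy
   bounds p(-1)^2 by C L(p^2); since 1/(s+1) acts with finite trace up to a rank
   one term, the absence of mass at 0 gives e L(p^2) <= L(s p^2) for some e > 0.
   As polynomials that are nonnegative on [x, oo[ are of the form A + (s - x) B
   with sums of squares A and B, L is positive on [e, oo[, and on [x, oo[ with
   x < e it has extensions to 1/(s+1) with different values; each extension is
   represented by a measure, by Riesz-Haviland.  Pulling this measure back under
   psi yields rho with r^(-k) integrable, and
   mu + (r^(-k) (rho - mu_{k,l})) (x) (Y_{k,l} dtheta), in polar coordinates, is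
   another element of V_mu by orthogonality of spherical harmonics.  The latter
   follows from Gaussian integration by parts and polar coordinates. *)
From HB Require Import structures.
Require Import Defs.
From mathcomp Require Import all_boot all_order all_algebra.
From mathcomp Require Import all_classical all_reals all_analysis.
From mathcomp.multinomials Require mpoly.
From mathcomp Require Import ring lra.
From mathcomp Require Import measurable_realfun zify.
Import Order.TTheory GRing.Theory Num.Theory.
Import numFieldNormedType.Exports.
Local Open Scope classical_set_scope.
Local Open Scope ring_scope.
Set Implicit Arguments.
Unset Strict Implicit.
Unset Printing Implicit Defensive.

(** * Sums of squares and threshold polynomials *)

(** A second solution of the moment problem of N cannot be used as it stands: r^(-k) need not be
    integrable for its pullback, and the perturbation would not be a charge. Hence the search for a
    solution supported away from 0.

    The point -1 is the pole of 1/(s+1), whose powers are bounded on the half-line and separate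
    measures: two measures with equal integrals of all (s+1)^(-j) coincide. At the first j where two
    solutions differ, the difference of the functionals p -> int p/(s+1)^j is a nonzero multiple of
    p -> p(-1), and this is what bounds p(-1)^2 by L(p^2).

    One extension of L is not enough, since N may itself be supported in [e, oo[ and the extension
    could return N. Moving the left end from e to e/2 makes room for a second value at 1/(s+1), and
    at most one of the two values belongs to N.

    Pseudo-positivity survives the perturbation because the component (k,l) of the new charge is the
    measure rho itself, while every other component is that of mu. *)

Section sums_of_squares.
Context {R : realType}.
Implicit Types (p q r A B : {poly R}) (x : R).

Inductive sos : {poly R} -> Prop :=
| sos0 : sos 0
| sos_add_sqr r p : sos p -> sos (r ^+ 2 + p).

Lemma sosD p q : sos p -> sos q -> sos (p + q).
Proof.
move=> + sq; elim=> [|r p' _ IH]; first by rewrite add0r.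
by rewrite -addrA; apply: sos_add_sqr.
Qed.

Lemma sos_sqr r : sos (r ^+ 2).
Proof. by rewrite -[_ ^+ 2]addr0; apply: sos_add_sqr; exact: sos0. Qed.

Lemma sos_sqrM r p : sos p -> sos (r ^+ 2 * p).
Proof.
elim=> [|s q _ IH]; first by rewrite mulr0; exact: sos0.
by rewrite mulrDr -exprMn; apply: sos_add_sqr.
Qed.

Lemma sosM p q : sos p -> sos q -> sos (p * q).
Proof.
move=> + sq; elim=> [|r p' _ IH]; first by rewrite mul0r; exact: sos0.
by rewrite mulrDl; apply: sosD => //; exact: sos_sqrM.
Qed.

Lemma sosC (c : R) : 0 <= c -> sos c%:P.
Proof.
by move=> c0; rewrite -(sqr_sqrtr c0) rmorphXn; exact: sos_sqr.
Qed.

Lemma sos_ge0 p t : sos p -> 0 <= p.[t].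
Proof.
elim=> [|r q _ IH]; first by rewrite horner0.
by rewrite hornerD horner_exp addr_ge0// sqr_ge0.
Qed.

(** The quadratic module generated by X - x. Since (X - x)^2 is a square it is closed under
    products, so [half_line_ge0_sos] can treat one factor at a time. *)
Definition half_line_sos x p :=
  exists A B, [/\ sos A, sos B & p = A + ('X - x%:P) * B].

Lemma half_line_sosD x p q :
  half_line_sos x p -> half_line_sos x q -> half_line_sos x (p + q).
Proof.
move=> [A [B [sA sB ->]]] [C [D [sC sD ->]]].
exists (A + C), (B + D); split; [exact: sosD|exact: sosD|].
by rewrite mulrDr addrACA.
Qed.

Lemma half_line_sosM x p q :
  half_line_sos x p -> half_line_sos x q -> half_line_sos x (p * q).
Proof.
move=> [A [B [sA sB ->]]] [C [D [sC sD ->]]].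
exists (A * C + ('X - x%:P) ^+ 2 * (B * D)), (A * D + B * C); split.
- by apply: sosD; [exact: sosM|apply: sos_sqrM; exact: sosM].
- by apply: sosD; exact: sosM.
- ring.
Qed.

Lemma half_line_sos_of_sos x p : sos p -> half_line_sos x p.
Proof. by move=> sp; exists p, 0; split => //; [exact: sos0|rewrite mulr0 addr0]. Qed.

Lemma half_line_sos_linear x y : x <= y -> half_line_sos x ('X - x%:P).
Proof.
move=> xy; exists 0, 1; split; [exact: sos0| |by rewrite mulr1 add0r].
by rewrite -[1]/(1%:P); exact: sosC.
Qed.

Lemma horner_split p a : exists q, p = q * ('X - a%:P) + (p.[a])%:P.
Proof.
have /factor_theorem[q qE] : root (p - (p.[a])%:P) a.
  by rewrite rootE !hornerE subrr.
by exists q; rewrite -qE subrK.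
Qed.

Lemma size_horner_split p q (a c : R) :
  p = q * ('X - a%:P) + c%:P -> q != 0 -> size p = (size q).+1.
Proof.
move=> -> q0; have sq : size (q * ('X - a%:P)) = (size q).+1.
  by rewrite size_Mmonic ?monicXsubC// size_XsubC addn2.
by rewrite size_addl sq// size_polyC ltnS (leq_trans (leq_b1 _))// lt0n size_poly_eq0.
Qed.

Lemma horner_away_from0 p : p != 0 ->
  exists M e : R, 0 < e /\ forall s, M <= s -> e <= `|p.[s]|.
Proof.
have [n] := ubnP (size p); elim: n p => // n IH p; rewrite ltnS => pn p0.
have [q pE] := horner_split p 0.
have [q0|q0] := eqVneq q 0.
  exists 0, `|p.[0]|; split=> [|s _]; last first.
    by rewrite {2}pE q0 mul0r add0r hornerC.
  by rewrite normr_gt0; apply: contraNneq p0 => p00; rewrite pE q0 p00 mul0r add0r.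
have sq := size_horner_split pE q0.
have [M [e [e0 He]]] := IH q (leq_trans (eq_leq (esym sq)) pn) q0.
exists (Num.max M (Num.max 1 ((1 + `|p.[0]|) / e))), 1; split=> // s.
rewrite !ge_max => /and3P[Ms s1 es].
rewrite {1}pE subr0 hornerMXaddC.
have s0 : 0 <= s by lra.
have h1 : 1 + `|p.[0]| <= e * s by rewrite mulrC -ler_pdivrMr.
have h2 : e * s <= `|q.[s] * s|.
  by rewrite normrM (ger0_norm s0) ler_wpM2r// He.
have := ler_normD (q.[s] * s + p.[0]) (- p.[0]).
rewrite addrK normrN; lra.
Qed.

Lemma horner_unbounded p : (1 < size p)%N ->
  forall K : R, exists M, forall s, M <= s -> K <= `|p.[s]|.
Proof.
move=> p1 K; have [q pE] := horner_split p 0.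
have q0 : q != 0.
  apply: contraTneq p1 => q0; rewrite pE q0 mul0r add0r size_polyC.
  by case: eqP.
have [M [e [e0 He]]] := horner_away_from0 q0.
exists (Num.max M (Num.max 1 ((`|K| + `|p.[0]|) / e))) => s.
rewrite !ge_max => /and3P[Ms s1 es].
rewrite {1}pE subr0 hornerMXaddC.
have s0 : 0 <= s by lra.
have h1 : `|K| + `|p.[0]| <= e * s by rewrite mulrC -ler_pdivrMr.
have h2 : e * s <= `|q.[s] * s|.
  by rewrite normrM (ger0_norm s0) ler_wpM2r// He.
have := ler_normD (q.[s] * s + p.[0]) (- p.[0]).
rewrite addrK normrN; have := ler_norm K; lra.
Qed.

Lemma horner_ge0_closure p a b : a < b ->
  (forall s, a < s < b -> 0 <= p.[s]) -> 0 <= p.[a].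
Proof.
move=> ab H; rewrite leNgt; apply/negP => pa.
have /cvgrPdist_lt /(_ (- p.[a])) := @continuous_horner R p a.
rewrite oppr_gt0 => /(_ pa) /nbhs_ballP[e /= e0 He].
pose s := a + Num.min (e / 2) ((b - a) / 2).
have m0 : 0 < Num.min (e / 2) ((b - a) / 2) by rewrite lt_min; apply/andP; split; lra.
have sb : a < s < b.
  rewrite /s; have : Num.min (e / 2) ((b - a) / 2) <= (b - a) / 2 by rewrite ge_min lexx orbT.
  lra.
have /He : ball a e s.
  rewrite /ball/= /s opprD addNKr normrN gtr0_norm//.
  by rewrite (@le_lt_trans _ _ (e / 2)) ?ge_min ?lexx//; lra.
have := H _ sb; move=> h1 h2.
have := ler_norm (p.[s] - p.[a]); rewrite distrC in h2; lra.
Qed.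

Lemma horner_ge0_closure_left p a b : b < a ->
  (forall s, b < s < a -> 0 <= p.[s]) -> 0 <= p.[a].
Proof.
move=> ba H; have := @horner_ge0_closure (p \Po (- 'X)) (- a) (- b).
rewrite horner_comp !hornerE opprK; apply; first by lra.
by move=> s sab; rewrite horner_comp !hornerE; apply: H; lra.
Qed.

(* Subtracting the minimum over the half-line creates a root, which is a double
   one unless it is [x] itself. *)
Lemma half_line_ge0_sos x p :
  (forall s, x <= s -> 0 <= p.[s]) -> half_line_sos x p.
Proof.
have [n] := ubnP (size p); elim: n p => // n IH p; rewrite ltnS => pn p0.
have [p1|p1] := leqP (size p) 1.
  rewrite (size1_polyC p1); apply: half_line_sos_of_sos; apply: sosC.
  by have := p0 x (lexx x); rewrite (size1_polyC p1) hornerC coefC eqxx.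
have [M HM] := horner_unbounded p1 (p.[x]).
pose M' := Num.max x M.
have cp : {within `[x, M'], continuous (horner p)}.
  by apply: continuous_subspaceT; exact: continuous_horner.
have xM' : x <= M' by rewrite le_max lexx.
have [c cI cmin] := EVT_min xM' cp.
have xc : x <= c by move: cI; rewrite in_itv => /andP[].
(* [horner_unbounded] bounds |p| from below; as p is nonnegative on the ray the absolute value
   drops, and the minimum over [x, M'] is one over the whole ray. *)
have cmin' s : x <= s -> p.[c] <= p.[s].
  move=> xs; have [sM|Ms] := leP s M'; first by apply: cmin; rewrite in_itv/= xs.
  apply: (@le_trans _ _ p.[x]); first by apply: cmin; rewrite in_itv/= lexx.
  rewrite -[leRHS]ger0_norm ?p0//; apply: HM.
  by rewrite (le_trans _ (ltW Ms))// le_max lexx orbT.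
have /factor_theorem[q qE] : root (p - (p.[c])%:P) c by rewrite rootE !hornerE subrr.
have pE : p = (p.[c])%:P + q * ('X - c%:P) by rewrite -qE addrC subrK.
have qs s : p.[s] - p.[c] = q.[s] * (s - c).
  by have := congr1 (fun p => p.[s]) qE; rewrite !hornerE.
rewrite pE; apply: half_line_sosD.
  by apply: half_line_sos_of_sos; apply: sosC; exact: p0.
have q0 : q != 0.
  apply: contraTneq p1 => q0; rewrite pE q0 mul0r addr0 size_polyC.
  by case: eqP.
have sq : (size q < size p)%N.
  have spc : (size (p - (p.[c])%:P)).-1.+1 = size p.
    rewrite size_addl; first by rewrite prednK// (leq_trans _ p1).
    by rewrite size_opp size_polyC (leq_ltn_trans _ p1)//; case: eqP.
  by rewrite -spc qE size_Mmonic ?monicXsubC// size_XsubC addn2.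
have qge s : c < s -> 0 <= q.[s].
  move=> cs; have : 0 <= q.[s] * (s - c) by rewrite -qs subr_ge0 cmin'//; lra.
  by rewrite pmulr_lge0// subr_gt0.
have qc : 0 <= q.[c].
  by apply: (@horner_ge0_closure _ _ (c + 1)); [lra|move=> s /andP[+ _]; exact: qge].
have [cx|xc'] := leP c x.
  have {}cx : c = x by apply/eqP; rewrite eq_le cx xc.
  subst c; rewrite mulrC; apply: half_line_sosM; first exact: (@half_line_sos_linear _ x).
  apply: IH; first exact: leq_trans sq pn.
  by move=> s; rewrite le_eqVlt => /predU1P[<-//|]; exact: qge.
have qle s : x <= s < c -> q.[s] <= 0.
  move=> /andP[xs sc]; have : 0 <= q.[s] * (s - c) by rewrite -qs subr_ge0 cmin'.
  by rewrite nmulr_lge0// subr_lt0.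
(* For c > x the quotient q is nonpositive on [x, c[ and nonnegative to the right of c, so it
   vanishes at c. *)
have /factor_theorem[r rE] : root q c.
  rewrite rootE eq_le qc andbT -oppr_ge0 -hornerN.
  apply: (@horner_ge0_closure_left _ _ x) => // s /andP[xs sc].
  by rewrite hornerN oppr_ge0 qle// (ltW xs).
have rs s : q.[s] = r.[s] * (s - c).
  by have := congr1 (fun p => p.[s]) rE; rewrite !hornerE.
have rgt s : c < s -> 0 <= r.[s].
  by move=> cs; have := qge _ cs; rewrite rs pmulr_lge0// subr_gt0.
rewrite rE -mulrA -expr2 mulrC; apply: half_line_sosM.
  by apply: half_line_sos_of_sos; exact: sos_sqr.
apply: IH.
  apply: leq_trans pn; apply: leq_trans sq.
  have r0 : r != 0 by apply: contraNneq q0 => r0; rewrite rE r0 mul0r.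
  by rewrite ltnS rE size_Mmonic ?monicXsubC// size_XsubC addn2 /= leqnSn.
move=> s xs; have [cs|sc|<-] := ltgtP c s; first exact: rgt.
  by have := qle s; rewrite xs sc rs nmulr_lle0 ?subr_lt0//; apply.
by apply: (@horner_ge0_closure _ _ (c + 1)); [lra|move=> t /andP[+ _]; exact: rgt].
Qed.

End sums_of_squares.

(** * Polynomial approximation of step functions *)

Section threshold_polynomials.
Context {R : realType}.
Implicit Types (x t a M : R).

Lemma bernoulli_ineq x n : 0 <= x -> 1 + n%:R * x <= (1 + x) ^+ n.
Proof.
move=> x0; elim: n => [|n IH]; first by rewrite mul0r addr0 expr0.
rewrite exprS -natr1; apply: (@le_trans _ _ ((1 + x) * (1 + n%:R * x))).
  rewrite mulrDl mul1r mulrDl mul1r mulrDr mulr1.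
  have : 0 <= x * (n%:R * x) by rewrite !mulr_ge0.
  lra.
by rewrite ler_wpM2l//; lra.
Qed.

Lemma onemX_le x n : 0 <= x <= 1 -> (1 - x) ^+ n * (1 + n%:R * x) <= 1.
Proof.
move=> /andP[x0 x1]; apply: (@le_trans _ _ ((1 - x) ^+ n * (1 + x) ^+ n)).
  by rewrite ler_wpM2l// ?bernoulli_ineq// exprn_ge0//; lra.
rewrite -exprMn exprn_ile1//; last by nra.
by rewrite mulr_ge0; lra.
Qed.

Lemma onemX_ge x n : 0 <= x <= 1 -> 1 - n%:R * x <= (1 - x) ^+ n.
Proof.
move=> /andP[x0 x1]; elim: n => [|n IH]; first by rewrite mul0r subr0 expr0.
rewrite exprS -natr1; apply: (@le_trans _ _ ((1 - x) * (1 - n%:R * x))).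
  have : 0 <= x * (n%:R * x) by rewrite !mulr_ge0.
  by rewrite mulrDl mul1r mulrBl mul1r mulrBr mulr1; lra.
by rewrite ler_wpM2l//; lra.
Qed.

(* With [N = (n + 5) ^ 2], the polynomial [1 - (1 - u ^ N) ^ (2 ^ N)] jumps from
   0 to 1 at [u = 1/2]; the shift of [u] by [1 / (n + 5)] makes the value at the
   jump converge to 0. *)
Lemma threshold_poly M a : exists q : nat -> {poly R},
  (forall n t, `|t| <= M -> 0 <= (q n).[t] <= 1) /\
  (forall t, `|t| <= M -> (q n).[t] @[n --> \oo] --> ((a < t)%R%:R : R)).
Proof.
(* K gives |(t - a) / K| <= 1/4, and the offset 5 gives e <= 1/5, so that v = 1/2 + (t - a) / K - e
   stays in [0, 1]. *)
pose K : R := 4 * (`|M| + `|a| + 1).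
have K4 : 4 <= K by rewrite /K; have := normr_ge0 M; have := normr_ge0 a; lra.
pose e n : R := (n.+4.+1%:R)^-1.
have e0 n : 0 < e n by rewrite invr_gt0.
have e5 n : e n <= 1 / 5.
  by rewrite /e div1r lef_pV2 ?posrE// ler_nat.
pose N n := (n.+4.+1 ^ 2)%N.
pose v n : {poly R} := K^-1 *: ('X - a%:P) + (1 / 2 - e n)%:P.
pose q n : {poly R} := 1 - (1 - v n ^+ N n) ^+ (2 ^ N n).
have vE n t : (v n).[t] = (t - a) / K + 1 / 2 - e n.
  by rewrite /v !hornerE/=; ring.
have qE n t : (q n).[t] = 1 - (1 - (v n).[t] ^+ N n) ^+ (2 ^ N n).
  by rewrite /q !(hornerE, horner_exp).
have ta t : `|t| <= M -> `|(t - a) / K| <= 1 / 4.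
  move=> tM; rewrite normrM normrV ?unitfE ?gt_eqF//; last by lra.
  rewrite (@gtr0_norm _ K); last by lra.
  rewrite ler_pdivrMr; last by lra.
  rewrite /K; have := ler_normB t a; have := ler_norm M; lra.
have v01 n t : `|t| <= M -> 0 <= (v n).[t] <= 1.
  move=> /ta; rewrite vE ler_norml => /andP[? ?].
  have := e5 n; have := e0 n => *; apply/andP; split; lra.
have vN01 n t : `|t| <= M -> 0 <= (v n).[t] ^+ N n <= 1.
  by move=> /(v01 n)/andP[? ?]; rewrite exprn_ge0// exprn_ile1.
have q01 n t : `|t| <= M -> 0 <= (q n).[t] <= 1.
  move=> /(vN01 n)/andP[? ?]; rewrite qE.
  have h : 0 <= 1 - (v n).[t] ^+ N n <= 1 by apply/andP; split; lra.
  have : 0 <= (1 - (v n).[t] ^+ N n) ^+ (2 ^ N n) <= 1.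
    by case/andP: h => *; rewrite exprn_ge0// exprn_ile1.
  by move=> /andP[? ?]; apply/andP; split; lra.
exists q; split=> // t tM.
(* Thus N e = 1/e is unbounded. For t <= a one has 2 v <= 1 - 2 e, and (2 v)^N <= (1 - 2 e)^N <= 1 /
   (1 + 2 N e) is of order e. *)
have NE n : (N n)%:R * e n ^+ 2 = 1.
  by rewrite /N /e natrX -exprMn divff ?expr1n// pnatr_eq0.
have harmE n : e n <= harmonic n by rewrite /e /harmonic/= lef_pV2 ?posrE// ler_nat; lia.
have [at_|ta'] := ltP a t; last first.
  have qle n : (q n).[t] <= harmonic n.
    apply: le_trans (harmE n); rewrite qE.
    have := onemX_ge (2 ^ N n) (vN01 n t tM).
    suff : (2 ^ N n)%:R * (v n).[t] ^+ N n <= e n by lra.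
    rewrite natrX -exprMn.
    have h1 : 0 <= (2 * (v n).[t]) <= 1 - 2 * e n.
      have /andP[? ?] := v01 n t tM; apply/andP; split; first by lra.
      rewrite vE; suff : (t - a) / K <= 0 by lra.
      by rewrite ler_pdivrMr ?mul0r; lra.
    apply: (@le_trans _ _ ((1 - 2 * e n) ^+ N n)).
      by case/andP: h1 => *; rewrite lerXn2r// nnegrE; lra.
    have h2 : 0 <= 2 * e n <= 1 by have := e0 n; have := e5 n; lra.
    have := onemX_le (N n) h2.
    have -> : 1 + (N n)%:R * (2 * e n) = 1 + 2 / e n.
      have -> : 2 / e n = 2 * ((N n)%:R * e n ^+ 2) / e n by rewrite NE mulr1.
      by field; rewrite gt_eqF.
    have x0 : 0 <= (1 - 2 * e n) ^+ N n by rewrite exprn_ge0//; lra.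
    move: ((1 - 2 * e n) ^+ N n) x0 => x x0 h.
    have : x * 2 / e n <= 1 by rewrite -mulrA; lra.
    by rewrite ler_pdivrMr// mul1r; lra.
  apply: (@squeeze_cvgr _ _ _ _ (cst 0) harmonic) => //.
  - by near=> n; rewrite qle andbT; case/andP: (q01 n t tM).
  - exact: cvg_cst.
  - exact: cvg_harmonic.
(* For t > a one has 2 v >= 1 + 2 dl as soon as e < dl. Then (2 v)^N >= 1 + 2 N dl, while (1 -
   y)^(2^N) <= 1 / (1 + 2^N y) with y = v^N. *)
pose dl := (t - a) / K / 2.
have dl0 : 0 < dl by rewrite !divr_gt0//; lra.
have qge : \forall n \near \oo, 1 - (2 * dl)^-1 * harmonic n <= (q n).[t].
  near=> n.
  have hdl : harmonic n < dl by near: n; exact: (cvgr_lt 0 (@cvg_harmonic R)).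
  have hdl' : e n < dl by apply: le_lt_trans hdl; exact: harmE.
  rewrite qE; suff : (1 - (v n).[t] ^+ N n) ^+ (2 ^ N n) <= (2 * dl)^-1 * harmonic n by lra.
  have := onemX_le (2 ^ N n) (vN01 n t tM).
  rewrite natrX -exprMn.
  have /andP[w0 w1] := vN01 n t tM.
  have : 0 <= (1 - (v n).[t] ^+ N n) ^+ (2 ^ N n) by rewrite exprn_ge0//; lra.
  move: (_ ^+ (2 ^ N n)) => y y0 hy.
  have h1 : 1 + 2 * dl <= 2 * (v n).[t].
    have : (t - a) / K = 2 * dl by rewrite /dl; field; lra.
    by rewrite vE; lra.
  have h2 : 1 + (N n)%:R * (2 * dl) <= (2 * (v n).[t]) ^+ N n.
    apply: le_trans (bernoulli_ineq _ _) _; first by lra.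
    by rewrite lerXn2r// nnegrE; lra.
  have h3 : n.+1%:R <= (N n)%:R :> R.
    rewrite ler_nat /N expnS expn1; apply: (@leq_trans n.+4.+1); first by lia.
    by rewrite leq_pmulr.
  rewrite /harmonic/= -invfM -[leRHS]mul1r ler_pdivlMr; last by rewrite mulr_gt0//; lra.
  have h4 : n.+1%:R * (2 * dl) <= (N n)%:R * (2 * dl) by rewrite ler_wpM2r//; lra.
  apply: le_trans hy; rewrite ler_wpM2l// mulrC; lra.
apply: (@squeeze_cvgr _ _ _ _ (fun n => 1 - (2 * dl)^-1 * harmonic n) (cst 1)) => //.
- by apply: filterS qge => n ->; case/andP: (q01 n t tM).
- rewrite -[X in _ --> X]subr0; apply: cvgB; first exact: cvg_cst.
  by rewrite -[X in _ --> X](mulr0 (2 * dl)^-1); apply: cvgMr; exact: cvg_harmonic.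
- exact: cvg_cst.
Unshelve. all: by end_near. Qed.

End threshold_polynomials.

Lemma indic01 {T : Type} {R : realType} (A : set T) x : 0 <= (\1_A x : R) <= 1.
Proof. by rewrite indicE; case: (_ \in _) => /=; rewrite ?lexx ?ler01. Qed.

(** * Dominated convergence and linearity of real integrals *)

Section convergence_of_integrals.
Context {dT : measure_display} {T : measurableType dT} {R : realType}.
Implicit Types (mu : {measure set T -> \bar R}) (D : set T) (f g h : T -> R).

Lemma Rdominated_convergence mu D (f_ : nat -> T -> R) f g : measurable D ->
  (forall n, measurable_fun D (f_ n)) ->
  (forall x, D x -> f_ n x @[n --> \oo] --> f x) ->
  mu.-integrable D (EFin \o g) ->
  (forall n x, D x -> `|f_ n x| <= g x) ->
  mu.-integrable D (EFin \o f) /\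
  \int[mu]_(x in D) f_ n x @[n --> \oo] --> \int[mu]_(x in D) f x.
Proof.
move=> mD mf_ f_f ig f_g.
have mf : measurable_fun D f by exact: (measurable_fun_cvg mf_ f_f).
have [|||||if_ _ c] := @dominated_convergence _ _ _ mu D mD
  (fun n => EFin \o f_ n) (EFin \o f) (EFin \o g).
- by move=> n; exact/measurable_EFinP.
- exact/measurable_EFinP.
- by apply: aeW => x Dx; apply: cvg_EFin; [exact: nearW|exact: f_f].
- by [].
- by apply: aeW => x n Dx; rewrite lee_fin f_g.
split=> //; rewrite /Rintegral; apply: fine_cvg.
by rewrite fineK//; exact: integrable_fin_num.
Qed.

Lemma integrable_bounded_by mu D f g : measurable D -> measurable_fun D f ->
  mu.-integrable D (EFin \o g) -> (forall x, D x -> `|f x| <= g x) ->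
  mu.-integrable D (EFin \o f).
Proof.
move=> mD mf ig fg; apply: le_integrable ig => //; first exact/measurable_EFinP.
by move=> x Dx /=; rewrite lee_fin (le_trans (fg _ Dx))// ler_norm.
Qed.

Lemma integrable_realD mu D f g : measurable D -> mu.-integrable D (EFin \o f) ->
  mu.-integrable D (EFin \o g) -> mu.-integrable D (EFin \o (fun x => f x + g x)).
Proof. by move=> mD jf jg; exact: (integrableD mD jf jg). Qed.

Lemma integrable_realB mu D f g : measurable D -> mu.-integrable D (EFin \o f) ->
  mu.-integrable D (EFin \o g) -> mu.-integrable D (EFin \o (fun x => f x - g x)).
Proof. by move=> mD jf jg; exact: (integrableB mD jf jg). Qed.

Lemma integrable_realZ mu D f (c : R) : measurable D -> mu.-integrable D (EFin \o f) ->
  mu.-integrable D (EFin \o (fun x => c * f x)).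
Proof. by move=> mD jf; exact: (integrableZl mD c jf). Qed.

Lemma integrable_real_sum I (s : seq I) mu D (F : I -> T -> R) : measurable D ->
  (forall i, mu.-integrable D (EFin \o F i)) ->
  mu.-integrable D (EFin \o (fun x => \sum_(i <- s) F i x)).
Proof.
move=> mD iF; elim: s => [|i s IH].
  rewrite (_ : (fun x => _) = fun=> 0); last by apply/funext => x; rewrite big_nil.
  exact: integrable0.
rewrite (_ : (fun x => _) = (fun x => F i x + \sum_(j <- s) F j x)).
  exact: integrable_realD.
by apply/funext => x; rewrite big_cons.
Qed.

Lemma Rintegral_sum I (s : seq I) mu D (F : I -> T -> R) : measurable D ->
  (forall i, mu.-integrable D (EFin \o F i)) ->
  \int[mu]_(x in D) (\sum_(i <- s) F i x) = \sum_(i <- s) \int[mu]_(x in D) F i x.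
Proof.
move=> mD iF; elim: s => [|i s IH].
  under eq_Rintegral do rewrite big_nil.
  by rewrite big_nil Rintegral_cst// mul0r.
under eq_Rintegral do rewrite big_cons.
by rewrite RintegralD// ?IH ?big_cons//; exact: integrable_real_sum.
Qed.

Lemma integrable_indic mu D A : measurable D -> measurable A -> (mu D < +oo)%E ->
  mu.-integrable D (EFin \o (\1_A : T -> R)).
Proof.
move=> mD mA fD; apply: measurable_bounded_integrable => //.
exists 1; split=> // M M1 x _; have /andP[? ?] := @indic01 _ R A x.
by rewrite /= ger0_norm// (le_trans _ (ltW M1)).
Qed.

Lemma Rintegral_indic mu D A : measurable D -> measurable A ->
  \int[mu]_(x in D) \1_A x = fine (mu (A `&` D)).
Proof. by move=> mD mA; rewrite /Rintegral integral_indic. Qed.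

Lemma cvg_prod_ord d (u : 'I_d -> nat -> R) (l : 'I_d -> R) :
  (forall i, u i n @[n --> \oo] --> l i) ->
  \prod_(i < d) u i n @[n --> \oo] --> \prod_(i < d) l i.
Proof.
elim: d u l => [|d IH] u l ul.
  by under eq_fun do rewrite big_ord0; rewrite big_ord0; exact: cvg_cst.
under eq_fun do rewrite big_ord_recl; rewrite big_ord_recl.
by apply: cvgM; [exact: ul|apply: IH => i; exact: ul].
Qed.

(** The threshold polynomials are controlled on [-M, M], so the X i are bounded where h does not
    vanish; |h| then dominates every product. *)
Lemma cvg_threshold d mu D h (X : 'I_d -> T -> R) M (a : 'I_d -> R)
    (q : 'I_d -> nat -> {poly R}) : measurable D ->
  (forall i n t, `|t| <= M -> 0 <= (q i n).[t] <= 1) ->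
  (forall i t, `|t| <= M -> (q i n).[t] @[n --> \oo] --> ((a i < t)%R%:R : R)) ->
  mu.-integrable D (EFin \o h) -> (forall i, measurable_fun D (X i)) ->
  (forall x, D x -> h x != 0 -> forall i, `|X i x| <= M) ->
  \int[mu]_(x in D) (h x * \prod_(i < d) (q i n).[X i x]) @[n --> \oo] -->
  \int[mu]_(x in D) (h x * \prod_(i < d) (a i < X i x)%R%:R).
Proof.
move=> mD q01 qc ih mX hX.
have mh : measurable_fun D h by apply/measurable_EFinP; exact: measurable_int ih.
have [] // := @Rdominated_convergence mu D
  (fun n x => h x * \prod_(i < d) (q i n).[X i x])
  (fun x => h x * \prod_(i < d) (a i < X i x)%R%:R) (fun x => `|h x|) mD.
- move=> n; apply: measurable_funM => //; apply: measurable_prod => i _.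
  apply: (@measurableT_comp _ _ _ _ _ _ (horner (q i n))); last exact: mX.
  by apply: continuous_measurable_fun; exact: continuous_horner.
- move=> x Dx; have [->|h0] := eqVneq (h x) 0.
    by under eq_fun do rewrite mul0r; rewrite mul0r; exact: cvg_cst.
  apply: cvgM; first exact: cvg_cst.
  by apply: cvg_prod_ord => i; apply: qc; exact: hX.
- exact: integrable_norm ih.
- move=> n x Dx; rewrite normrM; have [->|h0] := eqVneq (h x) 0.
    by rewrite normr0 mul0r.
  rewrite -[leRHS]mulr1 ler_wpM2l// normr_prod prodr_ile1// => i.
  have /andP[q0 q1] := q01 i n _ (hX x Dx h0 i).
  by rewrite normr_ge0 /= ger0_norm.
Qed.

End convergence_of_integrals.

(** * Measures on the half-line *)

Section half_line_measures.
Context {R : realType}.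
Implicit Types (nu tau : {measure set R -> \bar R}) (p : {poly R}).
Local Notation D := (`[0%R, +oo[%classic : set R).

Lemma half_line_moment_measure_lty nu : half_line_moment_measure nu ->
  (nu setT < +oo)%E.
Proof.
move=> [n0 ni]; have -> : [set: R] = `]-oo, 0[ `|` D.
  apply/seteqP; split => // x _; rewrite /= !in_itv /= andbT.
  by have [|] := ltP x 0; [left|right].
have nD : (nu D < +oo)%E.
  have /integrableP[_] := ni 1.
  under eq_integral do rewrite hornerC abse_EFin normr1.
  by rewrite integral_cst// mul1e.
apply: le_lt_trans nD; rewrite -[leRHS]add0e -n0.
exact: measureU2.
Qed.

Lemma half_line_measureE nu A : nu `]-oo, 0[%classic = 0%E ->
  measurable A -> nu (A `&` D) = nu A.
Proof.
move=> n0 mA; apply/eqP; rewrite eq_le; apply/andP; split.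
  by rewrite le_measure ?inE//; exact: measurableI.
rewrite -[leRHS]adde0 -n0.
apply: le_trans (measureU2 _ _ _) => //; last exact: measurableI.
rewrite le_measure ?inE//; first by apply: measurableU => //; exact: measurableI.
move=> x Ax; rewrite /= !in_itv /= andbT.
by have [|] := ltP x 0; [right|left].
Qed.

Lemma half_line_measure_ext nu tau : nu `]-oo, 0[%classic = 0%E ->
  tau `]-oo, 0[%classic = 0%E -> (nu setT < +oo)%E ->
  (forall b, 0 < b -> nu (`]-oo, b[ `&` D) = tau (`]-oo, b[ `&` D)) ->
  forall A, measurable A -> nu A = tau A.
Proof.
move=> n0 t0 nf H.
apply: (@measure_unique _ _ _ (@RGenInftyO.G R) (fun k => `]-oo, k%:R[%classic)).
- exact: RGenInftyO.measurableE.
- move=> _ _ [x ->] [y ->]; exists (Num.min x y).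
  apply/seteqP; split => z /=; rewrite !in_itv/= lt_min; last by move=> /andP.
  by move=> [-> ->].
- by move=> i; exists i%:R.
- apply/seteqP; split => // x _; exists (Num.trunc `|x|).+1 => //=.
  by rewrite in_itv/= (le_lt_trans (ler_norm x))// truncnS_gt.
- move=> _ [b ->]; have [b0|b0] := ltP 0 b.
    by rewrite -(half_line_measureE n0)// H// half_line_measureE.
  have le (m : {measure set R -> \bar R}) : m `]-oo, 0[%classic = 0%E -> m `]-oo, b[%classic = 0%E.
    move=> m0; apply/eqP; rewrite -measure_le0 -m0 le_measure ?inE//.
    by move=> x /=; rewrite !in_itv /= => /lt_le_trans; apply.
  by rewrite !le.
- by move=> k; apply: le_lt_trans nf; rewrite le_measure ?inE.
Qed.

End half_line_measures.

(** * Indeterminate moment problems on the half-line *)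

Section orthonormal_polynomials.
Context {R : realType}.
Variable L : {poly R} -> R.
Hypothesis Llin : forall c p q, L (c *: p + q) = c * L p + L q.
Hypothesis Lpos : forall p, p != 0 -> 0 < L (p ^+ 2).
Implicit Types (p q r : {poly R}).

Lemma functional0 : L 0 = 0.
Proof. by have := Llin 1 0 0; rewrite scaler0 addr0 mul1r; lra. Qed.

Lemma functionalZ c p : L (c *: p) = c * L p.
Proof. by have := Llin c p 0; rewrite addr0 functional0 addr0. Qed.

Lemma functionalD p q : L (p + q) = L p + L q.
Proof. by have := Llin 1 p q; rewrite scale1r mul1r. Qed.

Lemma functionalB p q : L (p - q) = L p - L q.
Proof. by rewrite functionalD -scaleN1r functionalZ mulN1r. Qed.

Lemma functional_sum I (s : seq I) (P : pred I) (F : I -> {poly R}) :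
  L (\sum_(i <- s | P i) F i) = \sum_(i <- s | P i) L (F i).
Proof. exact: (big_morph L functionalD functional0). Qed.

Let proj (s : seq {poly R}) p := p - \sum_(q <- s) L (p * q) *: q.

(** The recursion carries the list of all earlier polynomials, since each projection needs every one
    of them; [orth n] reads off the last entry. *)
Let gram_schmidt := fix gs n := if n is n'.+1 then
  rcons (gs n') ((Num.sqrt (L (proj (gs n') 'X^n' ^+ 2)))^-1 *: proj (gs n') 'X^n')
  else [::].

Let orth n := nth 0 (gram_schmidt n.+1) n.

Let size_gram_schmidt n : size (gram_schmidt n) = n.
Proof. by elim: n => //= n IH; rewrite size_rcons IH. Qed.

Let gram_schmidtE n : gram_schmidt n = [seq orth i | i <- iota 0 n].
Proof.
elim: n => // n IH; rewrite -addn1 iotaD map_cat /= -IH add0n addn1 cats1.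
by rewrite /= /orth /= nth_rcons size_gram_schmidt ltnn eqxx.
Qed.

Let orthE n : orth n = let p := 'X^n - \sum_(i < n) L ('X^n * orth i) *: orth i in
  (Num.sqrt (L (p ^+ 2)))^-1 *: p.
Proof.
rewrite {1}/orth /= nth_rcons size_gram_schmidt ltnn eqxx /proj gram_schmidtE.
rewrite big_map -(big_mkord xpredT (fun i => L ('X^n * orth i) *: orth i)).
by rewrite /index_iota subn0.
Qed.

Lemma orthonormal_polys : exists P : nat -> {poly R},
  (forall i j, L (P i * P j) = (i == j)%:R) /\ (forall i, size (P i) = i.+1).
Proof.
exists orth.
suff H n : (forall i j, (i < n)%N -> (j < n)%N -> L (orth i * orth j) = (i == j)%:R)
    /\ (forall i, (i < n)%N -> size (orth i) = i.+1).
  split=> [i j|i]; last exact: (H i.+1).2.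
  by apply: (H (maxn i j).+1).1; lia.
elim: n => // n [IH1 IH2].
pose p := 'X^n - \sum_(i < n) L ('X^n * orth i) *: orth i.
have sum_lt : (size (\sum_(i < n) L ('X^n * orth i) *: orth i)%R < n.+1)%N.
  rewrite ltnS; apply: (leq_trans (size_sum _ _ _)); apply/bigmax_leqP => i _.
  by rewrite (leq_trans (size_scale_leq _ _))// IH2.
have sp : size p = n.+1 by rewrite size_addl size_polyXn// size_opp.
have p0 : p != 0 by rewrite -size_poly_eq0 sp.
have c0 : 0 < Num.sqrt (L (p ^+ 2)) by rewrite sqrtr_gt0 Lpos.
have oE : orth n = (Num.sqrt (L (p ^+ 2)))^-1 *: p by rewrite orthE.
have sn : size (orth n) = n.+1.
  by rewrite oE size_scale// invr_eq0 gt_eqF.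
have oin i : (i < n)%N -> L (orth n * orth i) = 0.
  move=> ni; rewrite oE -scalerAl functionalZ.
  suff -> : L (p * orth i) = 0 by rewrite mulr0.
  rewrite /p mulrBl functionalB mulr_suml functional_sum.
  rewrite (bigD1 (Ordinal ni)) //= -scalerAl functionalZ IH1// eqxx mulr1.
  rewrite big1 ?addr0 ?subrr// => j /eqP jni.
  rewrite -scalerAl functionalZ IH1//; case: eqP => [ji|]; last by rewrite mulr0.
  by case: jni; apply: val_inj.
have onn : L (orth n * orth n) = 1.
  rewrite oE -scalerAl -scalerAr !functionalZ -expr2 mulrA -invfM -expr2 sqr_sqrtr.
    by rewrite mulVf// gt_eqF// Lpos.
  by rewrite ltW// Lpos.
split=> [i j|i]; rewrite ltnS leq_eqVlt => /predU1P[->|ni]; last exact: IH2.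
- rewrite ltnS leq_eqVlt => /predU1P[->|nj]; first by rewrite onn eqxx.
  by rewrite oin// gtn_eqF.
- rewrite ltnS leq_eqVlt => /predU1P[->|nj]; last exact: IH1.
  by rewrite mulrC oin// ltn_eqF.
- by [].
Qed.

Variable P : nat -> {poly R}.
Hypothesis PP : forall i j, L (P i * P j) = (i == j)%:R.
Hypothesis Psize : forall i, size (P i) = i.+1.

Lemma orthonormal_expansion n p : (size p <= n)%N ->
  p = \sum_(j < n) L (p * P j) *: P j.
Proof.
suff H : forall n p, (size p <= n)%N ->
    exists c : nat -> R, p = \sum_(j < n) c j *: P j.
- move=> /H[c ->]; apply: eq_bigr => i _; congr (_ *: _).
  rewrite mulr_suml functional_sum (bigD1 i) //= big1 ?addr0.
    by rewrite -scalerAl functionalZ PP eqxx mulr1.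
  move=> j ji; rewrite -scalerAl functionalZ PP.
    by have /negbTE -> : val j != val i by []; rewrite mulr0.
- move=> {}n {}p; elim: n p => [|n IH] p.
    by rewrite leqn0 size_poly_eq0 => /eqP ->; exists (fun=> 0); rewrite big_ord0.
  move=> pn; pose c := p`_n / lead_coef (P n).
  have lc : lead_coef (P n) != 0 by rewrite lead_coef_eq0 -size_poly_eq0 Psize.
  have [|b pE] := IH (p - c *: P n).
    apply/leq_sizeP => j; rewrite leq_eqVlt => /predU1P[<-|nj].
      rewrite coefB coefZ /c; have -> : (P n)`_n = lead_coef (P n).
        by rewrite lead_coefE Psize.
      by rewrite divfK// subrr.
    rewrite coefB coefZ (leq_sizeP _ _ pn)// nth_default ?mulr0 ?subr0//.
    by rewrite Psize.
  exists (fun j => if j == n then c else b j).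
  rewrite big_ord_recr /= eqxx -[LHS](subrK (c *: P n)) {1}pE; congr (_ + _).
  by apply: eq_bigr => i _; rewrite ltn_eqF.
Qed.

Lemma orthonormal_lower n p : (size p <= n)%N -> L (P n * p) = 0.
Proof.
move=> pn; rewrite (orthonormal_expansion pn) mulr_sumr functional_sum.
rewrite big1// => i _; rewrite -scalerAr functionalZ PP gtn_eqF ?mulr0//.
Qed.

Lemma orthonormal_parseval n p : (size p <= n)%N ->
  L (p ^+ 2) = \sum_(j < n) L (p * P j) ^+ 2.
Proof.
move=> pn; rewrite expr2 {2}(orthonormal_expansion pn) mulr_sumr functional_sum.
by apply: eq_bigr => i _; rewrite -scalerAr functionalZ.
Qed.

End orthonormal_polynomials.

(** * Integrals of polynomials against powers of 1/(t + 1) *)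

Section rational_moments.
Context {R : realType}.
Implicit Types (nu tau : {measure set R -> \bar R}) (p q : {poly R}).
Local Notation D := (`[0%R, +oo[%classic : set R).

Lemma measurable_horner p : measurable_fun setT (horner p).
Proof. by apply: continuous_measurable_fun; exact: continuous_horner. Qed.

Lemma measurable_rational p j (E : set R) :
  measurable_fun E (fun t : R => p.[t] / (t + 1) ^+ j).
Proof.
apply: (@measurable_funS _ _ _ _ setT) => //.
apply: measurable_funM; first exact: measurable_horner.
apply: (measurableT_comp measurable_inv).
by apply: measurable_funX; apply: measurable_funD.
Qed.

(** For j = 0 this is the moment functional. Multiplying p by X + 1 raises j by one ([wint_shift]),
    so splitting off the value at -1 reduces index j + 1 to index j and to the integral of (t +
    1)^-(j+1). *)
Definition wint nu j p := \int[nu]_(t in D) (p.[t] / (t + 1) ^+ j).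

Lemma horner_bounded p (K : R) : exists M, forall u, `|u| <= K -> `|p.[u]| <= M.
Proof.
elim/poly_ind: p => [|p c [M HM]]; first by exists 0 => u _; rewrite horner0 normr0.
exists (M * `|K| + `|c|) => u uK; rewrite !hornerE (le_trans (ler_normD _ _))//.
rewrite lerD2r normrM ler_pM// ?HM//.
by rewrite (le_trans uK)// ler_norm.
Qed.

Section positive_measure.
Variable nu : {measure set R -> \bar R}.
Hypothesis hnu : half_line_moment_measure nu.

Lemma integrable_poly_bounded (f : R -> R) p : measurable_fun D f ->
  (forall t, 0 <= t -> `|f t| <= `|p.[t]|) -> nu.-integrable D (EFin \o f).
Proof.
move=> mf fp; apply: (le_integrable _ _ _ (hnu.2 p)) => //.
  exact/measurable_EFinP.
by move=> t /=; rewrite in_itv/= andbT => t0; rewrite lee_fin fp.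
Qed.

Lemma integrable_rational j p :
  nu.-integrable D (EFin \o (fun t => p.[t] / (t + 1) ^+ j)).
Proof.
apply: (@integrable_poly_bounded _ p); first exact: measurable_rational.
move=> t t0; rewrite normrM ler_piMr// normfV invf_le1.
  by rewrite normrX exprn_ege1// ger0_norm; lra.
by rewrite normr_gt0 expf_neq0//; lra.
Qed.

Lemma wint_linear j c p q : wint nu j (c *: p + q) = c * wint nu j p + wint nu j q.
Proof.
rewrite /wint -RintegralZl//; last exact: integrable_rational.
rewrite -RintegralD//; last first.
- exact: integrable_rational.
- have -> : (fun t => c * (p.[t] / (t + 1) ^+ j)) = (fun t => (c *: p).[t] / (t + 1) ^+ j).
    by apply/funext => t; rewrite hornerZ mulrA.
  exact: integrable_rational.
by apply: eq_Rintegral => t _; rewrite hornerD hornerZ mulrDl mulrA.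
Qed.

Lemma wintD j p q : wint nu j (p + q) = wint nu j p + wint nu j q.
Proof. exact: (functionalD (wint_linear j)). Qed.

Lemma wintZ j c p : wint nu j (c *: p) = c * wint nu j p.
Proof. exact: (functionalZ (wint_linear j)). Qed.

Lemma wintB j p q : wint nu j (p - q) = wint nu j p - wint nu j q.
Proof. exact: (functionalB (wint_linear j)). Qed.

Lemma wint_sum j I (s : seq I) (P : pred I) (F : I -> {poly R}) :
  wint nu j (\sum_(i <- s | P i) F i) = \sum_(i <- s | P i) wint nu j (F i).
Proof. exact: (functional_sum (wint_linear j)). Qed.

Lemma wint_le i j p q :
  (forall t, 0 <= t -> p.[t] / (t + 1) ^+ i <= q.[t] / (t + 1) ^+ j) ->
  wint nu i p <= wint nu j q.
Proof.
move=> pq; apply: le_Rintegral => //; try exact: integrable_rational.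
by move=> t /=; rewrite in_itv/= andbT => t0; exact: pq.
Qed.

Lemma wint_ge0 j p : (forall t, 0 <= t -> 0 <= p.[t]) -> 0 <= wint nu j p.
Proof.
move=> p0; apply: Rintegral_ge0 => t /=; rewrite in_itv/= andbT => t0.
by rewrite divr_ge0 ?p0// exprn_ge0//; lra.
Qed.

End positive_measure.

Lemma wint_shift nu j q : wint nu j.+1 (q * ('X - (-1)%:P)) = wint nu j q.
Proof.
apply: eq_Rintegral => t; rewrite inE/= in_itv/= andbT => t0.
rewrite !hornerE opprK exprS; field; rewrite expf_neq0//=; lra.
Qed.

Lemma discriminant_le (a b c : R) :
  (forall t, 0 <= a - 2 * t * b + t ^+ 2 * c) -> b ^+ 2 <= a * c.
Proof.
move=> H; have [c0|c0|c0] := ltgtP c 0.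
- have a0 := H 0.
  (* For c < 0 the quadratic is negative at s = max(1, (a + 2|b| + 1) / (-c)), since then s^2 c <= -
     s (a + 2|b| + 1). The first summand of the witness is 0. *)
  have := H ((2 * b + `|b|*2 + a + 1) / c * 0 + Num.max 1 ((a + 2 * `|b| + 1) / - c)).
  set s := Num.max _ _; rewrite mulr0 add0r.
  have s1 : 1 <= s by rewrite le_max lexx.
  have s2 : a + 2 * `|b| + 1 <= s * - c.
    by rewrite -ler_pdivrMr ?oppr_gt0// le_max lexx orbT.
  have := ler_norm (- b); rewrite normrN => hb.
  nra.
- have := H (b / c).
  have -> : a - 2 * (b / c) * b + (b / c) ^+ 2 * c = (a * c - b ^+ 2) / c.
    by field; rewrite gt_eqF.
  by rewrite pmulr_lge0 ?invr_gt0// subr_ge0.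
- rewrite c0 mulr0 in H *.
  suff -> : b = 0 by rewrite expr0n.
  apply/eqP; apply/contraT => b0.
  have := H ((a + 1) / (2 * b)).
  have -> : a - 2 * ((a + 1) / (2 * b)) * b + ((a + 1) / (2 * b)) ^+ 2 * 0 = -1 by field.
  lra.
Qed.

Lemma wint_cauchy_schwarz nu (hnu : half_line_moment_measure nu) j p q :
  wint nu j (p * q) ^+ 2 <= wint nu j (p ^+ 2) * wint nu j (q ^+ 2).
Proof.
apply: discriminant_le => t.
have -> : wint nu j (p ^+ 2) - 2 * t * wint nu j (p * q) + t ^+ 2 * wint nu j (q ^+ 2)
    = wint nu j ((p - t *: q) ^+ 2).
  rewrite -!(wintZ hnu) -wintB// -wintD//; congr (wint _ _ _).
  rewrite -!mul_polyC !rmorphM ?rmorphXn /= (rmorph_nat (@polyC R)); ring.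
by apply: wint_ge0 => s _; rewrite horner_exp sqr_ge0.
Qed.

End rational_moments.

(** * Indeterminacy bounds the evaluation at -1 *)

Section indeterminate.
Context {R : realType}.
Implicit Types (nu tau : {measure set R -> \bar R}) (p q : {poly R}).
Local Notation D := (`[0%R, +oo[%classic : set R).

(** In p = q (X + 1) + p(-1) the quotient contributes equally to both measures by [Lj], so the
    difference of the two functionals of index j + 1 is h times evaluation at -1. Each functional is
    bounded by Cauchy-Schwarz, because (t + 1)^-(j+1) <= 1. *)
Lemma bounded_evaluation_of_kernel nu tau j :
  half_line_moment_measure nu -> half_line_moment_measure tau ->
  (forall p, wint nu 0 p = wint tau 0 p) ->
  (forall p, wint nu j p = wint tau j p) ->
  wint nu j.+1 1 <> wint tau j.+1 1 ->
  exists C, 0 < C /\ forall p, p.[-1] ^+ 2 <= C * wint nu 0 (p ^+ 2).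
Proof.
move=> hnu htau L0 Lj Lj1.
pose h := wint nu j.+1 1 - wint tau j.+1 1.
have h0 : h != 0 by rewrite subr_eq0; exact/eqP.
have pE p : p.[-1] * h = wint nu j.+1 p - wint tau j.+1 p.
  have [q {2 3}->] := horner_split p (-1).
  rewrite (wintD hnu) (wintD htau) !wint_shift Lj.
  by rewrite -[(p.[-1])%:P]mulr1 mul_polyC !(wintZ hnu, wintZ htau) /h; ring.
have sq (m : {measure set R -> \bar R}) (hm : half_line_moment_measure m) p :
    wint m j.+1 p ^+ 2 <= wint m 0 1 * wint m 0 (p ^+ 2).
  rewrite -{1}[p]mul1r; apply: le_trans (wint_cauchy_schwarz hm _ _ _) _.
  rewrite expr1n ler_pM//.
  - by apply: wint_ge0 => t _; rewrite hornerC.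
  - by apply: wint_ge0 => t _; rewrite horner_exp sqr_ge0.
  - apply: wint_le => // t t0; rewrite hornerC expr0 ler_wpM2l//.
    by rewrite invr1 invf_le1 ?exprn_ege1 ?exprn_gt0; lra.
  - apply: wint_le => // t t0; rewrite horner_exp expr0 ler_wpM2l ?sqr_ge0//.
    by rewrite invr1 invf_le1 ?exprn_ege1 ?exprn_gt0; lra.
have L10 : 0 <= wint nu 0 1 by apply: wint_ge0 => t _; rewrite hornerC.
(* The 4 comes from (x - y)^2 <= 2 x^2 + 2 y^2 with both squares at most L(1) L(p^2); the 1 keeps
   the constant positive. *)
exists ((4 * wint nu 0 1 + 1) / h ^+ 2); split.
  by rewrite divr_gt0 ?exprn_even_gt0//; lra.
move=> p; rewrite mulrAC ler_pdivlMr ?exprn_even_gt0// -exprMn pE.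
have := sq _ hnu p; have := sq _ htau p; rewrite -!L0.
have : 0 <= wint nu 0 (p ^+ 2) by apply: wint_ge0 => t _; rewrite horner_exp sqr_ge0.
move: (wint nu j.+1 p) (wint tau j.+1 p) (wint nu 0 (p ^+ 2)) => x y z z0 hy hx.
have : 0 <= (x + y) ^+ 2 by exact: sqr_ge0.
nra.
Qed.

(** The substitution u = 1/(t + 1) maps the half-line into [0, 1], where polynomials in u
    approximate the indicators of intervals. The hypothesis says that all powers of u have equal
    integrals. *)
Lemma rational_moments_determine nu tau :
  half_line_moment_measure nu -> half_line_moment_measure tau ->
  (forall j, wint nu j 1 = wint tau j 1) ->
  forall A, measurable A -> nu A = tau A.
Proof.
move=> hnu htau H.
have mu : measurable_fun D (fun t : R => (t + 1)^-1).
  apply: (@measurable_funS _ _ _ _ setT) => //.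
  by apply: (measurableT_comp measurable_inv); apply: measurable_funD.
have u01 t : D t -> 0 <= (t + 1)^-1 <= 1.
  by rewrite /= in_itv/= andbT => t0; rewrite invr_ge0 invf_le1; lra.
have ipow (m : {measure set R -> \bar R}) : half_line_moment_measure m ->
    forall Q i, m.-integrable D (EFin \o (fun t : R => Q.[(t + 1)^-1] * (t + 1)^-1 ^+ i)).
  move=> hm Q i; have [M HM] := horner_bounded Q 1.
  apply: (@integrable_poly_bounded _ m hm _ M%:P) => [|t t0].
    by apply: measurable_funM;
      [apply: (measurableT_comp (measurable_horner Q))|exact: measurable_funX].
  have /andP[? ?] : 0 <= (t + 1)^-1 <= 1 by apply: u01; rewrite /= in_itv/= t0.
  rewrite hornerC normrM normrX (ger0_norm (_ : 0 <= (t + 1)^-1))//.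
  apply: (@le_trans _ _ (M * 1)); last by rewrite mulr1 ler_norm.
  by rewrite ler_pM// ?exprn_ge0// ?exprn_ile1// HM// ger0_norm.
(* The extra factor u^j lets the induction on P absorb the factor X of P * X + c. *)
have HP P j : \int[nu]_(t in D) (P.[(t + 1)^-1] * (t + 1)^-1 ^+ j) =
              \int[tau]_(t in D) (P.[(t + 1)^-1] * (t + 1)^-1 ^+ j).
  elim/poly_ind: P j => [|P c IH] j.
    under eq_Rintegral do rewrite horner0 mul0r.
    by under [RHS]eq_Rintegral do rewrite horner0 mul0r; rewrite !Rintegral_cst// !mul0r.
  have step (m : {measure set R -> \bar R}) : half_line_moment_measure m ->
      \int[m]_(t in D) ((P * 'X + c%:P).[(t + 1)^-1] * (t + 1)^-1 ^+ j) =
      \int[m]_(t in D) (P.[(t + 1)^-1] * (t + 1)^-1 ^+ j.+1) + c * wint m j 1.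
    move=> hm; rewrite /wint -RintegralZl//; last exact: integrable_rational.
    rewrite -RintegralD//; first last.
    - apply: (@integrable_poly_bounded _ m hm _ c%:P) => [|t t0].
        by apply: measurable_funM => //; exact: measurable_rational.
      rewrite !hornerC normrM ler_piMr// ger0_norm ?divr_ge0// ?exprn_ge0//; last by lra.
      by rewrite div1r invf_le1 ?exprn_ege1 ?exprn_gt0; lra.
    - exact: ipow.
    apply: eq_Rintegral => t _; rewrite hornerMXaddC hornerC exprS exprVn; ring.
  by rewrite (step _ hnu) (step _ htau) IH H.
apply: half_line_measure_ext => //; 
  [exact: hnu.1|exact: htau.1|exact: half_line_moment_measure_lty|move=> b b0].
(* On the half-line t < b means 1/(b + 1) < 1/(t + 1), and 1/(t + 1) lies in [0, 1], whence the
   bound 1. *)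
have [q [q01 qc]] := threshold_poly 1 (b + 1)^-1.
have lim (m : {measure set R -> \bar R}) (hm : half_line_moment_measure m) :
    \int[m]_(t in D) ((q n).[(t + 1)^-1] * (t + 1)^-1 ^+ 0) @[n --> \oo] -->
    fine (m (`]-oo, b[ `&` D)).
  have i1 : m.-integrable D (EFin \o cst (1 : R)).
    by apply: (@integrable_poly_bounded _ m hm _ 1) => // t _; rewrite hornerC.
  have := @cvg_threshold _ _ R 1 m D (cst 1) (fun _ t => (t + 1)^-1) 1 (fun=> (b + 1)^-1)
    (fun=> q) ltac:(by []) (fun=> q01) (fun=> qc) i1 (fun=> mu).
  have h : forall x, D x -> (1 : R) != 0 -> forall i : 'I_1, `|(x + 1)^-1| <= 1.
    by move=> x /u01/andP[? ?] _ _; rewrite ger0_norm.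
  move=> /(_ h) c; rewrite -Rintegral_indic//.
  have -> : \int[m]_(t in D) \1_(`]-oo, b[%classic : set R) t =
      \int[m]_(t in D) (cst 1 t * \prod_(i < 1) ((b + 1)^-1 < (t + 1)^-1)%R%:R).
    apply: eq_Rintegral => t; rewrite inE/= in_itv/= andbT => t0.
    rewrite /cst mul1r big_ord1 indicE; congr (_%:R).
    rewrite ltf_pV2 ?posrE; [|lra|lra].
    by rewrite ltrD2r mem_setE in_itv.
  rewrite (_ : (fun n => _) = (fun n => \int[m]_(t in D)
     (cst 1 t * \prod_(i < 1) (q n).[(t + 1)^-1]))) //.
  apply/funext => n; apply: eq_Rintegral => t _.
  by rewrite /cst mul1r big_ord1 expr0 mulr1.
have fin (m : {measure set R -> \bar R}) : half_line_moment_measure m ->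
    m (`]-oo, b[ `&` D) \is a fin_num.
  move=> hm; rewrite ge0_fin_numE//; apply: le_lt_trans (half_line_moment_measure_lty hm).
  by rewrite le_measure ?inE//; exact: measurableI.
rewrite -(fineK (fin _ hnu)) -(fineK (fin _ htau)); congr (_%:E).
have cnu := lim _ hnu; rewrite (funext (fun n => HP (q n) 0%N)) in cnu.
exact: (cvg_unique (@Rhausdorff R) cnu (lim _ htau)).
Qed.

(** By [rational_moments_determine] some integral of (t + 1)^-j tells the measures apart; just
    before the first such index the weighted integrals still agree on all polynomials, by splitting
    at -1. *)
Lemma bounded_evaluation nu tau :
  half_line_moment_measure nu -> half_line_moment_measure tau ->
  (forall p, wint nu 0 p = wint tau 0 p) ->
  ~ (forall A, measurable A -> nu A = tau A) ->
  exists C, 0 < C /\ forall p, p.[-1] ^+ 2 <= C * wint nu 0 (p ^+ 2).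
Proof.
move=> hnu htau L0 ne.
have [j [Ej nEj]] : exists j, (forall p, wint nu j p = wint tau j p) /\
    wint nu j.+1 1 <> wint tau j.+1 1.
  apply: contrapT => H; apply: ne; apply: rational_moments_determine => // j.
  suff : forall p, wint nu j p = wint tau j p by apply.
  elim: j => // j IH p; have [q ->] := horner_split p (-1).
  rewrite (wintD hnu) (wintD htau) !wint_shift IH -[(p.[-1])%:P]mulr1 mul_polyC.
  rewrite (wintZ hnu) (wintZ htau); congr (_ + _ * _).
  by apply: contrapT => /eqP n1; apply: H; exists j; split => //; exact/eqP.
exact: (bounded_evaluation_of_kernel hnu htau L0 Ej nEj).
Qed.

End indeterminate.

Section Rintegral_cauchy_schwarz.
Context {dT : measure_display} {T : measurableType dT} {R : realType}.

Lemma Rintegral_cauchy_schwarz (mu : {measure set T -> \bar R}) D (f g : T -> R) :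
  measurable D -> mu.-integrable D (EFin \o (fun x => f x ^+ 2)) ->
  mu.-integrable D (EFin \o (fun x => g x ^+ 2)) ->
  mu.-integrable D (EFin \o (fun x => f x * g x)) ->
  (\int[mu]_(x in D) (f x * g x)) ^+ 2 <=
  (\int[mu]_(x in D) (f x ^+ 2)) * (\int[mu]_(x in D) (g x ^+ 2)).
Proof.
move=> mD iff igg ifg; apply: discriminant_le => t.
rewrite -!RintegralZl// -RintegralB//; last exact: integrable_realZ.
rewrite -RintegralD//; last exact: integrable_realZ; last first.
  by apply: integrable_realB => //; exact: integrable_realZ.
by apply: Rintegral_ge0 => x _; have := sqr_ge0 (f x - t * g x); lra.
Qed.

End Rintegral_cauchy_schwarz.

(** * Coercivity of multiplication by the variable *)

Section coercivity.
Context {R : realType}.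
Implicit Types (p q r : {poly R}).
Local Notation D := (`[0%R, +oo[%classic : set R).
Variable nu : {measure set R -> \bar R}.
Hypothesis hnu : half_line_moment_measure nu.
Local Notation L := (wint nu 0).
Variable C : R.
Hypothesis C0 : 0 < C.
Hypothesis eval_le : forall p, p.[-1] ^+ 2 <= C * L (p ^+ 2).

Lemma wint0E p : L p = \int[nu]_(t in D) p.[t].
Proof. by apply: eq_Rintegral => t _; rewrite expr0 divr1. Qed.

Lemma wint_sqr_ge0 j p : 0 <= wint nu j (p ^+ 2).
Proof. by apply: wint_ge0 => t _; rewrite horner_exp sqr_ge0. Qed.

(** The evaluation bound settles the case p(-1) <> 0. A root at -1 is divided out, which does not
    increase the integral of the square, as (t + 1)^2 >= 1. *)
Lemma wint_sqr_gt0 p : p != 0 -> 0 < L (p ^+ 2).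
Proof.
have [n] := ubnP (size p); elim: n p => // n IH p; rewrite ltnS => pn p0.
have [p1|p1] := eqVneq p.[-1] 0; last first.
  have : 0 < C * L (p ^+ 2) by apply: lt_le_trans (eval_le p); rewrite exprn_even_gt0.
  by rewrite pmulr_rgt0.
have [q pE] := horner_split p (-1).
have q0 : q != 0.
  by apply: contraNneq p0 => q0; rewrite pE q0 p1 mul0r add0r.
have sq := size_horner_split pE q0.
apply: (@lt_le_trans _ _ (L (q ^+ 2))); first by apply: IH => //; rewrite -sq.
apply: wint_le => // t t0; rewrite !expr0 !divr1 pE p1 addr0 !hornerE opprK.
rewrite exprMn ler_peMr ?sqr_ge0//.
by rewrite exprn_ege1//; lra.
Qed.

Section orthonormal_system.
Variable P : nat -> {poly R}.
Hypothesis PP : forall i j, L (P i * P j) = (i == j)%:R.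
Hypothesis Psize : forall i, size (P i) = i.+1.
Let Llin := wint_linear hnu 0.

(* The map [p |-> (p - p(-1)) / (X + 1)] lowers degrees, hence has trace zero, and
   it differs by a bounded rank one map from multiplication by [1 / (X + 1)]. *)
Lemma trace_bound n : (\sum_(j < n) wint nu 1 (P j ^+ 2)) ^+ 2 <= C * wint nu 2 1.
Proof.
(* The reproducing kernel of evaluation at -1 in degrees below n: L(K^2) = K(-1), so L(K^2)^2 <= C
   L(K^2) and L(K^2) <= C. *)
pose K := \sum_(j < n) (P j).[-1] *: P j.
have -> : \sum_(j < n) wint nu 1 (P j ^+ 2) = wint nu 1 K.
  rewrite (wint_sum hnu); apply: eq_bigr => j _.
  have [q qE] := horner_split (P j) (-1).
  have sq : (size q <= j)%N.
    have [->|q0] := eqVneq q 0; first by rewrite size_poly0.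
    by rewrite -ltnS -(size_horner_split qE q0) Psize.
  have -> : P j ^+ 2 = (P j * q) * ('X - (-1)%:P) + (P j).[-1] *: P j.
    by rewrite expr2 {2}qE -mul_polyC; ring.
  by rewrite (wintD hnu) wint_shift (orthonormal_lower Llin PP Psize sq) add0r.
have K2 : L (K ^+ 2) <= C.
  have LE : L (K ^+ 2) = K.[-1].
    rewrite expr2 {1}/K mulr_suml (wint_sum hnu) /K horner_sum.
    apply: eq_bigr => j _; rewrite -scalerAl (wintZ hnu) hornerZ mulr_sumr.
    rewrite (wint_sum hnu) (bigD1 j)//= -scalerAr (wintZ hnu) PP eqxx mulr1.
    rewrite big1 ?addr0// => i ij; rewrite -scalerAr (wintZ hnu) PP.
    by have /negbTE -> : val j != val i; rewrite ?mulr0// eq_sym.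
  have := eval_le K; rewrite -{1}LE.
  have [->|K0] := eqVneq (L (K ^+ 2)) 0; first by move=> _; exact: ltW.
  have K0' : 0 < L (K ^+ 2) by rewrite lt_def K0 wint_sqr_ge0.
  by rewrite expr2 ler_pM2r.
(* At index 2, Cauchy-Schwarz separates 1 from K (X + 1), and the square of the latter over (t +
   1)^2 integrates to L(K^2). *)
have -> : wint nu 1 K = wint nu 2 (K * ('X - (-1)%:P)) by rewrite wint_shift.
rewrite -(mul1r (K * _)) mulrC; apply: le_trans (wint_cauchy_schwarz hnu _ _ _) _.
rewrite expr1n exprMn expr2 mulrA wint_shift -expr2.
have -> : K ^+ 2 * ('X - (-1)%:P) = K ^+ 2 * ('X - (-1)%:P) by [].
rewrite wint_shift ler_wpM2r//; by apply: wint_ge0 => t _; rewrite hornerC.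
Qed.

End orthonormal_system.

Lemma measurable_indic_ray d : measurable_fun D (\1_(`]-oo, d]%classic : set R) : R -> R).
Proof. by apply: measurable_indic. Qed.

(** Dominated convergence: the integrals over [0, 1/(n+1)] tend to p(0) nu({0}) = 0. *)
Lemma vanishing_near0 p e : nu [set 0] = 0%E -> (forall t, 0 <= p.[t]) -> 0 < e ->
  exists d, 0 < d /\ \int[nu]_(t in D) (p.[t] * \1_(`]-oo, d]%classic : set R) t) <= e.
Proof.
move=> nu0 p0 e0.
have mp : measurable_fun D (horner p) by apply: measurable_funS (measurable_horner p).
have i0 : nu.-integrable D (EFin \o (\1_([set 0] : set R) : R -> R)).
  apply: (@integrable_poly_bounded _ nu hnu _ 1); first exact: measurable_indic.
  move=> t _; rewrite hornerC normr1.
  by have /andP[? ?] := @indic01 _ R [set 0] t; rewrite ger0_norm.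
have [|||||_ c] := @Rdominated_convergence _ _ _ nu D
  (fun n t => p.[t] * \1_(`]-oo, n.+1%:R^-1]%classic : set R) t)
  (fun t => p.[t] * \1_([set 0] : set R) t) (horner p).
- by [].
- by move=> n; apply: measurable_funM => //; exact: measurable_indic_ray.
- move=> t; rewrite /= in_itv/= andbT => t0.
  apply: cvgM; first exact: cvg_cst.
  have [->|tn0] := eqVneq t 0.
    rewrite indicE mem_set//; apply: cvg_near_cst; apply: nearW => n.
    by rewrite indicE mem_set// /= in_itv/= invr_ge0.
  have tgt : 0 < t by rewrite lt_def tn0.
  rewrite indicE memNset; last by move=> /= /eqP; rewrite (negbTE tn0).
  apply: cvg_near_cst; near=> n; rewrite indicE memNset//= in_itv/=.
  apply/negP; rewrite -ltNge; near: n.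
  exact: (cvgr_lt 0 (@cvg_harmonic R)).
- exact: (hnu.2 p).
- move=> n t _; have /andP[? ?] := @indic01 _ R (`]-oo, n.+1%:R^-1]%classic : set R) t.
  by rewrite normrM !ger0_norm// ler_piMr.
have l0 : \int[nu]_(t in D) (p.[t] * \1_([set 0] : set R) t) = 0.
  rewrite (_ : \int[nu]_(t in D) _ = \int[nu]_(t in D) (p.[0] * \1_([set 0] : set R) t)).
    rewrite RintegralZl// Rintegral_indic//.
    rewrite (_ : nu _ = 0%E) ?mulr0//.
    by apply/eqP; rewrite -measure_le0 -nu0 le_measure ?inE//; exact: measurableI.
  apply: eq_Rintegral => t _; rewrite indicE.
  case: (boolP (t \in _)) => [|_]; last by rewrite !mulr0.
  by rewrite inE => /= ->.
rewrite l0 in c; have [n _ Hn] := cvgr_lt 0 c e e0.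
by exists n.+1%:R^-1; split; [rewrite invr_gt0|apply/ltW/(Hn n)/leqnn].
Unshelve. all: by end_near.
Qed.

(** The integral of r p is cut at d. Near 0 Cauchy-Schwarz leaves the factor int p^2 over [0, d],
    small for small d; beyond d one has r^2 <= t r^2 / d. The factors 2 come from squaring a sum of
    two terms. *)
Lemma small_coefficient p r d : 0 < d ->
  L (r * p) ^+ 2 <= 2 * L (r ^+ 2) *
      (\int[nu]_(t in D) (p.[t] ^+ 2 * \1_(`]-oo, d]%classic : set R) t)) +
    2 * L (p ^+ 2) * (L ('X * r ^+ 2) / d).
Proof.
move=> d0; pose w t : R := \1_(`]-oo, d]%classic : set R) t.
have w01 t : 0 <= w t <= 1 := indic01 _ t.
have ww t : w t ^+ 2 = w t by rewrite /w indicE; case: (_ \in _); rewrite ?expr1n ?expr0n.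
have mw : measurable_fun D w := measurable_indic_ray d.
have mh q : measurable_fun D (horner q) by apply: measurable_funS (measurable_horner q).
have m1 : measurable_fun D (fun t => 1 - w t) by apply: measurable_funB.
have i2 q : nu.-integrable D (EFin \o (fun t => q.[t] ^+ 2)).
  rewrite (_ : (fun t => _) = horner (q ^+ 2)); first exact: (hnu.2 (q ^+ 2)).
  by apply/funext => t; rewrite horner_exp.
have iw q (f g : R -> R) : measurable_fun D f -> (forall t, `|f t| <= 1) ->
    (forall t, g t = q.[t] * f t) -> nu.-integrable D (EFin \o g).
  move=> mf f1 /funext ->; apply: (@integrable_poly_bounded _ nu hnu _ q).
    exact: measurable_funM.
  by move=> t _; rewrite normrM ler_piMr.
have w1 t : `|w t| <= 1 by have /andP[? ?] := w01 t; rewrite ger0_norm.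
have w1' t : `|1 - w t| <= 1 by have /andP[? ?] := w01 t; rewrite ger0_norm; lra.
have h1 : (\int[nu]_(t in D) (r.[t] * (p.[t] * w t))) ^+ 2 <=
    L (r ^+ 2) * \int[nu]_(t in D) (p.[t] ^+ 2 * w t).
  apply: le_trans (Rintegral_cauchy_schwarz _ _ _ _) _ => //.
  - by apply: (iw (p ^+ 2) w) => // t; rewrite exprMn ww horner_exp.
  - by apply: (iw (r * p) w) => // t; rewrite hornerM mulrA.
  rewrite wint0E; under eq_Rintegral do rewrite -horner_exp.
  by under [X in _ * X <= _]eq_Rintegral do rewrite exprMn ww.
have h2 : (\int[nu]_(t in D) (r.[t] * (1 - w t) * p.[t])) ^+ 2 <=
    (L ('X * r ^+ 2) / d) * L (p ^+ 2).
  have ir : nu.-integrable D (EFin \o (fun t => (r.[t] * (1 - w t)) ^+ 2)).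
    apply: (iw (r ^+ 2) (fun t => (1 - w t) ^+ 2)) => [|t|t]; first exact: measurable_funX.
      by rewrite normrX exprn_ile1.
    by rewrite exprMn horner_exp.
  apply: le_trans (Rintegral_cauchy_schwarz _ _ _ _) _ => //.
  - by apply: (iw (r * p) (fun t => 1 - w t)) => // t; rewrite hornerM; ring.
  rewrite [L (p ^+ 2)]wint0E; under [X in _ * X <= _]eq_Rintegral do rewrite -horner_exp.
  apply: ler_pM => //; try by apply: Rintegral_ge0 => t _; rewrite ?horner_exp sqr_ge0.
  rewrite wint0E mulrC -RintegralZl//; last exact: (hnu.2 ('X * r ^+ 2)).
  apply: le_Rintegral => //.
    by apply: integrable_realZ => //; exact: (hnu.2 ('X * r ^+ 2)).
  move=> t; rewrite /= in_itv/= andbT => t0; 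
  rewrite hornerM hornerX horner_exp exprMn /w indicE.
  case: (boolP (t \in _)) => [_|].
    rewrite subrr expr0n /= mulr0; apply: mulr_ge0; first by rewrite invr_ge0 ltW.
    exact: mulr_ge0 (sqr_ge0 _).
  rewrite mem_setE in_itv/= -ltNge => dt; rewrite subr0 expr1n mulr1 mulrA ler_peMl ?sqr_ge0//.
  by rewrite mulrC ler_pdivlMr// mul1r ltW.
have -> : L (r * p) = \int[nu]_(t in D) (r.[t] * (p.[t] * w t)) +
    \int[nu]_(t in D) (r.[t] * (1 - w t) * p.[t]).
  rewrite wint0E -RintegralD//.
  - by apply: eq_Rintegral => t _; rewrite hornerM; ring.
  - by apply: (iw (r * p) w) => // t; rewrite hornerM mulrA.
  - by apply: (iw (r * p) (fun t => 1 - w t)) => // t; rewrite hornerM; ring.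
move: h1 h2; set x := (\int[nu]_(t in D) (r.[t] * (p.[t] * w t))).
set y := \int[nu]_(t in D) _; set z := \int[nu]_(t in D) _ => h1 h2.
have := sqr_ge0 (x - z); lra.
Qed.

Lemma sum_cauchy_schwarz I (s : seq I) (F G : I -> R) :
  (\sum_(i <- s) F i * G i) ^+ 2 <= (\sum_(i <- s) F i ^+ 2) * (\sum_(i <- s) G i ^+ 2).
Proof.
apply: discriminant_le => t; rewrite -mulrA !mulr_sumr -sumrB -big_split/= sumr_ge0// => i _.
by have := sqr_ge0 (F i - t * G i); lra.
Qed.

(** Since 1 - t <= 1/(t + 1), it is enough to bound the integral of r^2 / (t + 1). Expand r in
    orthonormal polynomials and cut at N. Beyond N the convergent trace leaves at most L(r^2)/8.
    Each of the finitely many squared coefficients before N is bounded by [small_coefficient]: a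
    small multiple of L(r^2) plus a multiple of L(X r^2). The terms in L(r^2) are absorbed on the
    left. *)
Lemma coercive : nu [set 0] = 0%E ->
  exists e, 0 < e /\ forall r, e * L (r ^+ 2) <= L ('X * r ^+ 2).
Proof.
move=> nu0; have [P [PP Psize]] := orthonormal_polys (wint_linear hnu 0) wint_sqr_gt0.
pose S n := \sum_(0 <= j < n) wint nu 1 (P j ^+ 2).
have S0 n : 0 <= S n by apply: sumr_ge0 => j _; exact: wint_sqr_ge0.
have SB n : S n ^+ 2 <= C * wint nu 2 1 by rewrite /S big_mkord; exact: trace_bound.
have Ssup : has_sup (range S).
  split; first by exists (S 0%N), 0%N.
  exists (C * wint nu 2 1 + 1) => _ [n _ <-].
  by have := SB n; have := sqr_ge0 (S n - 1); nra.
have e8 : 0 < 1 / 8 :> R by lra.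
have [_ [N _ <-] SN] := sup_adherent e8 Ssup.
have tail n : (N <= n)%N -> \sum_(N <= j < n) wint nu 1 (P j ^+ 2) <= 1 / 8.
  move=> Nn; have : S n <= sup (range S) by apply: sup_upper_bound => //; exists n.
  rewrite /S (big_cat_nat (n := N))//= -/(S N); lra.
pose Q := \sum_(0 <= j < N) P j ^+ 2.
have Q0 t : 0 <= Q.[t].
  by rewrite horner_sum sumr_ge0// => j _; rewrite horner_exp sqr_ge0.
(* With the tail bound 1/8 and this eta, the two parts cost at most L(r^2)/4 each after the factor 2
   of (A + B)^2 <= 2 A^2 + 2 B^2. Half of L(r^2) survives, and the terms in L(X r^2) add up to the
   constant exhibited below. *)
pose eta := (16 * (S N * N%:R + 1))^-1.
have SN0 : 0 <= S N * N%:R by rewrite mulr_ge0.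
have eta0 : 0 < eta by rewrite invr_gt0; lra.
have [d [d0 Hd]] := vanishing_near0 nu0 Q0 eta0.
have q0 : 0 <= 4 * S N * N%:R / d by apply: divr_ge0; [lra|exact: ltW].
have q1 : 0 < 2 * (1 + 4 * S N * N%:R / d) by lra.
exists (2 * (1 + 4 * S N * N%:R / d))^-1; split; first by rewrite invr_gt0.
move=> r; rewrite ler_pdivrMl//.
pose m := maxn (size r) N; have rm : (size r <= m)%N by rewrite leq_maxl.
have Nm : (N <= m)%N by rewrite leq_maxr.
pose a j := L (r * P j).
pose A := \sum_(0 <= j < N) a j *: P j; pose B := \sum_(N <= j < m) a j *: P j.
have rE : r = A + B.
  rewrite {1}(orthonormal_expansion (wint_linear hnu 0) PP Psize rm).
  by rewrite -(big_mkord xpredT (fun j => a j *: P j)) (big_cat_nat (n := N)).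
have pars : L (r ^+ 2) = \sum_(0 <= j < m) a j ^+ 2.
  by rewrite (orthonormal_parseval (wint_linear hnu 0) PP Psize rm) big_mkord.
have L0 := wint_sqr_ge0 0 r.
have X0 : 0 <= L ('X * r ^+ 2).
  by apply: wint_ge0 => t t0; rewrite hornerM hornerX horner_exp mulr_ge0 ?sqr_ge0.
have sqr_sum (s : seq nat) : wint nu 1 ((\sum_(j <- s) a j *: P j) ^+ 2) <=
    (\sum_(j <- s) a j ^+ 2) * \sum_(j <- s) wint nu 1 (P j ^+ 2).
  rewrite -(wint_sum hnu) -(wintZ hnu); apply: wint_le => // t t0.
  rewrite ler_wpM2r ?invr_ge0 ?exprn_ge0//; first by lra.
  rewrite hornerZ horner_exp !horner_sum; under eq_bigr do rewrite hornerZ.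
  under [X in _ <= _ * X]eq_bigr do rewrite horner_exp.
  exact: sum_cauchy_schwarz.
have h1 : L (r ^+ 2) - L ('X * r ^+ 2) <= wint nu 1 (r ^+ 2).
  rewrite -(wintB hnu); apply: wint_le => // t t0.
  rewrite expr0 divr1 expr1 ler_pdivlMr; last by lra.
  rewrite hornerD hornerN [('X * _).[_]]hornerM hornerX !horner_exp.
  have := mulr_ge0 (sqr_ge0 t) (sqr_ge0 r.[t]); lra.
have h2 : wint nu 1 (r ^+ 2) <= 2 * wint nu 1 (A ^+ 2) + 2 * wint nu 1 (B ^+ 2).
  rewrite -!(wintZ hnu) -(wintD hnu); apply: wint_le => // t t0.
  rewrite ler_wpM2r ?invr_ge0 ?exprn_ge0//; first by lra.
  rewrite rE hornerD !hornerZ !horner_exp hornerD.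
  have := sqr_ge0 (A.[t] - B.[t]); lra.
have h3 : wint nu 1 (B ^+ 2) <= L (r ^+ 2) * (1 / 8).
  apply: le_trans (sqr_sum _) _; apply: ler_pM.
  - by apply: sumr_ge0 => j _; exact: sqr_ge0.
  - by apply: sumr_ge0 => j _; exact: wint_sqr_ge0.
  - rewrite pars [leRHS](big_cat_nat (n := N))//= lerDr.
    by apply: sumr_ge0 => j _; exact: sqr_ge0.
  - exact: tail.
have h4 : wint nu 1 (A ^+ 2) <= N%:R * (2 * L (r ^+ 2) * eta + 2 * (L ('X * r ^+ 2) / d)) * S N.
  apply: le_trans (sqr_sum _) _; apply: ler_wpM2r; first exact: S0.
  rewrite mulr_natl -{2}[N]subn0 -iter_addr_0 -big_const_nat.
  rewrite !big_seq; apply: ler_sum => j; rewrite mem_index_iota => /andP[_ jN].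
  apply: le_trans (small_coefficient _ _ d0) _.
  rewrite -[P j ^+ 2]/(P j * P j) PP eqxx mulr1 lerD2r ler_wpM2l ?mulr_ge0//.
  apply: le_trans Hd; apply: le_Rintegral => //.
  - apply: (@integrable_poly_bounded _ nu hnu _ (P j ^+ 2)) => [|t _].
      apply: measurable_funM; last exact: measurable_indic_ray.
      by apply: measurable_funX; apply: measurable_funS (measurable_horner (P j)).
    have /andP[? ?] := @indic01 _ R `]-oo, d]%classic t.
    by rewrite horner_exp normrM ler_piMr// ger0_norm.
  - apply: (@integrable_poly_bounded _ nu hnu _ Q) => [|t _].
      apply: measurable_funM; last exact: measurable_indic_ray.
      by apply: measurable_funS (measurable_horner Q).
    have /andP[? ?] := @indic01 _ R `]-oo, d]%classic t.
    by rewrite normrM ler_piMr// ger0_norm.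
  - move=> t _; apply: ler_wpM2r.
      by case/andP: (@indic01 _ R (`]-oo, d]%classic : set R) t).
    rewrite horner_sum (bigD1_seq j) ?mem_index_iota ?iota_uniq//= horner_exp lerDl.
    by apply: sumr_ge0 => i _; rewrite horner_exp sqr_ge0.
have h5 : S N * N%:R * eta <= 1 / 16.
  by rewrite /eta ler_pdivrMr; lra.
move: h1 h2 h3 h4 h5 L0 X0 SN0; set l := L (r ^+ 2); set x := L ('X * r ^+ 2).
set J := wint nu 1 (r ^+ 2); set JA := wint nu 1 (A ^+ 2); set JB := wint nu 1 (B ^+ 2).
have -> : (2 * (1 + 4 * S N * N%:R / d)) * x = 2 * x + 8 * (S N * N%:R) * (x / d).
  by field; rewrite gt_eqF.
move: (x / d) => y h1 h2 h3 h4 h5 l0 x0 SN0'.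
have : S N * N%:R * eta * l <= 1 / 16 * l by rewrite ler_wpM2r.
lra.
Qed.

End coercivity.

(** * Measures from distribution functions *)

Section stieltjes_measure.
Context {R : realType}.

Section on_reals.
Variable f : cumulative R R.

Definition stieltjes_measure : set R -> \bar R := lebesgue_stieltjes_measure f.

Let sm0 : stieltjes_measure set0 = 0%E.
Proof. exact: measure0. Qed.

Let sm_ge0 A : (0 <= stieltjes_measure A)%E.
Proof. exact: measure_ge0. Qed.

Let sm_sigma_additive : semi_sigma_additive stieltjes_measure.
Proof. exact: (@measure_semi_sigma_additive _ _ _ (lebesgue_stieltjes_measure f)). Qed.

HB.instance Definition _ := isMeasure.Build _ R _ stieltjes_measure
  sm0 sm_ge0 sm_sigma_additive.

End on_reals.

Lemma nondecreasing_measure (F : R -> R) : nondecreasing F -> right_continuous F ->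
  exists m : {measure set R -> \bar R},
    forall a b, a <= b -> m `]a, b]%classic = (F b - F a)%:E.
Proof.
move=> ndF rcF.
pose f : cumulative R R := HB.pack F (isCumulative.Build R _ R F ndF rcF).
exists (stieltjes_measure f) => a b ab.
transitivity (lebesgue_stieltjes_measure f `]a, b]%classic); first by [].
rewrite /lebesgue_stieltjes_measure /measure_extension measurable_mu_extE; last exact: is_ocitv.
exact: (@wlength_itv_bnd _ f).
Qed.

Lemma nondecreasing_measure_tail (m : {measure set R -> \bar R}) (F : R -> R) l a :
  (forall a b, a <= b -> m `]a, b]%classic = (F b - F a)%:E) ->
  F n%:R @[n --> \oo] --> l -> m `]a, +oo[%classic = (l - F a)%:E.
Proof.
move=> mF Fl.
pose N := (Num.trunc `|a|).+1.
have aN n : a <= (n + N)%:R.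
  apply: (le_trans (ler_norm a)); apply/ltW/(lt_le_trans (truncnS_gt _)).
  by rewrite ler_nat leq_addl.
have -> : `]a, +oo[%classic = \bigcup_n `]a, (n + N)%:R]%classic :> set R.
  apply/seteqP; split => t /=; last by move=> [n _] /=; rewrite !in_itv/= => /andP[->].
  rewrite in_itv/= andbT => at_; exists (Num.trunc `|t|).+1 => //=.
  rewrite in_itv/= at_ (le_trans (ler_norm t))//.
  by apply/ltW/(lt_le_trans (truncnS_gt _)); rewrite ler_nat leq_addr.
have c1 : m `]a, (n + N)%:R]%classic @[n --> \oo] --> (l - F a)%:E.
  rewrite (_ : (fun n => _) = (fun n => (F (n + N)%:R - F a)%:E)).
    apply: cvg_EFin; first exact: nearW.
    apply: cvgB; last exact: cvg_cst.
    by rewrite -(cvg_shiftn N (fun n => F n%:R)) in Fl.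
  by apply/funext => n; rewrite mF.
apply: (@cvg_unique _ _ (m (`]a, (n + N)%:R]%classic) @[n --> \oo])) => //.
apply: nondecreasing_cvg_mu => //; first exact: bigcup_measurable.
move=> i j ij; apply/subsetPset => t /=; rewrite !in_itv/= => /andP[-> /le_trans]; apply.
by rewrite ler_nat leq_add2r.
Qed.

End stieltjes_measure.

(** * Riesz extension of positive functionals *)

Section riesz_extension.
Context {R : realType}.
Variables (L : {poly R} -> R) (x : R) (f : nat -> R -> R).
Hypothesis Llin : forall c p q, L (c *: p + q) = c * L p + L q.
Hypothesis f01 : forall n t, x <= t -> 0 <= f n t <= 1.
Implicit Types (p q : {poly R}) (a V : nat -> R).

(** [V i] is the value assigned to [f i]: the functional on polynomials plus the span of the first n
    functions is positive, order being taken on [x, +oo[. *)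
Definition positive_upto V n := forall p a,
  (forall t, x <= t -> 0 <= p.[t] + \sum_(i < n) a i * f i t) ->
  0 <= L p + \sum_(i < n) a i * V i.

Definition minorants V n : set R := [set y | exists p a,
  (forall t, x <= t -> p.[t] + \sum_(i < n) a i * f i t <= f n t) /\
  y = L p + \sum_(i < n) a i * V i].

Lemma positive_upto_eq V V' n : (forall i, (i < n)%N -> V i = V' i) ->
  positive_upto V n -> positive_upto V' n.
Proof.
move=> VV' pV p a H; have := pV p a H.
by under eq_bigr => i _ do rewrite VV'//.
Qed.

(** The bounds 0 <= f n <= 1 make the set of minorant values nonempty and bounded. If a n > 0, minus
    the rest of the combination divided by a n is a minorant of [f n]; if a n < 0, the rest divided
    by - a n majorises every minorant. *)
Lemma positive_upto_step V n : positive_upto V n -> V n = sup (minorants V n) ->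
  positive_upto V n.+1.
Proof.
move=> pV Vn p a H.
have ub : has_sup (minorants V n).
  split.
    exists 0, 0, (fun=> 0); split => [t xt|].
      rewrite horner0 add0r big1 => [|i _]; last by rewrite mul0r.
      by have /andP[] := f01 n xt.
    by rewrite (functional0 Llin) add0r big1// => i _; rewrite mul0r.
  exists (L 1) => _ [q [b [Hq ->]]].
  have := pV (1 - q) (fun i => - b i); rewrite (functionalB Llin).
  under eq_bigr do rewrite mulNr; rewrite sumrN.
  suff h t : x <= t -> 0 <= (1 - q).[t] + \sum_(i < n) - b i * f i t by move=> /(_ h); lra.
  move=> xt; rewrite !hornerE; under eq_bigr do rewrite mulNr; rewrite sumrN.
  by have := Hq t xt; have /andP[_] := f01 n xt; lra.
have VE : V n = sup (minorants V n) by [].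
rewrite big_ord_recr /=.
have H' t : x <= t -> 0 <= p.[t] + \sum_(i < n) a i * f i t + a n * f n t.
  by move=> xt; have := H t xt; rewrite big_ord_recr /= addrA.
rewrite addrA.
have scale c q b t : (c *: q).[t] + \sum_(i < n) (c * b i) * f i t =
    c * (q.[t] + \sum_(i < n) b i * f i t).
  by rewrite hornerZ mulrDr mulr_sumr; congr (_ + _); apply: eq_bigr => i _; rewrite mulrA.
have scaleV c q b : L (c *: q) + \sum_(i < n) (c * b i) * V i =
    c * (L q + \sum_(i < n) b i * V i).
  rewrite (functionalZ Llin) mulrDr mulr_sumr; congr (_ + _).
  by apply: eq_bigr => i _; rewrite mulrA.
have [an0|an0|an0] := ltgtP (a n) 0.
- suff : V n <= (L p + \sum_(i < n) a i * V i) / - a n.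
    by rewrite ler_pdivlMr ?oppr_gt0//; lra.
  rewrite VE; apply: ge_sup; first exact: ub.1.
  move=> _ [q [b [Hq ->]]]; rewrite ler_pdivlMr ?oppr_gt0//.
  have := pV (p - (- a n) *: q) (fun i => a i - (- a n) * b i).
  rewrite (functionalB Llin); under eq_bigr do rewrite mulrBl; rewrite sumrB.
  move=> h; have := scaleV (- a n) q b => hs.
  suff : 0 <= L p - L (- a n *: q) +
      (\sum_(i < n) a i * V i - \sum_(i < n) - a n * b i * V i) by lra.
  apply: h => t xt; rewrite hornerD hornerN; under eq_bigr do rewrite mulrBl; rewrite sumrB.
  have := scale (- a n) q b t; have := H' t xt; have := Hq t xt => h1 h2 h3.
  have : - a n * (q.[t] + \sum_(i < n) b i * f i t) <= - a n * f n t.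
    by rewrite ler_wpM2l// oppr_ge0 ltW.
  lra.
- suff : - (a n)^-1 * (L p + \sum_(i < n) a i * V i) <= V n.
    move=> h; have : a n * (- (a n)^-1 * (L p + \sum_(i < n) a i * V i)) <= a n * V n.
      by rewrite ler_wpM2l// ltW.
    by rewrite mulrA mulrN divff ?gt_eqF// mulN1r; lra.
  rewrite VE; apply: sup_upper_bound => //.
  exists (- (a n)^-1 *: p), (fun i => - (a n)^-1 * a i); split => [t xt|]; last by rewrite scaleV.
  have := H' t xt => h; rewrite scale.
  rewrite -(ler_pM2l an0) mulrA mulrN divff ?gt_eqF// mulN1r; lra.
- by rewrite an0 mul0r addr0; apply: pV => t xt; have := H' t xt; rewrite an0 mul0r addr0.
Qed.

(** The values are kept in a growing list because each supremum depends on all earlier ones.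
    Prescribing the first m values allows a chosen value other than the supremum. *)
Lemma positive_extension V0 m : positive_upto V0 m ->
  exists V, (forall i, (i < m)%N -> V i = V0 i) /\ forall n, positive_upto V n.
Proof.
move=> pV0.
pose ext (s : seq R) := rcons s (sup (minorants (nth 0 s) (size s))).
pose vals k := iter k ext (mkseq V0 m).
have sz k : size (vals k) = (m + k)%N.
  by elim: k => [|k IH]; rewrite ?size_mkseq ?addn0// /vals /= size_rcons IH addnS.
have nth_vals k j i : (i < m + k)%N -> nth 0 (vals (k + j)%N) i = nth 0 (vals k) i.
  move=> ik; elim: j => [|j IH]; first by rewrite addn0.
  by rewrite addnS /vals /= nth_rcons sz (leq_trans ik)// ?leq_add2l ?leq_addr.
pose V i := nth 0 (vals i.+1) i.
have VE k i : (i < m + k)%N -> nth 0 (vals k) i = V i.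
  move=> ik; rewrite /V; have [ki|ki] := leqP k i.+1.
    by rewrite -(subnKC ki) nth_vals.
  by rewrite -(subnKC (ltnW ki)) nth_vals//; lia.
exists V; split=> [i im|].
  by rewrite -(VE 0%N) ?addn0// /vals /= nth_mkseq.
have H k : positive_upto V (m + k)%N.
  elim: k => [|k IH].
    rewrite addn0; apply: positive_upto_eq pV0 => i im.
    by rewrite -(VE 0%N) ?addn0// /vals /= nth_mkseq.
  rewrite addnS; apply: positive_upto_step => //.
  rewrite -(VE k.+1) ?addnS//.
  rewrite {1}/vals /= nth_rcons sz ltnn eqxx.
  congr sup; apply/seteqP; split => y [p [b [Hp ->]]]; exists p, b; split => //;
    congr (_ + _); apply: eq_bigr => i _; rewrite VE//.
move=> n; have [nm|mn] := leqP m n; first by rewrite -(subnKC nm).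
move=> p a Hp.
pose a' i := if (i < n)%N then a i else 0.
have trunc (g : nat -> R) : \sum_(i < m) a' i * g i = \sum_(i < n) a i * g i.
  rewrite (big_ord_widen _ (fun i => a i * g i) (ltnW mn)).
  rewrite [RHS]big_mkcond/=.
  by apply: eq_bigr => i _; rewrite /a'; case: ifP; rewrite ?mul0r.
have := H 0%N p a'; rewrite addn0 trunc; apply => t xt.
by rewrite (trunc (fun i => f i t)); exact: Hp.
Qed.

End riesz_extension.

(** * Representation of positive functionals by measures on a half-line *)

Section haviland.
Context {R : realType}.
Variables (L : {poly R} -> R) (x v0 : R).
Hypothesis Llin : forall c p q, L (c *: p + q) = c * L p + L q.
Hypothesis x0 : 0 < x.
Hypothesis Lpos : forall p b,
  (forall t, x <= t -> 0 <= p.[t] + b / (t + 1)) -> 0 <= L p + b * v0.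
Implicit Types (p q : {poly R}).
Local Notation D := (`[0%R, +oo[%classic : set R).

(** A countable family suffices: 1/(t + 1), with its prescribed value v0, then the indicators of
    ]-oo, q] for rational q. The default 0 serves codes that denote no rational. *)
Let rays (n : nat) (t : R) : R := if n is i.+1 then
  (t <= ratr (odflt 0 (@unpickle rat i)))%R%:R else (t + 1)^-1.

Lemma positive_ray_extension : exists W : rat -> R,
  forall p b (l : seq (R * rat)), (forall t, x <= t ->
    0 <= p.[t] + b / (t + 1) + \sum_(z <- l) z.1 * (t <= ratr z.2)%R%:R) ->
  0 <= L p + b * v0 + \sum_(z <- l) z.1 * W z.2.
Proof.
have rays01 n t : x <= t -> 0 <= rays n t <= 1.
  move=> xt; case: n => [|n] /=; last by case: (t <= ratr _)%R => /=; rewrite ?lexx ?ler01.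
  have t0 := lt_le_trans x0 xt.
  by rewrite invr_ge0 invf_le1; lra.
have raysS i t : rays i.+1 t = (t <= ratr (odflt 0 (unpickle i)))%R%:R by [].
have pV0 : positive_upto L x rays (fun=> v0) 1.
  move=> p a; rewrite big_ord1 /= => H; apply: Lpos => t xt.
  by have := H t xt; rewrite big_ord1.
have [V [VV0 pV]] := positive_extension Llin rays01 pV0.
exists (fun r : rat => V (pickle r).+1) => p b l H.
pose n := (\max_(z <- l) (pickle z.2).+1)%N.
have ln z : z \in l -> (pickle z.2 < n)%N.
  by move=> zl; rewrite /n (@leq_bigmax_seq _ _ xpredT (fun z => (pickle z.2).+1)).
(* Repeated rationals in l are merged into one coefficient. *)
pose a i := if i is j.+1 then \sum_(z <- l | pickle z.2 == j) z.1 else b.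
have sumE (F : nat -> R) : \sum_(i < n.+1) a i * F i =
    b * F 0%N + \sum_(z <- l) z.1 * F (pickle z.2).+1.
  rewrite big_ord_recl /=; congr (_ + _).
  under eq_bigr do rewrite mulr_suml.
  rewrite (exchange_big_dep xpredT)//= big_seq [RHS]big_seq; apply: eq_bigr => z zl.
  rewrite (bigD1 (Ordinal (ln z zl)))//= big1 ?addr0// => i /andP[/eqP zi /eqP].
  by case; apply: val_inj.
have := pV n.+1 p a; rewrite sumE (VV0 0%N)// addrA; apply => t xt.
rewrite (sumE (fun i => rays i t)) addrA.
suff -> : \sum_(z <- l) z.1 * rays (pickle z.2).+1 t =
  \sum_(z <- l) z.1 * (t <= ratr z.2)%R%:R by exact: H.
by apply: eq_bigr => z _; rewrite raysS pickleK.
Qed.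

(** W q is the value given to the indicator of ]-oo, q]. It is monotone in q but need not be right
    continuous; G(t), the infimum of W over the rationals above t, is. W is kept next to G because
    positivity is known for W. *)
Lemma ray_distribution : exists (W : rat -> R) (G : R -> R),
  [/\ forall p b (l : seq (R * rat)), (forall t, x <= t ->
        0 <= p.[t] + b / (t + 1) + \sum_(z <- l) z.1 * (t <= ratr z.2)%R%:R) ->
      0 <= L p + b * v0 + \sum_(z <- l) z.1 * W z.2,
    nondecreasing G /\ right_continuous G,
    (forall r, 0 <= W r <= G (ratr r)) /\ (forall t r, t < ratr r -> G t <= W r),
    forall t, t < x -> G t = 0 &
    G n%:R @[n --> \oo] --> L 1].
Proof.
have [W HW] := positive_ray_extension.
have W0 (q : rat) : 0 <= W q.
  have := HW 0 0 [:: (1, q)]; rewrite big_seq1 (functional0 Llin) mul0r !add0r mul1r.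
  by apply=> t _; rewrite horner0 mul0r !add0r big_seq1 mul1r.
have Wmono (q q' : rat) : q <= q' -> W q <= W q'.
  move=> qq'; have := HW 0 0 [:: (1, q'); (-1, q)].
  rewrite big_cons big_seq1 (functional0 Llin) mul0r !add0r mul1r mulN1r subr_ge0 /=.
  apply=> t _; rewrite horner0 mul0r !add0r big_cons big_seq1 mul1r mulN1r subr_ge0 /=.
  rewrite ler_nat; case: (boolP (t <= ratr q)) => // tq.
  by rewrite (le_trans tq)// ler_rat.
(* Chebyshev's inequality for the functional: the indicator of t > q is at most t/q on [x, +oo[. No
   mass escapes to infinity. *)
have Wtail (q : rat) : 0 < ratr q :> R -> L 1 - W q <= L 'X / ratr q.
  move=> q0; have := HW ((ratr q)^-1 *: 'X - 1) 0 [:: (1, q)].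
  rewrite big_seq1 (functionalB Llin) (functionalZ Llin) mul0r addr0 mul1r mulrC => h.
  suff : 0 <= L 'X / ratr q - L 1 + W q by lra.
  apply: h => t xt; rewrite mul0r addr0 big_seq1 mul1r !hornerE mulrC.
  rewrite /=; case: (leP t (ratr q)) => [tq|qt] /=.
    by rewrite subrK divr_ge0 ?ltW//; exact: lt_le_trans x0 xt.
  by rewrite addr0 subr_ge0 ler_pdivlMr// mul1r ltW.
have WL (q : rat) : W q <= L 1.
  have := HW 1 0 [:: (-1, q)]; rewrite big_seq1 mul0r addr0 mulN1r subr_ge0; apply=> t _.
  rewrite mul0r addr0 big_seq1 mulN1r subr_ge0 hornerC /=.
  by case: (t <= ratr q)%R.
have Wx (q : rat) : ratr q < x -> W q = 0.
  move=> qx; apply/eqP; rewrite eq_le W0 andbT -oppr_ge0.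
  have := HW 0 0 [:: (-1, q)]; rewrite big_seq1 (functional0 Llin) mul0r !add0r mulN1r.
  apply=> t xt; rewrite horner0 mul0r !add0r big_seq1 mulN1r.
  by rewrite /= (leNgt t) (lt_le_trans qx xt) oppr0.
pose E (t : R) : set R := [set W q | q in [set q : rat | t < ratr q]].
pose G t := inf (E t).
have ratr_gt (t t' : R) : t < t' -> exists q : rat, t < ratr q < t'.
  by move=> tt'; have [q] := rat_in_itvoo tt'; rewrite in_itv /= => h; exists q.
have Einf t : has_inf (E t).
  split; last by exists 0 => _ [q _ <-].
  have [|q /andP[tq _]] := ratr_gt t (t + 1); first by lra.
  by exists (W q), q.
have Gup t (q : rat) : t < ratr q -> G t <= W q.
  by move=> tq; apply: ge_inf; [exact: (Einf t).2|exists q].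
have Glow (q : rat) : W q <= G (ratr q).
  apply: lb_le_inf; first exact: (Einf _).1.
  by move=> _ [q' /= qq' <-]; apply: Wmono; rewrite -(ler_rat R) ltW.
have GL t : G t <= L 1.
  have [|q /andP[tq _]] := ratr_gt t (t + 1); first by lra.
  exact: le_trans (Gup _ _ tq) (WL q).
have G0 t : 0 <= G t.
  by apply: lb_le_inf; [exact: (Einf _).1|move=> _ [q' _ <-]].
have ndG : nondecreasing G.
  move=> s t st; apply: lb_le_inf; first exact: (Einf _).1.
  by move=> _ [q' /= tq <-]; apply: Gup; exact: le_lt_trans tq.
exists W, G; split => //.
- split=> // t; apply/cvgrPdist_le => e e0.
  have [_ [q tq <-] Wq] := inf_adherent e0 (Einf t).
  near=> s; have ts : t <= s by near: s; exact: nbhs_right_ge.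
  have sq : s < ratr q by near: s; exact: nbhs_right_lt.
  rewrite distrC ger0_norm ?subr_ge0 ?ndG//.
  have := Gup _ _ sq; rewrite -/(G t) in Wq; lra.
- by split=> // q; rewrite W0 Glow.
- move=> t tx; have [q /andP[tq qx]] := ratr_gt _ _ tx.
  by apply/eqP; rewrite eq_le G0 andbT -(Wx _ qx) Gup.
- have LX : 0 <= L 'X.
    have := @Lpos 'X 0; rewrite mul0r addr0; apply=> t xt.
    have t0 := lt_le_trans x0 xt; by rewrite mul0r addr0 hornerX ltW.
  rewrite -(cvg_shiftS (fun n => G n%:R)) /=.
  apply: (@squeeze_cvgr _ _ _ _ (fun n => L 1 - L 'X * harmonic n) (cst (L 1))).
  + apply: nearW => n; rewrite GL andbT /harmonic/=.
    have q0 : 0 < ratr n.+1%:R :> R by rewrite ratr_nat ltr0n.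
    have := Wtail n.+1%:R q0; have := Glow n.+1%:R; rewrite !ratr_nat => h1 h2.
    by rewrite lerBlDl -lerBlDr (le_trans _ h2)// lerB.
  + rewrite -[X in _ --> X]subr0 -(mulr0 (L 'X)).
    apply: cvgB; first exact: cvg_cst.
    by apply: cvgMr; exact: cvg_harmonic.
  + exact: cvg_cst.
Unshelve. all: by end_near.
Qed.

(** On ]q i, q i.+1] the staircase has the constant value h(q i.+1), which exceeds the nondecreasing
    h there by at most one increment. *)
Lemma staircase_approx (h : R -> R) (w : R) (N : nat) (q : nat -> R) :
  {in `[0%R, +oo[ &, {homo h : s t / s <= t}} ->
  (forall i, (i < N)%N -> 0 <= q i <= q i.+1) -> q 0%N = 0 ->
  (forall i, (i < N)%N -> h (q i.+1) - h (q i) <= w) -> 0 <= w ->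
  forall t, 0 <= t ->
  let S := h 0 + \sum_(i < N) (h (q i.+1) - h (q i)) * (q i < t)%R%:R in
  (q N < t -> S = h (q N)) /\ (t <= q N -> h t <= S <= h t + w).
Proof.
move=> hh; elim: N => [|N IH] qm q0 hw w0 t t0 /=.
  rewrite big_ord0 addr0 q0; split => // t0'.
  have -> : t = 0 by apply/eqP; rewrite eq_le t0'.
  by rewrite lexx lerDl.
have [IH1 IH2] := IH (fun i iN => qm i (ltnW iN)) q0 (fun i iN => hw i (ltnW iN)) w0 t t0.
have /andP[qN qN1] := qm N (ltnSn N).
have hqN := hw N (ltnSn N).
rewrite big_ord_recr /= addrA; split => [qt|tq].
  by have qNt := le_lt_trans qN1 qt; rewrite qNt mulr1 IH1// addrC subrK.
have [qNt|tqN] := ltP (q N) t; last by rewrite mulr0 addr0; exact: IH2.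
rewrite mulr1 IH1// addrC subrK.
have t0' : t \in `[0%R, +oo[ by rewrite in_itv/= t0.
have qN' : q N \in `[0%R, +oo[ by rewrite in_itv/= qN.
have qN1' : q N.+1 \in `[0%R, +oo[ by rewrite in_itv/= (le_trans qN qN1).
have h1 := hh _ _ t0' qN1' tq; have h2 := hh _ _ qN' t0' (ltW qNt).
apply/andP; split; lra.
Qed.

(** The nodes are rational because W is defined on rationals. *)
Lemma rat_partition (M N : nat) : exists q : nat -> rat,
  [/\ ratr (q 0%N) = 0 :> R, ratr (q N.+1) = M%:R :> R &
      forall i, ratr (q i.+1) = ratr (q i) + M%:R / N.+1%:R :> R].
Proof.
have N0 : N.+1%:R != 0 :> R by rewrite pnatr_eq0.
exists (fun i => i%:R * (M%:R / N.+1%:R)); split.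
- by rewrite mul0r rmorph0.
- by rewrite rmorphM fmorph_div /= !ratr_nat mulrCA divff// mulr1.
- by move=> i; rewrite -natr1 mulrDl mul1r rmorphD /= fmorph_div /= !ratr_nat.
Qed.

Section staircase.
Variables (W : rat -> R) (h : R -> R) (M N : nat) (K : R) (p e : {poly R}) (b : R).
Variable q : nat -> rat.
Hypothesis HW : forall p b (l : seq (R * rat)), (forall t, x <= t ->
    0 <= p.[t] + b / (t + 1) + \sum_(z <- l) z.1 * (t <= ratr z.2)%R%:R) ->
  0 <= L p + b * v0 + \sum_(z <- l) z.1 * W z.2.
Hypothesis hh : {in `[0%R, +oo[ &, {homo h : s t / s <= t}}.
Hypothesis hK : forall s t, 0 <= s -> s <= t -> t <= M%:R -> h t - h s <= K * (t - s).
Hypothesis K0 : 0 <= K.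
Hypothesis hE : forall t, 0 <= t -> h t = p.[t] + b / (t + 1).
Hypothesis he : forall t, M%:R <= t -> h t - h M%:R <= e.[t].
Hypothesis e0 : forall t, 0 <= t -> 0 <= e.[t].
Hypothesis q0 : ratr (q 0%N) = 0 :> R.
Hypothesis qN : ratr (q N.+1) = M%:R :> R.
Hypothesis qS : forall i, ratr (q i.+1) = ratr (q i) + M%:R / N.+1%:R :> R.

Let w := K * (M%:R / N.+1%:R).
Let dh i := h (ratr (q i.+1)) - h (ratr (q i)).
Let S := h 0 * L 1 + \sum_(i < N.+1) dh i * (L 1 - W (q i)).

Let w0 : 0 <= w. Proof. by rewrite mulr_ge0. Qed.

Let qle i j : (i <= j)%N -> ratr (q i) <= ratr (q j) :> R.
Proof.
by apply: (@homo_leq _ (fun i => ratr (q i) : R) _ lexx le_trans) => k; rewrite qS lerDl.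
Qed.

Let qge i : 0 <= ratr (q i) :> R.
Proof. by rewrite -q0; exact: qle. Qed.

Lemma staircase_step_le i : (i < N.+1)%N -> 0 <= dh i <= w.
Proof.
move=> iN; apply/andP; split.
  by rewrite subr_ge0 hh ?in_itv/= ?qge//; exact: qle.
have -> : w = K * (ratr (q i.+1) - ratr (q i)) by rewrite qS addrC addKr.
by apply: hK => //; [exact: qle|rewrite -qN; exact: qle].
Qed.

Lemma staircase_bounds t : 0 <= t ->
  let S := h 0 + \sum_(i < N.+1) dh i * (ratr (q i) < t)%R%:R in
  (M%:R < t -> S = h M%:R) /\ (t <= M%:R -> h t <= S <= h t + w).
Proof.
move=> t0; have := @staircase_approx h w N.+1 (fun i => ratr (q i)) hh.
rewrite qN; apply => // i iN; last by case/andP: (staircase_step_le iN).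
by rewrite qge qle.
Qed.

(** Positivity of the extension is applied to staircase + e - h and to h + w - staircase, both
    nonnegative on [x, +oo[; the polynomial e pays for the growth of h beyond the last node M. *)
Lemma staircase_functional : L p + b * v0 - L e <= S <= L p + b * v0 + w * L 1.
Proof.
have Lc c : L c%:P = c * L 1 by rewrite -[c%:P]mulr1 mul_polyC (functionalZ Llin).
have SE : \sum_(i < N.+1) dh i * (L 1 - W (q i)) =
    L ((\sum_(i < N.+1) dh i)%:P) - \sum_(i < N.+1) dh i * W (q i).
  by rewrite Lc mulr_suml -sumrB; apply: eq_bigr => i _; rewrite mulrBr.
have indE (t : R) (i : 'I_N.+1) : (t <= ratr (q i))%R%:R = 1 - (ratr (q i) < t)%R%:R :> R.
  by rewrite leNgt; case: (ratr (q i) < t)%R; rewrite ?subrr ?subr0.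
have sumE (t : R) : \sum_(i < N.+1) dh i * (t <= ratr (q i))%R%:R =
    \sum_(i < N.+1) dh i - \sum_(i < N.+1) dh i * (ratr (q i) < t)%R%:R.
  by rewrite -sumrB; apply: eq_bigr => i _; rewrite indE mulrBr mulr1.
have LN r : L (- r) = - L r by rewrite -scaleN1r (functionalZ Llin) mulN1r.
have sumN (F : nat -> R) : \sum_(i < N.+1) - dh i * F i = - \sum_(i < N.+1) dh i * F i.
  by rewrite -sumrN; apply: eq_bigr => i _; rewrite mulNr.
apply/andP; split.
  have := @HW (h 0 *: 1 + (\sum_(i < N.+1) dh i)%:P - p + e) (- b)
    [seq (- dh i, q i) | i : 'I_N.+1 <- index_enum _].
  rewrite big_map /= !(functionalD Llin, LN, functionalZ Llin) (sumN (fun i => W (q i))) => H.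
  rewrite /S SE; suff : 0 <= h 0 * L 1 + L (\sum_(i < N.+1) dh i)%:P - L p + L e + - b * v0 -
    \sum_(i < N.+1) dh i * W (q i) by lra.
  apply: H => t xt; have t0 := le_trans (ltW x0) xt.
  rewrite big_map /= (sumN (fun i => (t <= ratr (q i))%R%:R)) sumE.
  have [S1 S2] := staircase_bounds t0; have hEt := hE t0.
  rewrite !(hornerD, hornerN, hornerZ, hornerC).
  have [tM|Mt] := leP t M%:R.
    have /andP[? ?] := S2 tM; have := e0 t0; lra.
  have := S1 Mt; have := he (ltW Mt); lra.
have := @HW (p - h 0 *: 1 - (\sum_(i < N.+1) dh i)%:P + w *: 1) b
    [seq (dh i, q i) | i : 'I_N.+1 <- index_enum _].
rewrite big_map /= !(functionalD Llin, LN, functionalZ Llin) => H.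
rewrite /S SE; suff : 0 <= L p - h 0 * L 1 - L (\sum_(i < N.+1) dh i)%:P + w * L 1 + b * v0 +
    \sum_(i < N.+1) dh i * W (q i) by lra.
apply: H => t xt; have t0 := le_trans (ltW x0) xt.
rewrite big_map /= sumE; have [S1 S2] := staircase_bounds t0; have hEt := hE t0.
rewrite !(hornerD, hornerN, hornerZ, hornerC).
have [tM|Mt] := leP t M%:R.
  have /andP[? ?] := S2 tM; lra.
have := S1 Mt => S1'.
have : h M%:R <= h t by apply: hh; rewrite ?in_itv/= ?ler0n ?t0 ?ltW.
have := w0; lra.
Qed.

Variable G : R -> R.
Hypothesis WG : forall r, W r <= G (ratr r).
Hypothesis GW : forall t r, t < ratr r -> G t <= W r.
Hypothesis W1 : forall r, 0 <= W r <= L 1.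
Variable m : {measure set R -> \bar R}.
Hypothesis mtail : forall t, m `]t, +oo[%classic = (L 1 - G t)%:E.
Hypothesis mD : m D = (L 1)%:E.
Hypothesis M0 : (0 < M)%N.

(** The measure sees G at the nodes, the functional sees W. As W(q i) <= G(q i) <= W(q i.+1), the
    two staircase values differ by a telescoping sum of at most w L(1). A second w L(1) is the
    distance from the staircase to min(h, h(M)). *)
Lemma staircase_measure :
  S - 2 * w * L 1 <= \int[m]_(t in D) Num.min (h t) (h M%:R) <= S.
Proof.
pose S' := h 0 * L 1 + \sum_(i < N.+1) dh i * (L 1 - G (ratr (q i))).
have dl0 : 0 < M%:R / N.+1%:R :> R by rewrite divr_gt0// ltr0n.
have L10 : 0 <= L 1 by have /andP[] := W1 0; exact: le_trans.
have S'S : S - w * L 1 <= S' <= S.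
  apply/andP; split; last first.
    rewrite /S' /S lerD2l; apply: ler_sum => i _.
    by apply: ler_wpM2l; [have /andP[] := staircase_step_le (ltn_ord i)|rewrite lerD2l lerN2].
  rewrite lerBlDr -lerBlDl /S /S' opprD addrACA subrr add0r -sumrB.
  apply: (@le_trans _ _ (\sum_(i < N.+1) w * (W (q i.+1) - W (q i)))).
    apply: ler_sum => i _; rewrite -mulrBr.
    have -> : L 1 - W (q i) - (L 1 - G (ratr (q i))) = G (ratr (q i)) - W (q i) by lra.
    have /andP[d0 dw] := staircase_step_le (ltn_ord i).
    apply: (@le_trans _ _ (w * (G (ratr (q i)) - W (q i)))).
      by rewrite ler_wpM2r// subr_ge0.
    by rewrite ler_wpM2l// lerD2r GW// qS ltrDl.
  rewrite -mulr_sumr ler_wpM2l// -(big_mkord xpredT (fun i => W (q i.+1) - W (q i))).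
  rewrite telescope_sumr//; have /andP[_ h1] := W1 (q N.+1); have /andP[h2 _] := W1 (q 0%N).
  lra.
have mDoo : (m D < +oo)%E by rewrite mD ltry.
pose phi t := h 0 + \sum_(i < N.+1) dh i * \1_(`]ratr (q i), +oo[%classic : set R) t.
have phiE t : phi t = h 0 + \sum_(i < N.+1) dh i * (ratr (q i) < t)%R%:R.
  congr (_ + _); apply: eq_bigr => i _; congr (_ * _).
  by rewrite indicE mem_setE in_itv/= andbT.
have ic c : m.-integrable D (EFin \o cst (c : R)).
  apply: measurable_bounded_integrable => //.
  by exists `|c|; split=> // k kc t _; rewrite /= ltW.
have ii i : m.-integrable D (EFin \o (fun t => dh i * \1_(`]ratr (q i), +oo[%classic : set R) t)).
  by apply: integrable_realZ => //; exact: integrable_indic.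
have iphi : m.-integrable D (EFin \o phi).
  by apply: integrable_realD => //; [exact: ic|apply: integrable_real_sum => // i].
have phiI : \int[m]_(t in D) phi t = S'.
  rewrite /phi RintegralD//; [|exact: ic|exact: integrable_real_sum].
  rewrite Rintegral_cst// mD /= /S'; congr (_ + _).
  rewrite Rintegral_sum//; apply: eq_bigr => i _.
  rewrite RintegralZl//; last exact: integrable_indic.
  rewrite Rintegral_indic//; congr (_ * _).
  rewrite (_ : _ `&` D = `]ratr (q i), +oo[%classic) ?mtail//.
  apply/seteqP; split => t /=; first by move=> [].
  by rewrite !in_itv/= !andbT => qt; split => //; exact: le_trans (qge i) (ltW qt).
have bnd t : 0 <= t -> phi t - w <= Num.min (h t) (h M%:R) <= phi t.
  move=> t0; rewrite phiE; have [S1 S2] := staircase_bounds t0.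
  have [tM|Mt] := leP t M%:R.
    rewrite (_ : Num.min _ _ = h t); last first.
      by apply/min_idPl; rewrite hh ?in_itv/= ?ler0n ?t0.
    by have /andP[? ?] := S2 tM; apply/andP; split => //; lra.
  rewrite (_ : Num.min _ _ = h M%:R).
    by rewrite (S1 Mt) lexx andbT gerBl.
  by apply/min_idPr; rewrite hh ?in_itv/= ?ler0n ?t0// ltW.
have mh : measurable_fun D h.
  apply: (@eq_measurable_fun _ _ _ _ _ (fun t => p.[t] + b * (1.[t] / (t + 1) ^+ 1))).
    by move=> t; rewrite inE/= in_itv/= andbT => t0; rewrite hE// hornerC expr1 div1r.
  apply: measurable_funD; first by apply: measurable_funS (measurable_horner p).
  by apply: measurable_funM => //; exact: measurable_rational.
have imin : m.-integrable D (EFin \o (fun t => Num.min (h t) (h M%:R))).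
  apply: (@integrable_bounded_by _ _ _ _ _ _ (fun t => `|phi t| + w)) => //.
  - by apply: measurable_minr.
  - by apply: integrable_realD => //; [exact: integrable_norm iphi|exact: ic].
  - move=> t; rewrite /= in_itv/= andbT => /bnd/andP[h1 h2].
    rewrite ler_norml; have := ler_norm (phi t); have := ler_norm (- phi t).
    rewrite normrN => *; apply/andP; split; lra.
have /andP[h1 h2] := S'S.
apply/andP; split; last first.
  apply: le_trans h2; rewrite -phiI; apply: le_Rintegral => // t.
  by rewrite /= in_itv/= andbT => /bnd/andP[].
apply: (@le_trans _ _ (S' - w * L 1)); first by lra.
rewrite -phiI; have -> : w * L 1 = \int[m]_(t in D) cst w t by rewrite Rintegral_cst// mD.
rewrite -RintegralB//.
apply: le_Rintegral => //; first by apply: integrable_realB => //; exact: ic.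
by move=> t; rewrite /= in_itv/= andbT => /bnd/andP[].
Qed.

End staircase.

Lemma archimedean_le (u v B : R) : (forall n : nat, u <= v + B / n.+1%:R) -> u <= v.
Proof.
move=> H; rewrite leNgt; apply/negP => vu.
have uv0 : 0 < u - v by rewrite subr_gt0.
pose n := Num.trunc (`|B| / (u - v)).
have : `|B| / (u - v) < n.+1%:R by exact: truncnS_gt.
rewrite ltr_pdivrMr// => h; have := H n; rewrite -lerBlDl ler_pdivlMr ?ltr0n//.
by have := ler_norm B; rewrite mulrC; lra.
Qed.

Section integral_of_staircase_limit.
Variables (W : rat -> R) (G : R -> R) (m : {measure set R -> \bar R}).
Hypothesis HW : forall p b (l : seq (R * rat)), (forall t, x <= t ->
    0 <= p.[t] + b / (t + 1) + \sum_(z <- l) z.1 * (t <= ratr z.2)%R%:R) ->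
  0 <= L p + b * v0 + \sum_(z <- l) z.1 * W z.2.
Hypothesis WG : forall r, W r <= G (ratr r).
Hypothesis GW : forall t r, t < ratr r -> G t <= W r.
Hypothesis W1 : forall r, 0 <= W r <= L 1.
Hypothesis mtail : forall t, m `]t, +oo[%classic = (L 1 - G t)%:E.
Hypothesis mD : m D = (L 1)%:E.

Variables (h : R -> R) (p E : {poly R}) (b : R).
Hypothesis hh : {in `[0%R, +oo[ &, {homo h : s t / s <= t}}.
Hypothesis h0 : 0 <= h 0.
Hypothesis hK : forall M : nat, exists2 K, 0 <= K &
  forall s t, 0 <= s -> s <= t -> t <= M%:R -> h t - h s <= K * (t - s).
Hypothesis hE : forall t, 0 <= t -> h t = p.[t] + b / (t + 1).
Hypothesis he : forall (M : nat) t, (0 < M)%N -> M%:R <= t -> h t - h M%:R <= E.[t] / M%:R.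
Hypothesis E0 : forall t, 0 <= t -> 0 <= E.[t].

(** With M fixed, refining the partition removes the errors of order w. The tail error L(E)/M
    remains; it vanishes in [staircase_limit_integral], where the truncation is lifted by monotone
    convergence. *)
Lemma truncated_integral M : (0 < M)%N ->
  L p + b * v0 - L E / M%:R <= \int[m]_(t in D) Num.min (h t) (h M%:R) <= L p + b * v0.
Proof.
move=> M0; have [K K0 HK] := hK M.
have e0 t : 0 <= t -> 0 <= (M%:R^-1 *: E).[t].
  by move=> t0; rewrite hornerZ mulr_ge0 ?invr_ge0// E0.
have heM t : M%:R <= t -> h t - h M%:R <= (M%:R^-1 *: E).[t].
  by move=> Mt; rewrite hornerZ mulrC he.
pose B2 := K * M%:R * L 1; pose B := 2 * B2.
have bounds N :
    L p + b * v0 - L E / M%:R <= \int[m]_(t in D) Num.min (h t) (h M%:R) + B / N.+1%:R /\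
   \int[m]_(t in D) Num.min (h t) (h M%:R) <= L p + b * v0 + B2 / N.+1%:R.
  have [q [q0 qN qS]] := rat_partition M N.
  have := staircase_functional HW hh HK K0 hE heM e0 q0 qN qS.
  have := staircase_measure hh HK K0 hE q0 qN qS WG GW W1 mtail mD M0.
  rewrite (functionalZ Llin) [M%:R^-1 * _]mulrC.
  have -> : K * (M%:R / N.+1%:R) = K * M%:R / N.+1%:R by rewrite mulrA.
  have -> : B / N.+1%:R = 2 * (K * M%:R / N.+1%:R) * L 1 by rewrite /B /B2; ring.
  have -> : B2 / N.+1%:R = (K * M%:R / N.+1%:R) * L 1 by rewrite /B2; ring.
  by move: (K * M%:R / N.+1%:R) => c /andP[? ?] /andP[? ?]; split; lra.
apply/andP; split; apply: archimedean_le => n; [exact: (bounds n).1|exact: (bounds n).2].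
Qed.

Lemma staircase_limit_integral : m.-integrable D (EFin \o h) /\
  \int[m]_(t in D) h t = L p + b * v0.
Proof.
have mh : measurable_fun D h.
  apply: (@eq_measurable_fun _ _ _ _ _ (fun t => p.[t] + b * (1.[t] / (t + 1) ^+ 1))).
    by move=> t; rewrite inE/= in_itv/= andbT => t0; rewrite hE// hornerC expr1 div1r.
  apply: measurable_funD; first by apply: measurable_funS (measurable_horner p).
  by apply: measurable_funM => //; exact: measurable_rational.
have hge t : 0 <= t -> 0 <= h t.
  by move=> t0; apply: (le_trans h0); apply: hh; rewrite ?in_itv/= ?lexx ?t0.
pose g n t : R := Num.min (h t) (h n.+1%:R).
have mg n : measurable_fun D (g n) by apply: measurable_minr.
have ig n : m.-integrable D (EFin \o g n).
  apply: measurable_bounded_integrable => //; first by rewrite mD ltry.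
  exists (h n.+1%:R); split; first exact: num_real.
  move=> k hk t; rewrite /= in_itv/= andbT => t0; rewrite ger0_norm.
    by rewrite (le_trans _ (ltW hk))// ge_min lexx orbT.
  by rewrite le_min !hge.
have c : (\int[m]_(t in D) (g n t)%:E)%E @[n --> \oo] -->
    (\int[m]_(t in D) limn (fun n => (g n t)%:E))%E.
  apply: cvg_monotone_convergence => //.
  - by move=> n; exact/measurable_EFinP.
  - by move=> n t; rewrite /= in_itv/= andbT => t0; rewrite lee_fin le_min !hge.
  - move=> t; rewrite /= in_itv/= andbT => t0 i j ij; rewrite lee_fin /g le_min ge_min lexx /=.
    by rewrite ge_min; apply/orP; right; apply: hh; rewrite ?in_itv/= ?ler0n// ler_nat.
have limE t : D t -> limn (fun n => (g n t)%:E) = (h t)%:E.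
  rewrite /= in_itv/= andbT => t0; apply: cvg_lim => //; apply: cvg_EFin; first exact: nearW.
  apply: cvg_near_cst; exists (Num.trunc t).+1 => // n /= tn; apply/min_idPl.
  apply: hh; rewrite ?in_itv/= ?t0 ?ler0n//; apply/ltW/(lt_le_trans (truncnS_gt _)).
  by rewrite ler_nat ltnW.
have cI : (\int[m]_(t in D) (g n t)%:E)%E @[n --> \oo] --> (L p + b * v0)%:E.
  rewrite (_ : (fun n => _) = (fun n => (\int[m]_(t in D) g n t)%:E)); last first.
    by apply/funext => n; rewrite /Rintegral fineK//; apply: integrable_fin_num => //; exact: ig.
  apply: cvg_EFin; first exact: nearW.
  apply: (@squeeze_cvgr _ _ _ _ (fun n => L p + b * v0 - L E * harmonic n) (cst (L p + b * v0))).
  - by apply: nearW => n; exact: truncated_integral.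
  - rewrite -[X in _ --> X]subr0 -(mulr0 (L E)).
    apply: cvgB; first exact: cvg_cst.
    by apply: cvgMr; exact: cvg_harmonic.
  - exact: cvg_cst.
have IE : (\int[m]_(t in D) (h t)%:E)%E = (L p + b * v0)%:E.
  rewrite -(cvg_unique _ c cI); first by apply: eq_integral => t; rewrite inE => Dt; rewrite limE.
  exact: ereal_hausdorff.
split; last by rewrite /Rintegral IE.
apply/integrableP; split; first exact/measurable_EFinP.
rewrite (_ : (\int[m]_(t in D) _)%E = (L p + b * v0)%:E) ?ltry// -IE.
apply: eq_integral => t; rewrite inE/= in_itv/= andbT => t0.
by rewrite ger0_norm// hge.
Qed.

End integral_of_staircase_limit.

Lemma inv_succ_lipschitz (s t : R) : 0 <= s -> s <= t ->
  1 - (t + 1)^-1 - (1 - (s + 1)^-1) <= t - s.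
Proof.
move=> s0 st; have s1 : 0 < s + 1 by lra.
have t1 : 0 < t + 1 by lra.
have -> : 1 - (t + 1)^-1 - (1 - (s + 1)^-1) = (t - s) / ((s + 1) * (t + 1)).
  by field; rewrite !gt_eqF.
rewrite ler_pdivrMr ?mulr_gt0// ler_peMr ?subr_ge0//.
have : 0 <= s * t by apply: mulr_ge0; lra.
lra.
Qed.

Lemma inv_succ_growth (M : nat) (t : R) : (0 < M)%N -> M%:R <= t ->
  1 - (t + 1)^-1 - (1 - (M%:R + 1)^-1) <= t / M%:R.
Proof.
move=> M0 Mt; have M0' : 0 < M%:R :> R by rewrite ltr0n.
have t1 : 1 <= t / M%:R by rewrite ler_pdivlMr// mul1r.
have : 0 <= (t + 1)^-1 by rewrite invr_ge0; lra.
have : (M%:R + 1)^-1 <= 1 :> R by rewrite invf_le1; lra.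
lra.
Qed.

Lemma haviland : exists m : {measure set R -> \bar R},
  [/\ half_line_moment_measure m, m `]-oo, x[%classic = 0%E,
      forall p, wint m 0 p = L p & wint m 1 1 = v0].
Proof.
have [W [G [HW [ndG rcG] [WG GW] Gx GL]]] := ray_distribution.
have [m mG] := nondecreasing_measure ndG rcG.
have mtail t : m `]t, +oo[%classic = (L 1 - G t)%:E.
  exact: nondecreasing_measure_tail mG GL.
have mNx : m `]-oo, x[%classic = 0%E.
  apply/negligibleP => //.
  have -> : `]-oo, x[%classic = \bigcup_n `]x - n.+1%:R, x - n.+1%:R^-1]%classic :> set R.
    apply/seteqP; split => t /=; last first.
      move=> [n _] /=; rewrite !in_itv/= => /andP[_ /le_lt_trans]; apply.
      by rewrite ltrBlDr ltrDl invr_gt0.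
    rewrite in_itv/= => tx; have xt0 : 0 < x - t by rewrite subr_gt0.
    pose n := Num.trunc (Num.max (x - t) (x - t)^-1).
    have : Num.max (x - t) (x - t)^-1 < n.+1%:R by exact: truncnS_gt.
    rewrite gt_max => /andP[h1 h2]; exists n => //=; rewrite in_itv/=; apply/andP; split.
      by lra.
    rewrite lerBrDl -lerBrDr -[leRHS]invrK lef_pV2 ?posrE ?invr_gt0//; exact: ltW.
  apply: negligible_bigcup => n; apply/negligibleP => //.
  have h0 : (n.+1%:R^-1 : R) <= n.+1%:R.
    by rewrite (@le_trans _ _ 1)// ?invf_le1 ?ler1n.
  apply: etrans (mG _ _ (lerB (lexx x) h0)) _.
  by rewrite !Gx ?subrr// ltrBlDr ltrDl ?invr_gt0.
have G0 t : t < x -> m `]t, +oo[%classic = (L 1)%:E by move=> tx; rewrite mtail Gx// subr0.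
have mD : m D = (L 1)%:E.
  apply/eqP; rewrite eq_le; apply/andP; split.
    have n1 : -1 < x by apply: lt_trans x0.
    rewrite -(G0 _ n1) le_measure ?inE// => t /=; rewrite !in_itv/= !andbT.
    by apply: lt_le_trans.
  have n1 : x / 2 < x by rewrite ltr_pdivrMr// ltr_pMr// ltr1n.
  rewrite -(G0 _ n1) le_measure ?inE// => t /=; rewrite !in_itv/= !andbT => /ltW.
  by apply: le_trans; rewrite divr_ge0// ltW.
have WG' r : W r <= G (ratr r) by case/andP: (WG r).
have W1 r : 0 <= W r <= L 1.
  have := HW 0 0 [:: (1, r)]; have := HW 1 0 [:: (-1, r)].
  rewrite !big_seq1 (functional0 Llin) !mul0r !addr0 !add0r mul1r mulN1r subr_ge0 /=.
  move=> h1 h2; apply/andP; split; [apply: h2|apply: h1] => t _.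
    by rewrite mul0r addr0 big_seq1 horner0 add0r mul1r.
  by rewrite mul0r addr0 big_seq1 mulN1r hornerC /= subr_ge0; case: (t <= ratr r)%R.
(* The tail polynomial is X^(j+1), as t^j <= t^(j+1) / M for t >= M. *)
have mono j : m.-integrable D (EFin \o (fun t => t ^+ j)) /\
    \int[m]_(t in D) t ^+ j = L 'X^j.
  have := @staircase_limit_integral W G m HW WG' GW W1 mtail mD (fun t => t ^+ j) 'X^j 'X^(j.+1) 0.
  rewrite mul0r addr0; apply.
  - move=> s t; rewrite !in_itv/= !andbT => s0 t0 st; exact: lerXn2r.
  - by rewrite exprn_ge0.
  - move=> M; exists (j%:R * M%:R ^+ j.-1); first by rewrite mulr_ge0// exprn_ge0.
    move=> s t s0 st tM; rewrite subrXX mulrC ler_wpM2r ?subr_ge0//.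
    rewrite -[j in j%:R]card_ord -sum1_card natr_sum mulr_suml; apply: ler_sum => i _.
    rewrite mul1r; have t0 := le_trans s0 st.
    have {2}-> : j.-1 = (j.-1 - i + i)%N.
      by rewrite subnK// -ltnS prednK// (leq_ltn_trans _ (ltn_ord i)).
    rewrite exprD ler_pM ?exprn_ge0// lerXn2r ?nnegrE//; exact: le_trans tM.
  - by move=> t _; rewrite hornerXn mul0r addr0.
  - move=> M t M0 Mt; rewrite hornerXn ler_pdivlMr ?ltr0n// exprSr.
    have t0 : 0 <= t by apply: le_trans Mt.
    apply: (@le_trans _ _ (t ^+ j * M%:R)); last by rewrite ler_wpM2l// exprn_ge0.
    by rewrite ler_wpM2r// lerBlDr lerDl exprn_ge0.
  - by move=> t t0; rewrite hornerXn exprn_ge0.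
(* The staircase estimate wants a nondecreasing function, hence 1 - 1/(t + 1), that is p = 1 and b =
   -1. *)
have bnd : m.-integrable D (EFin \o (fun t => 1 - (t + 1)^-1)) /\
    \int[m]_(t in D) (1 - (t + 1)^-1) = L 1 - v0.
  have := @staircase_limit_integral W G m HW WG' GW W1 mtail mD (fun t => 1 - (t + 1)^-1) 1 'X (-1).
  rewrite mulN1r; apply.
  - move=> s t; rewrite !in_itv/= !andbT => s0 t0 st.
    rewrite lerD2l lerN2 lef_pV2 ?posrE; lra.
  - by rewrite add0r invr1 subrr.
  - move=> M; exists 1 => // s t s0 st _; rewrite mul1r.
    exact: inv_succ_lipschitz.
  - by move=> t _; rewrite hornerC mulN1r.
  - move=> M t M0 Mt; rewrite hornerX; exact: inv_succ_growth.
  - by move=> t t0; rewrite hornerX.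
have hm : half_line_moment_measure m.
  split.
    apply/eqP; rewrite -measure_le0 -mNx le_measure ?inE// => t /=; rewrite !in_itv/=.
    by move=> t0; exact: lt_trans x0.
  move=> p; rewrite (_ : (fun t => _) = EFin \o (fun t => \sum_(i < size p) p`_i * t ^+ i)).
    by apply: integrable_real_sum => // i; apply: integrable_realZ => //; exact: (mono i).1.
  by apply/funext => t /=; rewrite horner_coef.
exists m; split => //.
  move=> p; rewrite -{2}[p]coefK poly_def (functional_sum Llin) wint0E.
  under eq_Rintegral do rewrite horner_coef.
  rewrite Rintegral_sum//; last by move=> i; apply: integrable_realZ => //; exact: (mono i).1.
  apply: eq_bigr => i _; rewrite (functionalZ Llin) RintegralZl//; last exact: (mono i).1.
  by rewrite (mono i).2.
have := bnd.2; rewrite RintegralB//; first last.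
- by move: (integrable_rational hm 1 1); rewrite (_ : (fun t => _) = (fun t => (t + 1)^-1))//;
    apply/funext => t; rewrite hornerC expr1 div1r.
- by move: (integrable_rational hm 0 1); rewrite (_ : (fun t => _) = cst 1)//;
    apply/funext => t; rewrite hornerC expr0 divr1.
rewrite Rintegral_cst// mD mul1r /= => /addrI/oppr_inj <-.
by apply: eq_Rintegral => t _; rewrite hornerC expr1 div1r.
Qed.

End haviland.

(** * A second solution supported away from 0 *)

Section second_solution.
Context {R : realType}.
Implicit Types (p q r A B : {poly R}).
Variables nu tau : {measure set R -> \bar R}.
Hypothesis hnu : half_line_moment_measure nu.
Hypothesis htau : half_line_moment_measure tau.
Hypothesis nu_tau : forall p, wint nu 0 p = wint tau 0 p.
Hypothesis nu_ne_tau : ~ (forall E : set R, measurable E -> nu E = tau E).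
Hypothesis nu0 : nu [set 0] = 0%E.
Local Notation L := (wint nu 0).
Let Llin := wint_linear hnu 0.

Lemma sos_eval_le C B : 0 < C -> (forall p, p.[-1] ^+ 2 <= C * L (p ^+ 2)) -> sos B ->
  B.[-1] <= C * L B.
Proof.
move=> C0 HC; elim=> [|r p _ IH]; first by rewrite horner0 (functional0 Llin) mulr0.
by rewrite hornerD horner_exp (functionalD Llin) mulrDr lerD.
Qed.

Lemma separated_positivity e p : (forall r, e * L (r ^+ 2) <= L ('X * r ^+ 2)) ->
  (forall t, e <= t -> 0 <= p.[t]) -> 0 <= L p.
Proof.
move=> He /half_line_ge0_sos[A [B [sA sB ->]]].
rewrite (functionalD Llin) addr_ge0//.
  by apply: wint_ge0 => t _; exact: sos_ge0.
elim: sB => [|r q _ IH]; first by rewrite mulr0 (functional0 Llin).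
rewrite mulrDr (functionalD Llin) addr_ge0// mulrBl (functionalB Llin) mul_polyC.
by rewrite (functionalZ Llin) subr_ge0.
Qed.

(* The values of positive extensions of [L] to [1 / (X + 1)] fill a nondegenerate
   interval once the half-line is slightly enlarged: a majorant [p] of
   [1 / (X + 1)] gives [(X + 1) p - 1 = A + (X - x) B] whose value [-1] at [-1]
   forces [B(-1)], hence [L B], to be bounded below. *)
Lemma second_positive_extension C e v : 0 < C -> 0 < e ->
  (forall p, p.[-1] ^+ 2 <= C * L (p ^+ 2)) ->
  (forall p b, (forall t, e <= t -> 0 <= p.[t] + b / (t + 1)) -> 0 <= L p + b * v) ->
  exists2 v', v < v' & forall p b,
    (forall t, e / 2 <= t -> 0 <= p.[t] + b / (t + 1)) -> 0 <= L p + b * v'.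
Proof.
move=> C0 e0 HC Hv; pose x := e / 2; have x0 : 0 < x by rewrite /x; lra.
(* dl is the least value of (t - x)/(t + 1) on t >= e, and k below is the resulting gain: - b <= (1
   + x) B(-1) <= (1 + x) C L(B), so - b k <= dl L(B). *)
pose dl := (e - x) / (e + 1); have dl0 : 0 < dl by rewrite divr_gt0 /x; lra.
pose k := dl / (C * (1 + x)).
have k0 : 0 < k by rewrite divr_gt0// mulr_gt0//; lra.
exists (v + k); first by lra.
move=> p b H; rewrite mulrDr addrA.
have [b0|b0] := leP 0 b.
  apply: addr_ge0; last by rewrite mulr_ge0 // ltW.
  by apply: Hv => t et; apply: H; lra.
pose w := p * ('X - (-1)%:P) + b%:P.
have [A [B [sA sB wE]]] : half_line_sos x w.
  apply: half_line_ge0_sos => t xt; have := H t xt => Ht.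
  have t1 : 0 < t + 1 by lra.
  rewrite !hornerE opprK; have := mulr_ge0 (ltW t1) Ht.
  by rewrite mulrDr mulrCA divff ?gt_eqF// mulr1 mulrC.
have [QA QAE] := horner_split A (-1).
have [QB QBE] := horner_split (('X - x%:P) * B) (-1).
have bE : b = A.[-1] + (('X - x%:P) * B).[-1].
  by rewrite -hornerD -wE /w hornerD hornerC hornerM hornerXsubC subrr mulr0 add0r.
have pE : p = QA + QB.
  apply: (@mulIf _ ('X - (-1)%:P)); first by rewrite polyXsubC_eq0.
  have : w - b%:P = A + ('X - x%:P) * B - b%:P by rewrite wE.
  rewrite {1}/w addrK => ->; rewrite {1}QAE {1}QBE bE polyCD; ring.
have hA : 0 <= L QA + A.[-1] * v.
  apply: Hv => t et; have t1 : 0 < t + 1 by lra.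
  have := sos_ge0 t sA; rewrite {1}QAE !hornerE opprK => h.
  have -> : QA.[t] + A.[-1] / (t + 1) = (QA.[t] * (t + 1) + A.[-1]) / (t + 1).
    by rewrite mulrDl mulfK// gt_eqF.
  by rewrite divr_ge0// ltW.
(* Divided by t + 1, the term (t - x) B(t) is at least dl B(t) on t >= e. Positivity with the old
   value v therefore leaves dl L(B) to spend on raising v. *)
have hB : 0 <= L (QB - dl *: B) + (('X - x%:P) * B).[-1] * v.
  apply: Hv => t et; have t1 : 0 < t + 1 by lra.
  have c : (t - x) * B.[t] = QB.[t] * (t + 1) + (('X - x%:P) * B).[-1].
    by rewrite -[t - x]hornerXsubC -hornerM {1}QBE !hornerE opprK.
  have -> : (QB - dl *: B).[t] + (('X - x%:P) * B).[-1] / (t + 1) =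
      ((t - x) / (t + 1) - dl) * B.[t].
    rewrite hornerD hornerN hornerZ; move: (_.[-1]) c => cB c.
    transitivity ((t - x) * B.[t] / (t + 1) - dl * B.[t]); last by ring.
    by rewrite c mulrDl mulfK ?gt_eqF//; ring.
  apply: mulr_ge0; last exact: sos_ge0.
  have e1 : 0 < e + 1 by lra.
  rewrite subr_ge0 /dl ler_pdivrMr// mulrAC ler_pdivlMr//.
  have : 0 <= (t - e) * (1 + x) by apply: mulr_ge0; lra.
  lra.
have LB : B.[-1] <= C * L B := sos_eval_le C0 HC sB.
have A1 : 0 <= A.[-1] by exact: sos_ge0.
have bE' : b = A.[-1] - (1 + x) * B.[-1].
  by rewrite bE hornerM hornerXsubC; ring.
have hb : - b / (1 + x) <= C * L B.
  by apply: le_trans LB; rewrite ler_pdivrMr; lra.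
have bk : - (b * k) <= dl * L B.
  have -> : - (b * k) = dl / C * (- b / (1 + x)).
    by rewrite /k; field; rewrite !gt_eqF//; lra.
  apply: (@le_trans _ _ (dl / C * (C * L B))); last by rewrite mulrA divfK// gt_eqF.
  by rewrite ler_wpM2l// divr_ge0// ltW.
move: hB; rewrite (functionalB Llin) (functionalZ Llin) => hB.
rewrite {1}pE (functionalD Llin) {1}bE mulrDl; lra.
Qed.

(** The values v, on [e, +oo[, and v' > v, on [e/2, +oo[, are both represented by measures with the
    moments of nu. If v is the integral of 1/(t + 1) against nu, then v' is not. *)
Lemma second_moment_solution : exists (s : {measure set R -> \bar R}) (x : R),
  [/\ 0 < x, half_line_moment_measure s, s `]-oo, x[%classic = 0%E,
      forall p, wint s 0 p = L p & wint s 1 1 != wint nu 1 1].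
Proof.
have [C [C0 HC]] := bounded_evaluation hnu htau nu_tau nu_ne_tau.
have [e [e0 He]] := coercive hnu C0 HC nu0.
pose f (n : nat) (t : R) := (t + 1)^-1.
have f01 n t : e <= t -> 0 <= f n t <= 1.
  by move=> et; rewrite /f invr_ge0 invf_le1; lra.
(* The Riesz step for 1/(t + 1) as first function: with nothing adjoined before it, [minorants] does
   not depend on its argument [V]. *)
pose v := sup (minorants L e f (fun=> 0) 0).
have pos0 : positive_upto L e f (fun=> v) 0.
  move=> p b H; rewrite big_ord0 addr0; apply: (separated_positivity He) => t et.
  by have := H t et; rewrite big_ord0 addr0.
have vE : v = sup (minorants L e f (fun=> v) 0).
  by congr sup; apply/seteqP; split => y [p [b [Hp ->]]]; exists p, b; rewrite !big_ord0.
have pos1 := positive_upto_step Llin f01 pos0 vE.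
have Hv p b : (forall t, e <= t -> 0 <= p.[t] + b / (t + 1)) -> 0 <= L p + b * v.
  move=> H; have := pos1 p (fun=> b); rewrite big_ord1; apply => t et.
  by rewrite big_ord1; exact: H.
have [v' vv' Hv'] := second_positive_extension C0 e0 HC Hv.
have e2 : 0 < e / 2 by lra.
have [s [hs s0 Ls s1]] := haviland Llin e0 Hv.
have [s' [hs' s0' Ls' s1']] := haviland Llin e2 Hv'.
have [eqv|nev] := eqVneq v (wint nu 1 1); last by exists s, e; rewrite s1.
by exists s', (e / 2); rewrite s1' -eqv gt_eqF.
Qed.

End second_solution.

(** * Charges and harmonic decomposition of polynomials *)

Section measure_comparison.
Context {dT : measure_display} {T : measurableType dT} {R : realType}.
Implicit Types (m : {measure set T -> \bar R}) (f : T -> R).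

Lemma integrable_le_measure m1 m2 f :
  (forall A, measurable A -> (m1 A <= m2 A)%E) ->
  m2.-integrable setT (EFin \o f) -> m1.-integrable setT (EFin \o f).
Proof.
move=> m12 if2; have mf := measurable_int _ if2.
apply/integrableP; split => //; have /integrableP[_] := if2.
apply: le_lt_trans; apply: ge0_le_measure_integral => //.
exact: measurableT_comp.
Qed.

Lemma integrable_measure_add m1 m2 f : m1.-integrable setT (EFin \o f) ->
  m2.-integrable setT (EFin \o f) ->
  (measure_add m1 m2).-integrable setT (EFin \o f).
Proof.
move=> if1 if2; have mf := measurable_int _ if1.
apply/integrableP; split => //; have /integrableP[_ f1] := if1.
have /integrableP[_ f2] := if2.
rewrite ge0_integral_measure_add//; last exact: measurableT_comp.
exact: lte_add_pinfty.
Qed.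

Lemma Rintegral_measure_add m1 m2 f : m1.-integrable setT (EFin \o f) ->
  m2.-integrable setT (EFin \o f) ->
  \int[measure_add m1 m2]_x f x = \int[m1]_x f x + \int[m2]_x f x.
Proof.
move=> if1 if2; rewrite /Rintegral integral_measure_add//.
by rewrite fineD//; exact: integrable_fin_num.
Qed.

Lemma eq_Rintegral_measure m1 m2 f : (forall A, measurable A -> m1 A = m2 A) ->
  \int[m1]_x f x = \int[m2]_x f x.
Proof.
by move=> m12; rewrite /Rintegral (eq_measure_integral m2)// => A mA _; exact: m12.
Qed.

Lemma eq_integrable_measure m1 m2 f : (forall A, measurable A -> m1 A = m2 A) ->
  m2.-integrable setT (EFin \o f) -> m1.-integrable setT (EFin \o f).
Proof. by move=> m12; apply: integrable_le_measure => A mA; rewrite m12. Qed.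

End measure_comparison.

(** * Integration against charges *)

Section charges.
Context {dT : measure_display} {T : measurableType dT} {R : realType}.
Implicit Types (sigma : {charge set T -> \bar R}) (f g : T -> R).

Lemma charge_decomp sigma A : measurable A ->
  sigma A = (charge_pos sigma A - charge_neg sigma A)%E.
Proof.
move=> mA; rewrite (jordan_decomp (svalP (hahn_sets sigma)) mA) /cadd.
by rewrite /= cscaleN1.
Qed.

Lemma charge_pos_fin sigma A : measurable A -> charge_pos sigma A \is a fin_num.
Proof. exact: fin_num_measure. Qed.

Lemma charge_neg_fin sigma A : measurable A -> charge_neg sigma A \is a fin_num.
Proof. exact: fin_num_measure. Qed.

Lemma fin_num_cross (p n a b : \bar R) : n \is a fin_num -> p \is a fin_num ->
  b \is a fin_num -> a \is a fin_num -> (a - b = p - n -> a + n = p + b)%E.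
Proof.
case: n p b a => // n [] // p [] // b [] // a _ _ _ _.
by rewrite -!EFinB -!EFinD => -[abpn]; congr EFin; lra.
Qed.

Section charge_difference.
Variables (sigma : {charge set T -> \bar R}) (P N : {finite_measure set T -> \bar R}).
Hypothesis sPN : forall A, measurable A -> sigma A = (P A - N A)%E.

(** Minimality of the Jordan decomposition: on the positive Hahn set sigma = P - N is at most P. *)
Lemma charge_pos_le A : measurable A -> (charge_pos sigma A <= P A)%E.
Proof.
move=> mA; rewrite /charge_pos jordan_posE cjordan_posE /crestr0 mem_set//.
case: (hahn_sets sigma) => -[A0 B0] /= h.
have [[mA0 _] _ _ _] := h; rewrite /crestr sPN; last exact: measurableI.
apply: (@le_trans _ _ (P (A `&` A0))).
  by rewrite leeBlDr ?fin_num_measure ?leeDl//; exact: measurableI.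
by rewrite le_measure ?inE//; exact: measurableI.
Qed.

Lemma charge_neg_le A : measurable A -> (charge_neg sigma A <= N A)%E.
Proof.
move=> mA; rewrite /charge_neg jordan_negE cjordan_negE /crestr0 mem_set//.
case: (hahn_sets sigma) => -[A0 B0] /= h.
have [_ [mB0 _] _ _] := h; rewrite /crestr sPN; last exact: measurableI.
rewrite fin_num_oppeB; last by rewrite fin_num_measure//; exact: measurableI.
apply: (@le_trans _ _ (N (A `&` B0))).
  rewrite addeC leeBlDr ?fin_num_measure ?leeDl//; exact: measurableI.
by rewrite le_measure ?inE//; exact: measurableI.
Qed.

(** Stated with sums on both sides, so that it is an equality of measures and can be integrated;
    [charge_integral_diff] then computes charge integrals from any decomposition into finite
    measures. *)
Lemma charge_crossE A : measurable A ->
  measure_add (charge_pos sigma) N A = measure_add P (charge_neg sigma) A.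
Proof.
move=> mA; have := sPN mA; rewrite charge_decomp// !measure_addE.
have := charge_pos_fin sigma mA; have := charge_neg_fin sigma mA.
have : P A \is a fin_num by rewrite fin_num_measure.
have : N A \is a fin_num by rewrite fin_num_measure.
exact: fin_num_cross.
Qed.

Lemma charge_integrable_diff f : P.-integrable setT (EFin \o f) ->
  N.-integrable setT (EFin \o f) ->
  (charge_pos sigma).-integrable setT (EFin \o f) /\
  (charge_neg sigma).-integrable setT (EFin \o f).
Proof.
move=> fP fN; split.
  exact: integrable_le_measure charge_pos_le fP.
exact: integrable_le_measure charge_neg_le fN.
Qed.

Lemma charge_integral_diff f : P.-integrable setT (EFin \o f) ->
  N.-integrable setT (EFin \o f) ->
  charge_integral sigma f = \int[P]_x f x - \int[N]_x f x.
Proof.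
move=> fP fN; have [fp fn] := charge_integrable_diff fP fN.
have := @eq_Rintegral_measure _ _ _ _ _ f charge_crossE.
by rewrite !Rintegral_measure_add// /charge_integral; lra.
Qed.

End charge_difference.

Definition charge_integrable sigma f :=
  (Defs.total_variation sigma).-integrable setT (EFin \o f).

Lemma charge_integrableP sigma f : charge_integrable sigma f <->
  (charge_pos sigma).-integrable setT (EFin \o f) /\
  (charge_neg sigma).-integrable setT (EFin \o f).
Proof.
split=> [fs|[fp fn]].
  split; apply: integrable_le_measure fs => A mA.
    by rewrite /Defs.total_variation /charge_variation leeDl.
  by rewrite /Defs.total_variation /charge_variation leeDr.
apply: eq_integrable_measure (integrable_measure_add fp fn) => A mA.
exact: (esym (measure_addE _ _ _)).
Qed.

Lemma charge_integrable_bounded sigma f g : measurable_fun setT f ->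
  charge_integrable sigma g -> (forall x, `|f x| <= g x) -> charge_integrable sigma f.
Proof. by move=> mf ig fg; apply: integrable_bounded_by ig _. Qed.

Lemma charge_integrable_sum I (s : seq I) sigma (F : I -> T -> R) :
  (forall i, charge_integrable sigma (F i)) ->
  charge_integrable sigma (fun x => \sum_(i <- s) F i x).
Proof. by move=> iF; apply: integrable_real_sum. Qed.

Lemma charge_integral_sum I (s : seq I) sigma (F : I -> T -> R) :
  (forall i, charge_integrable sigma (F i)) ->
  charge_integral sigma (fun x => \sum_(i <- s) F i x) =
  \sum_(i <- s) charge_integral sigma (F i).
Proof.
move=> iF; rewrite /charge_integral !Rintegral_sum ?sumrB// => i.
  by have /charge_integrableP[] := iF i.
by have /charge_integrableP[] := iF i.
Qed.

Lemma charge_integrableZ sigma c f : charge_integrable sigma f ->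
  charge_integrable sigma (fun x => c * f x).
Proof. exact: integrable_realZ. Qed.

Lemma charge_integralZ sigma c f : charge_integrable sigma f ->
  charge_integral sigma (fun x => c * f x) = c * charge_integral sigma f.
Proof.
by move=> /charge_integrableP[fp fn]; rewrite /charge_integral !RintegralZl// mulrBr.
Qed.

Lemma charge_integralD sigma f g : charge_integrable sigma f ->
  charge_integrable sigma g ->
  charge_integral sigma (fun x => f x + g x) =
  charge_integral sigma f + charge_integral sigma g.
Proof.
move=> /charge_integrableP[fp fn] /charge_integrableP[gp gn].
by rewrite /charge_integral !RintegralD//; lra.
Qed.

Lemma charge_dominated_convergence sigma (f_ : nat -> T -> R) f g :
  (forall n, measurable_fun setT (f_ n)) ->
  (forall x, f_ n x @[n --> \oo] --> f x) ->
  charge_integrable sigma g -> (forall n x, `|f_ n x| <= g x) ->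
  charge_integrable sigma f /\
  charge_integral sigma (f_ n) @[n --> \oo] --> charge_integral sigma f.
Proof.
move=> mf_ f_f /charge_integrableP[gp gn] f_g.
have [fp cp] := Rdominated_convergence measurableT mf_ (fun x _ => f_f x) gp
  (fun n x _ => f_g n x).
have [fn cn] := Rdominated_convergence measurableT mf_ (fun x _ => f_f x) gn
  (fun n x _ => f_g n x).
split; first exact/charge_integrableP.
exact: cvgB.
Qed.

End charges.

(** * Gauss decomposition of polynomials *)

Section harmonic_decomposition.
Context {K : numFieldType} {d : nat}.
Implicit Types (p q h : mpoly.mpoly d K) (n j : nat).
Local Notation homog n := (mpoly.ishomog1 n mpoly.mdeg).
Local Notation "''X_[' m ]" := (mpoly.mpolyX K m).
Local Notation "''x_' i" := (mpoly.mpolyX K (mpoly.mnm1 i)) (at level 8, i at level 2).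

(** Over a general field, since harmonicity is used for complex polynomials, where the basis
    property holds, and for the real polynomials Y. *)
Definition lap p := \sum_(i < d) mpoly.mderiv i (mpoly.mderiv i p).
Definition sqnorm : mpoly.mpoly d K := \sum_(i < d) 'x_i ^+ 2.

Lemma lap_linear c p q : lap (c *: p + q) = c *: lap p + lap q.
Proof.
rewrite /lap scaler_sumr -big_split; apply: eq_bigr => i _ /=.
by rewrite !mpoly.mderivD !mpoly.mderivZ.
Qed.

Lemma iter_lap_linear j c p q :
  iter j lap (c *: p + q) = c *: iter j lap p + iter j lap q.
Proof. by elim: j => //= j ->; rewrite lap_linear. Qed.

Lemma lap0 : lap 0 = 0.
Proof. by rewrite /lap big1// => i _; rewrite !mpoly.mderiv0. Qed.

Lemma iter_lap0 j : iter j lap 0 = 0.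
Proof. by elim: j => //= j ->; rewrite lap0. Qed.

Lemma mulX_mderivX i (m : mpoly.multinom d) :
  'x_i * mpoly.mderiv i 'X_[m] = (m i)%:R *: 'X_[m].
Proof.
rewrite mpoly.mderivX -scalerAr -mpoly.mpolyXD.
have [m0|m0] := posnP (m i); first by rewrite m0 !scale0r.
by rewrite mpoly.addmC mpoly.submK// mpoly.lep1mP -lt0n.
Qed.

Lemma euler_identity n p : p \is homog n ->
  \sum_(i < d) 'x_i * mpoly.mderiv i p = n%:R *: p.
Proof.
move=> /mpoly.dhomogP pn; rewrite {1 2}(mpoly.mpolyE p).
under eq_bigr => i _.
  rewrite raddf_sum mulr_sumr.
  under eq_bigr => m _ do rewrite /= mpoly.mderivZ -scalerAr mulX_mderivX.
  over.
rewrite exchange_big /= scaler_sumr; apply: eq_big_seq => m mp.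
rewrite -scaler_sumr -scaler_suml scalerA mulrC -scalerA; congr (_ *: _).
by rewrite -natr_sum -mpoly.mdegE (pn _ mp).
Qed.

Lemma mderiv_homog n i p : p \is homog n -> mpoly.mderiv i p \is homog n.-1.
Proof.
move=> /mpoly.dhomogP pn; rewrite (mpoly.mpolyE p) raddf_sum.
rewrite big_seq; apply: rpred_sum => m mp.
rewrite /= mpoly.mderivZ mpoly.mderivX; apply: rpredZ.
have [m0|m0] := posnP (m i); first by rewrite m0 scale0r rpred0.
apply: rpredZ; rewrite mpoly.dhomogX /=; apply/eqP.
have := mpoly.mdegD (mpoly.mnm_sub m (mpoly.mnm1 i)) (mpoly.mnm1 i).
rewrite mpoly.submK ?mpoly.lep1mP -?lt0n// mpoly.mdeg1 addn1 => E.
by rewrite -(pn _ mp) /= E.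
Qed.

Lemma mderiv_homog0 i p : p \is homog 0 -> mpoly.mderiv i p = 0.
Proof.
move=> /mpoly.dhomogP pn; rewrite (mpoly.mpolyE p) raddf_sum.
rewrite big_seq big1// => m mp.
have /eqP := pn _ mp; rewrite mpoly.mdeg_eq0 => /eqP ->.
by rewrite /= mpoly.mderivZ mpoly.mderivX mpoly.mnm0E scale0r scaler0.
Qed.

Lemma lap_homog n p : p \is homog n -> lap p \is homog (n - 2)%N.
Proof.
move=> pn; apply: rpred_sum => i _.
by rewrite -[(n - 2)%N]/(n - 1.+1)%N subnS subn1; do 2 apply: mderiv_homog.
Qed.

Lemma lap_homog_small n p : p \is homog n -> (n < 2)%N -> lap p = 0.
Proof.
move=> pn n2; rewrite /lap big1// => i _; apply: mderiv_homog0.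
by have := mderiv_homog i pn; move: n n2 {pn} => [|[|]].
Qed.

Lemma iter_lap_homog n j p : p \is homog n -> iter j lap p \is homog (n - j.*2)%N.
Proof.
move=> pn; elim: j => [|j IH]; first by rewrite subn0.
by rewrite doubleS -addn2 subnDA; exact: lap_homog.
Qed.

Lemma iter_lap_small n j p : p \is homog n -> (n < j.*2)%N -> iter j lap p = 0.
Proof.
elim: j n p => // j IH n p pn nj; rewrite iterSr.
have [n2|n2] := ltnP n 2; first by rewrite (lap_homog_small pn n2) iter_lap0.
by apply: IH (lap_homog pn) _; move: nj n2; rewrite doubleS; lia.
Qed.

Lemma sqnorm_homog : sqnorm \is homog 2.
Proof.
apply: rpred_sum => i _; rewrite expr2 -mpoly.mpolyXD mpoly.dhomogX.
by rewrite /= mpoly.mdegD mpoly.mdeg1.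
Qed.

Lemma mderiv_mnm1 (i j : 'I_d) : mpoly.mderiv j 'x_i = (i == j)%:R.
Proof.
rewrite mpoly.mderivX mpoly.mnm1E; case: eqVneq => [->|_]; last by rewrite scale0r.
rewrite scale1r (_ : mpoly.mnm_sub _ _ = mpoly.mnm0); first by rewrite mpoly.mpolyX0.
by apply/mpoly.mnmP => k; rewrite mpoly.mnmBE subnn mpoly.mnm0E.
Qed.

Lemma mderiv_sqnorm (j : 'I_d) : mpoly.mderiv j sqnorm = 2%:R *: 'x_j.
Proof.
rewrite /sqnorm raddf_sum (bigD1 j)//= big1 => [|i ij].
  by rewrite addr0 expr2 mpoly.mderivM mderiv_mnm1 eqxx mul1r mulr1 scaler_nat.
by rewrite expr2 mpoly.mderivM mderiv_mnm1 (negbTE ij) mul0r mulr0 addr0.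
Qed.

(** Product rule; the cross terms 4 x_i d_i p add up to 4 n p by Euler's identity, and the Laplacian
    of |x|^2 is 2 d. *)
Lemma lap_sqnormM n p : p \is homog n ->
  lap (sqnorm * p) = (2 * d + 4 * n)%:R *: p + sqnorm * lap p.
Proof.
move=> pn; rewrite /lap.
have E i : mpoly.mderiv i (mpoly.mderiv i (sqnorm * p)) =
    2%:R *: p + 4%:R *: ('x_i * mpoly.mderiv i p) +
    sqnorm * mpoly.mderiv i (mpoly.mderiv i p).
  rewrite mpoly.mderivM mpoly.mderivD !mpoly.mderivM mderiv_sqnorm mpoly.mderivZ.
  rewrite mderiv_mnm1 eqxx -!scalerAl mul1r (_ : 4%:R = 2%:R + 2%:R) ?scalerDl.
    by rewrite !addrA.
  by rewrite -natrD.
under eq_bigr do rewrite E.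
rewrite !big_split /= -mulr_sumr -[X in _ + X + _]scaler_sumr (euler_identity pn).
rewrite sumr_const card_ord scalerA -natrM -scaler_nat scalerA -natrM.
by rewrite -scalerDl -natrD mulnC.
Qed.

Hypothesis d0 : (0 < d)%N.

(** The constant stays existential: what matters is that it can be divided by. Its positivity rests
    on 2 d > 0. *)
Lemma lap_sqnormX n j h : h \is homog n -> lap h = 0 ->
  exists2 c : nat, (0 < c)%N & lap (sqnorm ^+ j.+1 * h) = c%:R *: (sqnorm ^+ j * h).
Proof.
move=> hn h0; elim: j => [|j [c c0 IH]].
  exists (2 * d + 4 * n)%N; first by rewrite addn_gt0 muln_gt0 d0.
  by rewrite expr1 (lap_sqnormM hn) h0 mulr0 addr0 expr0 mul1r.
exists (2 * d + 4 * (2 * j.+1 + n) + c)%N; first by rewrite addn_gt0 c0 orbT.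
rewrite exprS -mulrA (@lap_sqnormM (2 * j.+1 + n)); last first.
  by apply: mpoly.dhomogM hn; exact: (mpoly.dhomogMn _ sqnorm_homog).
by rewrite IH -scalerAr mulrA -exprS -scalerDl -natrD.
Qed.

Lemma iter_lap_sqnormX n j h : h \is homog n -> lap h = 0 ->
  exists2 c : nat, (0 < c)%N & iter j lap (sqnorm ^+ j * h) = c%:R *: h.
Proof.
move=> hn h0; elim: j => [|j [c c0 IH]]; first by exists 1%N; rewrite // mul1r scale1r.
have [b b0 bE] := lap_sqnormX j hn h0.
exists (b * c)%N; first by rewrite muln_gt0 b0.
rewrite iterSr bE -[X in iter _ _ X]addr0 iter_lap_linear IH iter_lap0 addr0.
by rewrite scalerA natrM.
Qed.

(* With [lap^j.+1 p = 0], the polynomial [h = lap^j p] is harmonic and a multiple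
   of [|x|^(2j) h] has the same image under [lap^j] as [p]. *)
Lemma harmonic_ind (P : mpoly.mpoly d K -> Prop) :
  (forall c p q, P p -> P q -> P (c *: p + q)) ->
  (forall j n h, h \is homog n -> lap h = 0 -> P (sqnorm ^+ j * h)) ->
  forall p, P p.
Proof.
move=> PD Ph; have P0 : P 0.
  by have := Ph 0%N 0%N 0; rewrite mulr0; apply; [exact: rpred0|exact: lap0].
have Pj j n p : p \is homog n -> iter j lap p = 0 -> P p.
  elim: j p => [p _ /= ->//|j IH p pn p0].
  have [nj|nj] := ltnP n j.*2; first by apply: IH => //; exact: iter_lap_small pn nj.
  pose h := iter j lap p.
  have hn : h \is homog (n - j.*2)%N by exact: iter_lap_homog.
  have [c c0 cE] := iter_lap_sqnormX j hn p0.
  have cn0 : c%:R != 0 :> K by rewrite pnatr_eq0 -lt0n.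
  rewrite -[p](subrK (c%:R^-1 *: (sqnorm ^+ j * h))) addrC.
  apply: PD; first exact: Ph hn p0.
  apply: IH.
    apply: rpredB => //; apply: rpredZ; rewrite -(subnK nj) addnC -mul2n.
    by apply: mpoly.dhomogM; [exact: (mpoly.dhomogMn _ sqnorm_homog)|rewrite mul2n].
  rewrite addrC -scaleNr iter_lap_linear cE scaleNr scalerA mulVf// scale1r addNr//.
move=> p; rewrite (mpoly.mpolyE p).
elim: (mpoly.msupp p : seq _) => [|m s IH]; first by rewrite big_nil.
rewrite big_cons; apply: PD => //.
apply: (Pj (mpoly.mdeg m).+1 (mpoly.mdeg m)); first by rewrite mpoly.dhomogX.
by apply: (@iter_lap_small (mpoly.mdeg m)); rewrite ?mpoly.dhomogX//; lia.
Qed.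

End harmonic_decomposition.

(** * Real and complex polynomials as functions *)

Section polynomial_functions.
Context {R : realType} {d : nat}.
Local Notation C := (complex.complex R).
Local Notation rc := (complex.real_complex_def (Phant R)).
Implicit Types (p q : mpoly.mpoly d R) (x : d.-tuple R).
Local Notation homog n := (mpoly.ishomog1 n mpoly.mdeg).

Lemma measurable_peval p : measurable_fun setT (peval p).
Proof.
rewrite (_ : peval p = fun x => \sum_(m <- mpoly.msupp p)
    mpoly.mcoeff m p * \prod_i tnth x i ^+ m i); last first.
  by apply/funext => x; exact: mpoly.mevalE.
apply: measurable_sum => m; apply: measurable_funM => //.
apply: measurable_prod => i _; apply: measurable_funX; exact: measurable_tnth.
Qed.

Lemma peval_linear c p q x : peval (c *: p + q) x = c * peval p x + peval q x.
Proof. by rewrite /peval mpoly.mevalD mpoly.mevalZ. Qed.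

Lemma pevalM p q x : peval (p * q) x = peval p x * peval q x.
Proof. exact: mpoly.mevalM. Qed.

Lemma pevalXU i x : peval (mpoly.mpolyX R (mpoly.mnm1 i)) x = tnth x i.
Proof. exact: mpoly.mevalXU. Qed.

Lemma peval_sum I (s : seq I) (F : I -> mpoly.mpoly d R) x :
  peval (\sum_(i <- s) F i) x = \sum_(i <- s) peval (F i) x.
Proof. by rewrite /peval raddf_sum. Qed.

Lemma pevalX p n x : peval (p ^+ n) x = peval p x ^+ n.
Proof. by rewrite /peval rmorphXn. Qed.

Lemma enorm_ge0 x : 0 <= enorm x.
Proof. exact: sqrtr_ge0. Qed.

Lemma sqr_enorm x : enorm x ^+ 2 = \sum_(i < d) tnth x i ^+ 2.
Proof. by rewrite sqr_sqrtr// sumr_ge0// => i _; exact: sqr_ge0. Qed.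

Lemma peval_sqnorm x : peval sqnorm x = enorm x ^+ 2.
Proof.
rewrite sqr_enorm /sqnorm peval_sum; apply: eq_bigr => i _.
by rewrite pevalX pevalXU.
Qed.

Lemma homog_scale n p x y (c : R) : p \is homog n ->
  (forall i, tnth y i = c * tnth x i) -> peval p y = c ^+ n * peval p x.
Proof.
move=> /mpoly.dhomogP pn yx; rewrite /peval !mpoly.mevalE mulr_sumr.
apply: eq_big_seq => m mp; rewrite mulrCA; congr (_ * _).
under eq_bigr do rewrite yx exprMn.
by rewrite big_split /= -(pn _ mp) /= mpoly.mdegE expr_sum.
Qed.

Lemma tnth_le_enorm x i : `|tnth x i| <= enorm x.
Proof.
rewrite -(ler_pXn2r (n:=2))// ?nnegrE ?enorm_ge0// real_normK ?num_real//.
by rewrite sqr_enorm (bigD1 i)//= lerDl sumr_ge0// => j _; exact: sqr_ge0.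
Qed.

Lemma peval_add1_sqnorm x : peval (1 + sqnorm) x = 1 + enorm x ^+ 2.
Proof. by rewrite -peval_sqnorm /peval mpoly.mevalD mpoly.meval1. Qed.

Lemma enorm0 x i : enorm x = 0 -> tnth x i = 0.
Proof.
by move=> x0; apply/normr0_eq0/eqP; rewrite -normr_le0 normr_id -x0 tnth_le_enorm.
Qed.

Lemma peval_direction n p x : p \is homog n ->
  enorm x != 0 \/ (0 < n)%N -> peval p x = enorm x ^+ n * peval p (direction x).
Proof.
move=> pn xn; apply: homog_scale pn _ => i; rewrite tnth_mktuple.
have [x0|x0] := eqVneq (enorm x) 0; last by rewrite mulrC divfK.
by rewrite (enorm0 i x0) !mul0r mulr0.
Qed.

Lemma cpeval_complexify p x : cpeval (complexify p) x = rc (peval p x).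
Proof.
rewrite /cpeval /complexify -[mpoly.map_mpoly _]/(mpoly.map_mpoly rc).
have -> : mpoly.map_mpoly rc p = \sum_(m <- mpoly.msupp p)
    mpoly.map_mpoly rc (mpoly.mcoeff m p *: mpoly.mpolyX R m).
  by rewrite {1}(mpoly.mpolyE p) raddf_sum.
have cevalS I (s : seq I) (F : I -> mpoly.mpoly d C) v :
    mpoly.meval v (\sum_(i <- s) F i) = \sum_(i <- s) mpoly.meval v (F i).
  exact: raddf_sum.
rewrite cevalS /peval mpoly.mevalE raddf_sum; apply: eq_bigr => m _ /=.
rewrite mpoly.map_mpolyZ mpoly.map_mpolyX mpoly.mevalZ mpoly.mevalX rmorphM /=; congr (_ * _).
by rewrite rmorph_prod; apply: eq_bigr => i _; rewrite rmorphXn.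
Qed.

Definition re_poly (f : C -> R) (p : mpoly.mpoly d C) : mpoly.mpoly d R :=
  \sum_(m <- mpoly.msupp p) f (mpoly.mcoeff m p) *: mpoly.mpolyX R m.

Lemma cpeval_parts (p : mpoly.mpoly d C) x :
  complex.Re (cpeval p x) = peval (re_poly (@complex.Re R) p) x /\
  complex.Im (cpeval p x) = peval (re_poly (@complex.Im R) p) x.
Proof.
rewrite /cpeval mpoly.mevalE /re_poly !peval_sum.
have E m : \prod_i complex.Complex (tnth x i) 0 ^+ m i =
    rc (\prod_(i < d) tnth x i ^+ m i) :> C.
  by rewrite rmorph_prod; apply: eq_bigr => i _; rewrite rmorphXn.
elim: (mpoly.msupp p : seq _) => [|m s [IH1 IH2]]; first by rewrite !big_nil.
rewrite !big_cons E /peval !mpoly.mevalZ !mpoly.mevalX.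
case: (mpoly.mcoeff m p) => u v.
move: IH1 IH2; case: (\sum_(i <- s) _ * _) => u' v' /= <- <-.
by rewrite !mulr0 subr0 add0r.
Qed.

Lemma moment_measureP (sigma : {charge set (d.-tuple R) -> \bar R}) :
  moment_measure sigma <-> forall p, charge_integrable sigma (peval p).
Proof.
split=> [H p|H p]; last first.
  split; [have := H (re_poly (@complex.Re R) p)|have := H (re_poly (@complex.Im R) p)];
    congr (integrable _ _ _); apply/funext => x /=; have [E1 E2] := cpeval_parts p x;
    by rewrite ?E1 ?E2.
have [+ _] := H (complexify p); congr (integrable _ _ _); apply/funext => x.
by rewrite cpeval_complexify.
Qed.

Lemma cintegral_peval (sigma mu : {charge set (d.-tuple R) -> \bar R}) :
  (forall p : mpoly.mpoly d C,
    charge_cintegral sigma (cpeval p) = charge_cintegral mu (cpeval p)) <->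
  forall p, charge_integral sigma (peval p) = charge_integral mu (peval p).
Proof.
split=> [H p|H p].
  have [+ _] := H (complexify p).
  rewrite (_ : (fun x => _) = peval p)//.
  by apply/funext => x; rewrite cpeval_complexify.
rewrite /charge_cintegral; congr complex.Complex.
  rewrite (_ : (fun x => _) = peval (re_poly (@complex.Re R) p))//.
  by apply/funext => x; have [-> _] := cpeval_parts p x.
rewrite (_ : (fun x => _) = peval (re_poly (@complex.Im R) p))//.
by apply/funext => x; have [_ ->] := cpeval_parts p x.
Qed.

Lemma mcoeff_complexify p m :
  mpoly.mcoeff m (complexify p) = rc (mpoly.mcoeff m p).
Proof. exact: (@mpoly.mcoeff_map_mpoly d _ _ rc). Qed.

Lemma complexify_homog n p : complexify p \is homog n -> p \is homog n.
Proof.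
move=> pn; apply/mpoly.dhomogP => m; rewrite mpoly.mcoeff_msupp => pm.
apply/eqP; apply: contraNT pm => mn.
have := mpoly.dhomog_nemf_coeff pn mn; rewrite mcoeff_complexify => /complex.complexI.
by move=> ->.
Qed.

Lemma complexify_lap p : laplacian (complexify p) = 0 -> lap p = 0.
Proof.
move=> p0; apply/mpoly.mpolyP => m; rewrite mpoly.mcoeff0.
apply: complex.complexI; have <- : mpoly.mcoeff m (laplacian (complexify p)) = rc 0.
  by rewrite p0 mpoly.mcoeff0.
rewrite /laplacian /lap !raddf_sum /=.
apply: eq_bigr => i _.
by rewrite !mpoly.mcoeff_mderiv mcoeff_complexify !raddfMn.
Qed.

End polynomial_functions.

Section spherical_harmonic_expansion.
Context {R : realType} {d : nat}.
Hypothesis d0 : (0 < d)%N.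
Variables (a : nat -> nat) (Y : forall k : nat, 'I_(a k) -> mpoly.mpoly d R).
Arguments Y : clear implicits.
Hypothesis hY : forall k : nat, orthonormal_harmonic_basis k (Y k).
Local Notation C := (complex.complex R).
Local Notation rc := (complex.real_complex_def (Phant R)).
Local Notation homog n := (mpoly.ishomog1 n mpoly.mdeg).

Lemma Y_homog k l : Y k l \is homog k.
Proof. by have [/(_ l)[+ _] _ _] := hY k; exact: complexify_homog. Qed.

Lemma Y_harmonic k l : lap (Y k l) = 0.
Proof. by have [/(_ l)[_ +] _ _] := hY k; exact: complexify_lap. Qed.

(** The basis property speaks of complex polynomials, so the expansion is found for [complexify p];
    as the functions |x|^(2i) Y are real-valued, one may take real parts of the coefficients. *)
Lemma harmonic_expansion (p : mpoly.mpoly d R) :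
  exists s : seq (R * nat * {k : nat & 'I_(a k)}), forall x,
    peval p x = \sum_(e <- s)
      e.1.1 * (enorm x ^+ (2 * e.1.2) * peval (Y (tag e.2) (tagged e.2)) x).
Proof.
pose P (q : mpoly.mpoly d C) := exists s : seq (C * nat * {k : nat & 'I_(a k)}),
  forall x, cpeval q x = \sum_(e <- s)
    e.1.1 * rc (enorm x ^+ (2 * e.1.2) * peval (Y (tag e.2) (tagged e.2)) x).
have [s sE] : P (complexify p).
  apply: (harmonic_ind d0) => [c q r [s sE] [t tE]|j n h hn h0].
    exists ([seq (c * e.1.1, e.1.2, e.2) | e <- s] ++ t) => x.
    rewrite big_cat big_map /= /cpeval mpoly.mevalD mpoly.mevalZ.
    rewrite -[mpoly.meval _ q]/(cpeval q x) -[mpoly.meval _ r]/(cpeval r x) sE tE.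
    by rewrite mulr_sumr; congr (_ + _); apply: eq_bigr => e _; rewrite mulrA.
  have [_ /(_ h)[//|c [cE _]] _] := hY n.
  exists [seq (c l, j, existT (fun k => 'I_(a k)) n l) | l <- enum 'I_(a n)] => x.
  rewrite big_map big_enum /= {1}cE /cpeval mpoly.mevalM rmorphXn /=.
  have -> : mpoly.meval (fun i => complex.Complex (tnth x i) 0) sqnorm =
      rc (enorm x ^+ 2).
    rewrite sqr_enorm /sqnorm raddf_sum /= raddf_sum /=; apply: eq_bigr => i _.
    by rewrite rmorphXn /= mpoly.mevalXU rmorphXn.
  rewrite raddf_sum /= mulr_sumr; apply: eq_bigr => l _.
  rewrite mpoly.mevalZ -[mpoly.meval _ _]/(cpeval (complexify (Y n l)) x).
  by rewrite cpeval_complexify mulrCA -rmorphXn -exprM -rmorphM.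
exists [seq (complex.Re e.1.1, e.1.2, e.2) | e <- s] => x.
have := congr1 (@complex.Re R) (sE x); rewrite cpeval_complexify /= => ->.
rewrite big_map /=; elim: s {sE} => [|e s IH]; first by rewrite !big_nil.
rewrite !big_cons -IH; case: e => -[[u v] j] e /=.
by case: (\sum_(i <- s) _) => u' v' /=; rewrite mulr0 subr0.
Qed.

End spherical_harmonic_expansion.

(** * Radial components of charges *)

Section density.
Context {dT : measure_display} {T : measurableType dT} {R : realType}.
Variables (mu : {measure set T -> \bar R}) (f : T -> R).
Hypotheses (mf : measurable_fun setT f) (f0 : forall x, 0 <= f x).

Lemma density_exists : exists m : {measure set T -> \bar R},
  forall A, m A = (\int[mu]_(x in A) (f x)%:E)%E.
Proof.
pose m A : \bar R := (\int[mu]_(x in A) (f x)%:E)%E.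
have m0 : m set0 = 0%E by rewrite /m integral_set0.
have m_ge0 A : (0 <= m A)%E by apply: integral_ge0 => x _; rewrite lee_fin.
have ms : semi_sigma_additive m.
  apply: semi_sigma_additive_nng_induced; first exact/measurable_EFinP.
  by move=> x; rewrite lee_fin.
by exists (HB.pack m (isMeasure.Build _ _ _ m m0 m_ge0 ms) : {measure set T -> \bar R}).
Qed.

Variable m : {measure set T -> \bar R}.
Hypothesis mE : forall A, m A = (\int[mu]_(x in A) (f x)%:E)%E.

Import HBNNSimple.

Lemma ge0_integral_density (g : T -> \bar R) : (forall x, 0 <= g x)%E ->
  measurable_fun setT g -> (\int[m]_x g x = \int[mu]_x (g x * (f x)%:E))%E.
Proof.
move=> g0 mg; pose h := nnsfun_approx measurableT mg.
have mfE : measurable_fun setT (EFin \o f) by exact/measurable_EFinP.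
have hg x : (EFin \o h n) x @[n --> \oo] --> g x by exact: cvg_nnsfun_approx.
have -> : (\int[m]_x g x = lim (\int[m]_x (EFin \o h n) x @[n --> \oo]))%E.
  under eq_integral => x _ do rewrite -(cvg_lim _ (hg x))//.
  apply: monotone_convergence => //.
  - by move=> n; exact/measurable_EFinP.
  - by move=> n x _; rewrite lee_fin.
  - by move=> x _ a b ab; rewrite lee_fin; exact/lefP/nd_nnsfun_approx.
have -> : (\int[mu]_x (g x * (f x)%:E) =
    lim (\int[mu]_x ((EFin \o h n) x * (f x)%:E) @[n --> \oo]))%E.
  have gf x : ((EFin \o h n) x * (f x)%:E)%E @[n --> \oo] --> (g x * (f x)%:E)%E.
    by apply: cvgeZr.
  under eq_integral => x _ do rewrite -(cvg_lim _ (gf x))//.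
  apply: monotone_convergence => //.
  - by move=> n; apply: emeasurable_funM => //; exact/measurable_EFinP.
  - by move=> n x _ /=; rewrite mule_ge0 ?lee_fin.
  - move=> x _ a b ab /=; rewrite lee_wpmul2r ?lee_fin//.
    exact/lefP/nd_nnsfun_approx.
suff suf n : (\int[m]_x (EFin \o h n) x = \int[mu]_x ((EFin \o h n) x * (f x)%:E))%E.
  by under eq_fun do rewrite suf.
transitivity (\int[m]_x
    (\sum_(y \in range (h n)) (y * \1_(h n @^-1` [set y]) x)%:E))%E.
  by apply: eq_integral => t _; rewrite /= fimfunE -fsumEFin.
have indich r : measurable_fun setT (fun x => (r * \1_(h n @^-1` [set r]) x)%:E).
  by apply/measurable_EFinP; exact: measurable_funM.
rewrite ge0_integral_fsum//; last by move=> y x _; exact: nnfun_muleindic_ge0.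
transitivity (\int[mu]_x (\sum_(y \in range (h n))
    (y * \1_(h n @^-1` [set y]) x)%:E * (f x)%:E))%E; last first.
  apply: eq_integral => x _; rewrite -ge0_mule_fsuml => [|y]; last first.
    exact: nnfun_muleindic_ge0.
  by rewrite fsumEFin // -(fimfunE _ x).
rewrite ge0_integral_fsum//; last 2 first.
  - by move=> y; apply: emeasurable_funM.
  - by move=> y x _; apply: mule_ge0; [rewrite EFinM; exact: nnfun_muleindic_ge0|rewrite lee_fin].
apply: eq_fsbigr => r rhn.
have r0 : 0 <= r by move: rhn; rewrite inE => -[t _ <-].
under eq_integral do rewrite EFinM.
rewrite integralZl_indic_nnsfun => //.
under [RHS]eq_integral do rewrite EFinM -muleA.
rewrite ge0_integralZl//.
- under [in RHS]eq_integral do rewrite muleC.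
  rewrite [in RHS](eq_integral ((EFin \o f) \_ (h n @^-1` [set r]))); last first.
    by move=> x xE; rewrite epatch_indic.
  by rewrite -integral_mkcondr setTI integral_indic// setIT mE.
- by apply: emeasurable_funM => //; exact/measurable_EFinP.
- by move=> t _; rewrite mule_ge0 ?lee_fin.
Qed.

Lemma integrable_density (g : T -> R) : measurable_fun setT g ->
  mu.-integrable setT (EFin \o (fun x => g x * f x)) ->
  m.-integrable setT (EFin \o g).
Proof.
move=> mg /integrableP[_ igf]; apply/integrableP; split; first exact/measurable_EFinP.
rewrite ge0_integral_density//; last by apply/measurable_EFinP; exact: measurableT_comp.
apply: le_lt_trans igf; rewrite le_eqVlt; apply/orP; left; apply/eqP.
by apply: eq_integral => x _ /=; rewrite normrM [`|f x|]ger0_norm.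
Qed.

Lemma Rintegral_density (g : T -> R) : measurable_fun setT g ->
  mu.-integrable setT (EFin \o (fun x => g x * f x)) ->
  \int[m]_x g x = \int[mu]_x (g x * f x).
Proof.
move=> mg igf; rewrite /Rintegral integralE [in RHS]integralE; congr fine.
rewrite !ge0_integral_density//.
- congr (_ - _)%E; apply: eq_integral => x _ /=.
    by rewrite !funeposE -!EFin_max -EFinM maxr_pMl// mul0r.
  by rewrite !funenegE -!EFinN -!EFin_max -EFinM maxr_pMl// mul0r mulNr.
- by apply: measurable_funeneg; exact/measurable_EFinP.
- by apply: measurable_funepos; exact/measurable_EFinP.
Qed.

End density.

Lemma max_oppr (R : realType) (z : R) :
  [/\ z = Num.max z 0 - Num.max (- z) 0, 0 <= Num.max z 0 <= `|z| &
      0 <= Num.max (- z) 0 <= `|z|].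
Proof.
split; last 2 first.
- by rewrite le_max lexx orbT ge_max normr_ge0 ler_norm.
- by rewrite le_max lexx orbT ge_max normr_ge0 andbT -normrN ler_norm.
by case: (leP z 0) => h1; case: (leP (- z) 0) => h2; lra.
Qed.

Section weighted_image.
Context {dT dS : measure_display} {T : measurableType dT} {S : measurableType dS}
  {R : realType}.
Variables (phi : T -> S).
Hypothesis mphi : measurable_fun setT phi.

Lemma image_density (mu : {measure set T -> \bar R}) (f : T -> R) :
  measurable_fun setT f -> (forall x, 0 <= f x) ->
  exists m : {measure set S -> \bar R},
  [/\ forall A, measurable A ->
        m A = (\int[mu]_(x in phi @^-1` A) (f x)%:E)%E,
      forall g : S -> R, measurable_fun setT g ->
        mu.-integrable setT (EFin \o (fun x => g (phi x) * f x)) ->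
        m.-integrable setT (EFin \o g) &
      forall g : S -> R, measurable_fun setT g ->
        mu.-integrable setT (EFin \o (fun x => g (phi x) * f x)) ->
        \int[m]_y g y = \int[mu]_x (g (phi x) * f x)].
Proof.
move=> mf f0; have [n nE] := density_exists mu mf f0.
pose m' := pushforward n phi : {measure set S -> \bar R}.
pose m := m' mphi.
exists m; split=> [A mA|g mg ig|g mg ig]; first exact: nE.
  apply: integrable_pushforward => //; first exact/measurable_EFinP.
  by rewrite preimage_setT; exact: (integrable_density mf f0 nE (measurableT_comp mg mphi)).
rewrite /Rintegral integral_pushforward//=; last 2 first.
- exact/measurable_EFinP.
- by rewrite preimage_setT; exact: (integrable_density mf f0 nE (measurableT_comp mg mphi)).
rewrite preimage_setT.
exact: (Rintegral_density mf f0 nE (measurableT_comp mg mphi)).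
Qed.

(** The image of y sigma under phi as a difference of positive measures: P collects the products of
    parts of y and sigma with like signs, N those with unlike signs. *)
Lemma weighted_image (sigma : {charge set T -> \bar R}) (y : T -> R) :
  measurable_fun setT y -> charge_integrable sigma y ->
  exists P N : {measure set S -> \bar R},
  [/\ (P setT < +oo)%E, (N setT < +oo)%E,
    forall A, measurable A -> phi @^-1` A = set0 -> P A = 0%E &
    forall g : S -> R, measurable_fun setT g ->
      charge_integrable sigma (fun x => g (phi x) * y x) ->
      [/\ P.-integrable setT (EFin \o g), N.-integrable setT (EFin \o g) &
      \int[P]_t g t - \int[N]_t g t = charge_integral sigma (fun x => g (phi x) * y x)]].
Proof.
move=> my iy.
pose yp x := Num.max (y x) 0; pose yn x := Num.max (- y x) 0.
have myp : measurable_fun setT yp by exact: measurable_maxr.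
have myn : measurable_fun setT yn by apply: measurable_maxr => //; exact: measurableT_comp.
have yp0 x : 0 <= yp x by have [_ /andP[]] := max_oppr (y x).
have yn0 x : 0 <= yn x by have [_ _ /andP[]] := max_oppr (y x).
have yE x : y x = yp x - yn x by have [] := max_oppr (y x).
have ypy x : `|yp x| <= `|y x| by rewrite ger0_norm//; have [_ /andP[]] := max_oppr (y x).
have yny x : `|yn x| <= `|y x| by rewrite ger0_norm//; have [_ _ /andP[]] := max_oppr (y x).
have [Pp [PpE Ppi PpI]] := image_density (charge_pos sigma) myp yp0.
have [Pn [PnE Pni PnI]] := image_density (charge_neg sigma) myn yn0.
have [Np [NpE Npi NpI]] := image_density (charge_pos sigma) myn yn0.
have [Nn [NnE Nni NnI]] := image_density (charge_neg sigma) myp yp0.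
have sub (mu : {measure set T -> \bar R}) (g : S -> R) (w : T -> R) :
    measurable_fun setT w -> (forall x, `|w x| <= `|y x|) ->
    measurable_fun setT g -> mu.-integrable setT (EFin \o (fun x => g (phi x) * y x)) ->
    mu.-integrable setT (EFin \o (fun x => g (phi x) * w x)).
  move=> mw wy mg ig; apply: le_integrable ig => //.
    by apply/measurable_EFinP; apply: measurable_funM => //; exact: measurableT_comp.
  by move=> x _ /=; rewrite lee_fin !normrM ler_wpM2l.
have main (g : S -> R) : measurable_fun setT g ->
      charge_integrable sigma (fun x => g (phi x) * y x) ->
      [/\ (measure_add Pp Pn).-integrable setT (EFin \o g),
          (measure_add Np Nn).-integrable setT (EFin \o g) &
      \int[measure_add Pp Pn]_t g t - \int[measure_add Np Nn]_t g t =
      charge_integral sigma (fun x => g (phi x) * y x)].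
  move=> mg /charge_integrableP[gp gn].
  have ipp := sub _ _ _ myp ypy mg gp; have inp := sub _ _ _ myp ypy mg gn.
  have ipn := sub _ _ _ myn yny mg gp; have inn := sub _ _ _ myn yny mg gn.
  have j1 := Ppi _ mg ipp; have j2 := Pni _ mg inn.
  have j3 := Npi _ mg ipn; have j4 := Nni _ mg inp.
  split; [exact: integrable_measure_add|exact: integrable_measure_add|].
  rewrite !Rintegral_measure_add// PpI// PnI// NpI// NnI// /charge_integral.
  have E x : g (phi x) * y x = g (phi x) * yp x - g (phi x) * yn x.
    by rewrite -mulrBr -yE.
  under [in RHS]eq_Rintegral do rewrite E.
  under [X in _ = _ - X]eq_Rintegral do rewrite E.
  by rewrite !RintegralB//; ring.
have fin1 (m : {measure set S -> \bar R}) : m.-integrable setT (EFin \o (fun=> 1 : R)) ->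
    (m setT < +oo)%E.
  move=> /integrableP[_]; under eq_integral do rewrite /= normr1.
  by rewrite integral_cst// mul1e.
have [|i1 i2 _] := main (fun=> 1) (measurable_cst _).
  by rewrite (_ : (fun x => _) = y)//; apply/funext => x; rewrite mul1r.
exists (measure_add Pp Pn), (measure_add Np Nn); split=> //; [exact: fin1|exact: fin1|].
move=> A mA A0; apply: etrans (measure_addE _ _ _) _.
by rewrite PpE// PnE// A0 !integral_set0 adde0.
Qed.

End weighted_image.

Section clamp.
Context {R : realType}.
Implicit Types u : R.

Definition clamp u := Num.min (Num.max u 0) 1.

Lemma clamp_ge0 u : 0 <= clamp u.
Proof. by rewrite le_min ler01 le_max lexx orbT. Qed.

Lemma clamp_le1 u : clamp u <= 1.
Proof. by rewrite ge_min lexx orbT. Qed.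

Lemma clamp_norm u : `|clamp u| <= 1.
Proof. by rewrite ger0_norm ?clamp_ge0// clamp_le1. Qed.

Lemma clamp0 u : u <= 0 -> clamp u = 0.
Proof. by move=> u0; rewrite /clamp max_r// min_l// ler01. Qed.

Lemma clamp1 u : 1 <= u -> clamp u = 1.
Proof. by move=> u1; rewrite /clamp min_r// le_max u1. Qed.

Lemma clamp_homo : {homo clamp : u v / u <= v}.
Proof.
move=> u v uv; rewrite /clamp; apply: le_min2 => //; apply: le_max2 => //.
Qed.

Lemma continuous_clamp : continuous clamp.
Proof.
move=> u; apply: (@continuous_min _ _ (fun u => Num.max u 0) (fun=> 1)).
  by apply: (@continuous_max _ _ id (fun=> 0)); [exact: cvg_id|exact: cvg_cst].
exact: cvg_cst.
Qed.

Lemma cvg_clamp u : clamp (n.+1%:R * u) @[n --> \oo] --> ((0 < u)%R%:R : R).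
Proof.
have [u0|u0] := ltP 0 u; last first.
  under eq_fun do rewrite clamp0 ?pmulr_rle0//.
  exact: cvg_cst.
apply: cvg_near_cst; exists (Num.trunc u^-1).+1 => // n /= un; apply: clamp1.
rewrite -ler_pdivrMr// div1r ltW// (lt_le_trans (truncnS_gt _))// ler_nat.
exact: leqW.
Qed.

End clamp.

(** * Construction of component measures *)

Section component_measure.
Context {dT : measure_display} {T : measurableType dT} {R : realType}.
Variables (sigma : {charge set T -> \bar R}) (phi y : T -> R).
Hypotheses (mphi : measurable_fun setT phi) (phi0 : forall x, 0 <= phi x).
Hypothesis my : measurable_fun setT y.
Hypothesis iy : forall n, charge_integrable sigma (fun x => phi x ^+ n * y x).
Hypothesis pos : forall h : R -> R, continuous h -> (forall t, 0 <= h t) ->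
  (exists M, forall t, M <= t -> h t = 0) ->
  0 <= charge_integral sigma (fun x => h (phi x) * y x).

Let iy0 : charge_integrable sigma y.
Proof.
by have := iy 0%N; congr (integrable _ _ _); apply/funext => x /=; rewrite mul1r.
Qed.

Let iyn : charge_integrable sigma (fun x => `|y x|).
Proof. exact: integrable_norm iy0. Qed.

Let mgy (g : R -> R) : measurable_fun setT g -> measurable_fun setT (fun x => g (phi x) * y x).
Proof. by move=> mg; apply: measurable_funM => //; exact: measurableT_comp. Qed.

Let bd (c z : R) : `|c| <= 1 -> `|c * z| <= `|z|.
Proof. by move=> c1; rewrite normrM ler_piMl. Qed.

Let bdb (b : bool) (z : R) : `|b%:R * z| <= `|z|.
Proof. by apply: bd; case: b; rewrite ?normr1 ?normr0. Qed.

Let tail t := charge_integral sigma (fun x => (t < phi x)%R%:R * y x).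

Let mltr (t : R) : measurable_fun setT (fun s : R => (t < s)%R%:R : R).
Proof.
rewrite (_ : (fun _ => _) = \1_(`]t, +oo[%classic)); first exact: measurable_indic.
apply/funext => s; rewrite indicE; congr (_%:R); congr (nat_of_bool _).
by apply/idP/idP; rewrite inE /= in_itv/= andbT.
Qed.

Let tail_antitone a b : a <= b -> tail b <= tail a.
Proof.
move=> ab; rewrite -subr_ge0.
(* A nonnegative trapezoid that vanishes from b + 1 on, hence an allowed test function; as n grows
   it tends to the indicator of ]a, b]. *)
pose h n t : R := clamp (n.+1%:R * (t - a)) - clamp (n.+1%:R * (t - b)).
have h_ge0 n t : 0 <= h n t.
  by rewrite subr_ge0; apply: clamp_homo; rewrite ler_wpM2l// lerB.
have ch n : continuous (h n).
  have cc v : continuous (fun t : R => clamp (n.+1%:R * (t - v))).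
    move=> t; apply: (@cvg_comp _ _ _ (fun t => n.+1%:R * (t - v)) clamp);
      last exact: continuous_clamp.
    by apply: cvgM; [exact: cvg_cst|apply: cvgB; [exact: cvg_id|exact: cvg_cst]].
  by move=> t; apply: cvgB; exact: cc.
have it u : charge_integrable sigma (fun x => (u < phi x)%R%:R * y x).
  by apply: charge_integrable_bounded iyn _ => [|x]; [exact: mgy (mltr u)|exact: bdb].
have [||//||ih c] := @charge_dominated_convergence _ _ _ sigma
    (fun n x => h n (phi x) * y x)
    (fun x => ((a < phi x)%R%:R - (b < phi x)%R%:R) * y x) (fun x => `|y x|).
- by move=> n; apply: mgy; exact: continuous_measurable_fun.
- move=> x; apply: cvgM; last exact: cvg_cst.
  rewrite -(subr_gt0 a) -(subr_gt0 b).
  by apply: cvgB; exact: cvg_clamp.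
- move=> n x; apply: bd; rewrite ger0_norm// lerBlDr.
  by rewrite (le_trans (clamp_le1 _))// lerDl clamp_ge0.
have <- : charge_integral sigma (fun x => ((a < phi x)%R%:R - (b < phi x)%R%:R) * y x) =
    tail a - tail b.
  rewrite /tail -[X in _ = _ + X]mulN1r -charge_integralZ// -charge_integralD//.
    by congr charge_integral; apply/funext => x; rewrite mulrBl mulN1r.
  exact: charge_integrableZ.
have -> : charge_integral sigma (fun x => ((a < phi x)%R%:R - (b < phi x)%R%:R) * y x) =
    lim (charge_integral sigma (fun x => h n (phi x) * y x) @[n --> \oo]).
  by apply/esym/cvg_lim.
apply: limr_ge; first exact: cvgP c.
apply: nearW => n; apply: pos => //; exists (b + 1) => t bt.
rewrite /h !clamp1 ?subrr//; have n1 : 1 <= n.+1%:R :> R by rewrite ler1n.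
  by rewrite (le_trans n1)// ler_peMr//; lra.
by rewrite (le_trans n1)// ler_peMr//; lra.
Qed.

Let tail_cvg (u : nat -> R) (f : R -> R) :
  (forall x, 0 <= x -> (u n < x)%R%:R @[n --> \oo] --> f x) ->
  tail (u n) @[n --> \oo] --> charge_integral sigma (fun x => f (phi x) * y x).
Proof.
move=> uf.
have [||||_ //] := @charge_dominated_convergence _ _ _ sigma
    (fun n x => (u n < phi x)%R%:R * y x) (fun x => f (phi x) * y x) (fun x => `|y x|).
- by move=> n; exact: mgy (mltr _).
- by move=> x; apply: cvgM; [exact: uf|exact: cvg_cst].
- exact: iyn.
- by move=> n x; exact: bdb.
Qed.

Let tail_rc : right_continuous (fun t => - tail t).
Proof.
move=> t; apply: cvgN; apply/cvg_at_rightP => u [ut uc].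
apply: (tail_cvg (f := fun s => (t < s)%R%:R)) => s _.
have [ts|st] := ltP t s.
  apply: cvg_near_cst; have /cvgrPdist_lt := uc => /(_ (s - t)).
  rewrite subr_gt0 => /(_ ts); apply: filterS => n; rewrite distrC.
  have := ler_norm (u n - t); case: (ltP (u n) s) => // su; lra.
apply: cvg_near_cst; apply: nearW => n.
by rewrite ltNge (le_trans st (ltW (ut n))).
Qed.

Let tail_cvg0 : - tail n%:R @[n --> \oo] --> (0 : R).
Proof.
rewrite -oppr0; apply: cvgN.
have <- : charge_integral sigma (fun x => 0 * y x) = 0.
  by rewrite charge_integralZ// mul0r.
apply: (tail_cvg (f := fun=> 0)) => x _; apply: cvg_near_cst.
exists (Num.trunc `|x|).+1 => // n /= xn.
rewrite ltNge (le_trans (ler_norm x))// ltW// (lt_le_trans (truncnS_gt _))//.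
by rewrite ler_nat.
Qed.

(** Positivity makes [tail] nonincreasing, so minus it is a distribution function. The resulting
    measure rho satisfies P = N + rho on rays, where P - N is the image of y sigma, hence on all
    Borel sets; this transfers integrability and integrals to rho. *)
Lemma component_measure_exists : exists rho : {measure set R -> \bar R},
  (forall A, measurable A -> phi @^-1` A = set0 -> rho A = 0%E) /\
  forall g : R -> R, measurable_fun setT g ->
    charge_integrable sigma (fun x => g (phi x) * y x) ->
    rho.-integrable setT (EFin \o g) /\
    \int[rho]_t g t = charge_integral sigma (fun x => g (phi x) * y x).
Proof.
have ndF : nondecreasing (fun t => - tail t).
  by move=> a b ab; rewrite lerN2; exact: tail_antitone.
have [rho rhoE] := nondecreasing_measure ndF tail_rc.
have rho_tail a : rho `]a, +oo[%classic = (tail a)%:E.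
  by rewrite (nondecreasing_measure_tail a rhoE tail_cvg0) sub0r opprK.
have [P [N [Pfin Nfin P0 PN]]] := weighted_image mphi my iy0.
have PNrho A : measurable A -> P A = measure_add N rho A.
  apply: (@measure_unique _ _ _ (@RGenOInfty.G R) (fun k => `]- k%:R, +oo[%classic)).
  - exact: RGenOInfty.measurableE.
  - move=> _ _ [x ->] [z ->]; exists (Num.max x z).
    apply/seteqP; split => t /=; rewrite !in_itv/= !andbT gt_max; last by move=> /andP.
    by move=> [-> ->].
  - by move=> i; exists (- i%:R).
  - apply/seteqP; split => // x _; exists (Num.trunc `|x|).+1 => //=.
    rewrite in_itv/= andbT ltrNl (le_lt_trans _ (truncnS_gt _))//.
    by rewrite -normrN ler_norm.
  - move=> _ [a ->]; rewrite [RHS]measure_addE [X in (_ + X)%E]rho_tail.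
    have [|_ _] := PN (fun s => (a < s)%R%:R) (mltr a).
      by apply: charge_integrable_bounded iyn _ => [|x]; [exact: mgy (mltr a)|exact: bdb].
    have E (m : {measure set R -> \bar R}) :
        \int[m]_t (a < t)%R%:R = fine (m `]a, +oo[%classic).
      rewrite -[in RHS](setIT (`]a, +oo[%classic)) -Rintegral_indic//.
      apply: eq_Rintegral => s _; rewrite indicE; congr (_%:R); congr (nat_of_bool _).
      by apply/idP/idP; rewrite inE /= in_itv/= andbT.
    rewrite !E -/(tail a) => <-; rewrite EFinB !fineK.
    + by rewrite addeCA subee ?adde0// ge0_fin_numE// (le_lt_trans _ Nfin)// le_measure ?inE.
    + by rewrite ge0_fin_numE// (le_lt_trans _ Nfin)// le_measure ?inE.
    + by rewrite ge0_fin_numE// (le_lt_trans _ Pfin)// le_measure ?inE.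
  - by move=> k; rewrite (le_lt_trans _ Pfin)// le_measure ?inE.
have rhoP A : measurable A -> (rho A <= P A)%E.
  by move=> mA; rewrite PNrho// [leRHS]measure_addE leeDr.
exists rho; split=> [A mA A0|g mg ig].
  by apply/eqP; rewrite -measure_le0 -(P0 A mA A0) rhoP.
have [gP gN <-] := PN g mg ig.
have grho := integrable_le_measure rhoP gP.
split=> //; rewrite (eq_Rintegral_measure _ PNrho) Rintegral_measure_add//.
by rewrite [X in X - _]addrC addrK.
Qed.

End component_measure.

(** * Charges determined by cut-off polynomials *)

Section boxes.
Context {R : realType} {d : nat}.
Implicit Types (a : 'I_d -> R).

Definition box a : set (d.-tuple R) := [set x | forall i, a i < tnth x i].

Lemma measurable_box a : measurable (box a).
Proof.
have -> : box a = \big[setI/setT]_(i < d) ((@tnth d R)^~ i @^-1` `]a i, +oo[).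
  apply/seteqP; split => x.
    by move=> xa; apply: (big_ind (fun A : set _ => A x)) => // i _; rewrite /= in_itv/= xa.
  by move=> + i; rewrite (bigD1 i)//= => -[/=]; rewrite in_itv/= andbT.
apply: bigsetI_measurable => i _; rewrite -[X in measurable X]setTI.
by apply: (@measurable_tnth _ _ _ i).
Qed.

Lemma indic_box a x : \1_(box a) x = \prod_(i < d) (a i < tnth x i)%R%:R :> R.
Proof.
rewrite indicE; have [xa|xa] := pselect (box a x).
  by rewrite mem_set// big1// => i _; rewrite xa.
rewrite memNset//.
have /existsNP[i ai] := xa.
by rewrite (bigD1 i)//=; case: (ltP _ _) ai => // _ _; rewrite mul0r.
Qed.

Lemma measurable_tuple_box : measurable = <<s range box >> :> set (set (d.-tuple R)).
Proof.
apply/seteqP; split; last first.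
  apply: smallest_sub; first exact: sigma_algebra_measurable.
  by move=> _ [a _ <-]; exact: measurable_box.
apply: smallest_sub; first exact: smallest_sigma_algebra.
apply: (big_ind (fun G => G `<=` <<s range box >>)) => [//|G1 G2 H1 H2 A [/H1|/H2]//|i _].
move=> _ [B mB <-].
have H : sigma_algebra [set: R]
    (image_set_system setT ((@tnth d R)^~ i) <<s range box >>).
  by apply: sigma_algebra_image; exact: smallest_sigma_algebra.
have mB' : (@RGenOInfty.G R).-sigma.-measurable B by rewrite -RGenOInfty.measurableE.
apply: (mB' _ (conj H _)).
move=> _ [t ->]; rewrite /image_set_system /= setTI.
rewrite (_ : _ @^-1` _ = \bigcup_n box (fun j => if j == i then t else - n%:R)).
  apply: sigma_algebra_bigcup => n; apply: sub_sigma_algebra.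
  by exists (fun j => if j == i then t else - n%:R).
apply/seteqP; split => x /=; last first.
  by move=> [n _ /(_ i)]; rewrite eqxx in_itv/= andbT.
rewrite in_itv/= andbT => tx.
exists (Num.trunc (\sum_(j < d) `|tnth x j|)).+1 => // j; case: eqP => [->//|_].
rewrite ltrNl (le_lt_trans _ (truncnS_gt _))// (bigD1 j)//=.
rewrite -[leLHS]addr0 lerD ?sumr_ge0//; by rewrite -normrN ler_norm.
Qed.

Lemma measure_ext_box (m1 m2 : {measure set (d.-tuple R) -> \bar R}) :
  (m1 setT < +oo)%E -> (forall a, m1 (box a) = m2 (box a)) ->
  forall A, measurable A -> m1 A = m2 A.
Proof.
move=> fin m12; apply: (measure_unique (range box) (fun k => box (fun=> - k%:R))).
- exact: measurable_tuple_box.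
- move=> _ _ [a _ <-] [b _ <-]; exists (fun i => Num.max (a i) (b i)) => //.
  apply/seteqP; split => x /=.
    by move=> xab; split=> i; have := xab i; rewrite gt_max => /andP[].
  by move=> [xa xb] i; rewrite gt_max xa xb.
- by move=> k; exists (fun=> - k%:R).
- apply/seteqP; split => // x _.
  exists (Num.trunc (\sum_(j < d) `|tnth x j|)).+1 => // j.
  rewrite ltrNl (le_lt_trans _ (truncnS_gt _))// (bigD1 j)//=.
  rewrite -[leLHS]addr0 lerD ?sumr_ge0//; by rewrite -normrN ler_norm.
- by move=> _ [a _ <-].
- move=> k; apply: le_lt_trans fin; rewrite le_measure ?inE//; exact: measurable_box.
Qed.

End boxes.

Section charge_extensionality.
Context {R : realType} {d : nat}.
Implicit Types (sigma mu : {charge set (d.-tuple R) -> \bar R}) (x : d.-tuple R).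

Lemma fine_cross (p n a b : \bar R) : n \is a fin_num -> p \is a fin_num ->
  b \is a fin_num -> a \is a fin_num ->
  fine a - fine b = fine p - fine n -> (a + n = p + b)%E.
Proof.
case: n p b a => // n [] // p [] // b [] // a _ _ _ _ /= abpn.
by rewrite -!EFinD; congr EFin; lra.
Qed.

Lemma fin_num_sub (p n a b : \bar R) : n \is a fin_num -> b \is a fin_num ->
  p \is a fin_num -> a \is a fin_num -> (a + n = p + b -> a - b = p - n)%E.
Proof.
case: n p b a => // n [] // p [] // b [] // a _ _ _ _.
by rewrite -!EFinB -!EFinD => -[abpn]; congr EFin; lra.
Qed.

Lemma charge_eq_indic sigma mu :
  (forall a, charge_integral sigma (\1_(box a)) = charge_integral mu (\1_(box a))) ->
  charge_eq sigma mu.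
Proof.
move=> sm.
have H A : measurable A -> measure_add (charge_pos sigma) (charge_neg mu) A =
    measure_add (charge_pos mu) (charge_neg sigma) A.
  apply: measure_ext_box => [|a].
    rewrite [X in (X < _)%E]measure_addE lte_add_pinfty//.
      by rewrite -ge0_fin_numE// fin_num_measure.
    by rewrite -ge0_fin_numE// fin_num_measure.
  have mb := measurable_box a; apply: etrans (measure_addE _ _ _) _.
  apply/esym; apply: etrans (measure_addE _ _ _) _.
  have := sm a; rewrite /charge_integral !Rintegral_indic// !setIT.
  move=> E; apply/esym/fine_cross => //; [exact: charge_neg_fin|exact: charge_pos_fin
    |exact: charge_neg_fin|exact: charge_pos_fin].
move=> A mA; rewrite !charge_decomp//; apply: fin_num_sub.
- exact: charge_neg_fin.
- exact: charge_neg_fin.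
- exact: charge_pos_fin.
- exact: charge_pos_fin.
exact: etrans (esym (measure_addE _ _ _)) (etrans (H A mA) (measure_addE _ _ _)).
Qed.

Definition cutoff n (t : R) : R := clamp (n.+1%:R - t).

Lemma cutoff_norm n t : `|cutoff n t| <= 1. Proof. exact: clamp_norm. Qed.

Lemma cutoff0 n t : n.+1%:R <= t -> cutoff n t = 0.
Proof. by move=> tn; rewrite /cutoff clamp0// subr_le0. Qed.

Lemma continuous_cutoff n : continuous (cutoff n).
Proof.
move=> t; apply: (@cvg_comp _ _ _ (fun t => n.+1%:R - t) clamp); last exact: continuous_clamp.
by apply: cvgB; [exact: cvg_cst|exact: cvg_id].
Qed.

Lemma cvg_cutoff t : cutoff n t @[n --> \oo] --> (1 : R).
Proof.
apply: cvg_near_cst; exists (Num.trunc `|t|).+1 => // n /= tn; apply: clamp1.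
have h1 := ler_norm t; have h2 := truncnS_gt `|t|.
have h3 : (Num.trunc `|t|).+1%:R <= n%:R :> R by rewrite ler_nat.
have h4 : n.+1%:R = n%:R + 1 :> R by rewrite -natr1.
lra.
Qed.

Lemma measurable_cutoff n : measurable_fun setT (fun x => cutoff n (enorm x)).
Proof.
apply: measurableT_comp; last exact: measurable_enorm.
by apply: continuous_measurable_fun; exact: continuous_cutoff.
Qed.

Definition prod_poly (q : 'I_d -> {poly R}) : mpoly.mpoly d R :=
  \prod_(i < d) \sum_(j < size (q i)) (q i)`_j *: mpoly.mpolyX R (mpoly.mnm1 i) ^+ j.

Lemma peval_prod_poly q x : peval (prod_poly q) x = \prod_(i < d) (q i).[tnth x i].
Proof.
rewrite /peval rmorph_prod /=; apply: eq_bigr => i _.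
rewrite raddf_sum /= horner_coef; apply: eq_bigr => j _.
by rewrite mpoly.mevalZ rmorphXn /= mpoly.mevalXU.
Qed.

(** Where the cutoff is nonzero the coordinates are bounded by n + 1, so products of threshold
    polynomials converge to the indicator of a box; the cutoff is removed by letting n grow. *)
Lemma charge_eq_cutoff sigma mu : moment_measure sigma -> moment_measure mu ->
  (forall n p, charge_integral sigma (fun x => cutoff n (enorm x) * peval p x) =
               charge_integral mu (fun x => cutoff n (enorm x) * peval p x)) ->
  charge_eq sigma mu.
Proof.
move=> /moment_measureP isig /moment_measureP imu sm; apply: charge_eq_indic => a.
have i1 (nu : {charge set (d.-tuple R) -> \bar R}) :
    (forall p, charge_integrable nu (peval p)) -> charge_integrable nu (fun=> 1).
  by move=> /(_ 1); congr (integrable _ _ _); apply/funext => x; rewrite /= /peval mpoly.meval1.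
have mb : measurable_fun setT (\1_(box a) : d.-tuple R -> R).
  by apply: measurable_indic; exact: measurable_box.
have bn x : `|\1_(box a) x : R| <= 1.
  by have /andP[? ?] := @indic01 _ R (box a) x; rewrite ger0_norm.
have lim1 (nu : {charge set (d.-tuple R) -> \bar R}) : charge_integrable nu (fun=> 1) ->
    charge_integral nu (fun x => cutoff n (enorm x) * \1_(box a) x) @[n --> \oo] -->
    charge_integral nu (\1_(box a)).
  move=> inu; have [||||_ //] := @charge_dominated_convergence _ _ _ nu
    (fun n x => cutoff n (enorm x) * \1_(box a) x) (\1_(box a)) (fun=> 1).
  - by move=> n; apply: measurable_funM => //; exact: measurable_cutoff.
  - move=> x; rewrite -[X in _ --> X]mul1r; apply: cvgM; last exact: cvg_cst.
    exact: cvg_cutoff.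
  - by [].
  - by move=> n x; rewrite normrM mulr_ile1// cutoff_norm.
have E n : charge_integral sigma (fun x => cutoff n (enorm x) * \1_(box a) x) =
    charge_integral mu (fun x => cutoff n (enorm x) * \1_(box a) x).
  have /choice[q qP] : forall i, exists q : nat -> {poly R},
    (forall m t, `|t| <= n.+1%:R -> 0 <= (q m).[t] <= 1) /\
    (forall t, `|t| <= n.+1%:R -> (q m).[t] @[m --> \oo] --> ((a i < t)%R%:R : R)).
    by move=> i; exact: threshold_poly.
  have lim2 (nu : {charge set (d.-tuple R) -> \bar R}) : charge_integrable nu (fun=> 1) ->
      charge_integral nu (fun x => cutoff n (enorm x) * peval (prod_poly (fun i => q i m)) x)
        @[m --> \oo] -->
      charge_integral nu (fun x => cutoff n (enorm x) * \1_(box a) x).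
    move=> inu.
    have ic : charge_integrable nu (fun x => cutoff n (enorm x)).
      by apply: charge_integrable_bounded inu _ => [|x];
        [exact: measurable_cutoff|exact: cutoff_norm].
    have /charge_integrableP[icp icn] := ic.
    have thr (m : {measure set (d.-tuple R) -> \bar R}) :
        m.-integrable setT (EFin \o (fun x => cutoff n (enorm x))) ->
        \int[m]_x (cutoff n (enorm x) * peval (prod_poly (fun i => q i k)) x)
          @[k --> \oo] --> \int[m]_x (cutoff n (enorm x) * \1_(box a) x).
      move=> im; have := @cvg_threshold _ _ _ d m setT (fun x => cutoff n (enorm x))
        (fun i x => tnth x i) n.+1%:R a q measurableT (fun i => (qP i).1)
        (fun i => (qP i).2) im (fun i => measurable_tnth _).
      have -> : (fun k => \int[m]_x (cutoff n (enorm x) * peval (prod_poly (fun i => q i k)) x)) =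
          (fun k => \int[m]_x (cutoff n (enorm x) * \prod_(i < d) (q i k).[tnth x i])).
        by apply/funext => k; apply: eq_Rintegral => x _; rewrite peval_prod_poly.
      have -> : \int[m]_x (cutoff n (enorm x) * \1_(box a) x) =
          \int[m]_x (cutoff n (enorm x) * \prod_(i < d) (a i < tnth x i)%R%:R).
        by apply: eq_Rintegral => x _; rewrite indic_box.
      apply=> x _ cn0 i; apply: le_trans (tnth_le_enorm x i) _.
      by apply: contraNT cn0; rewrite -ltNge => /ltW /cutoff0 ->.
    by apply: cvgB; exact: thr.
  have l1 := lim2 _ (i1 _ isig); have l2 := lim2 _ (i1 _ imu).
  by rewrite -(cvg_lim _ l1)// -(cvg_lim _ l2)//; under eq_fun do rewrite sm.
have l1 := lim1 _ (i1 _ isig); have l2 := lim1 _ (i1 _ imu).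
by rewrite -(cvg_lim _ l1)// -(cvg_lim _ l2)//; under eq_fun do rewrite E.
Qed.

End charge_extensionality.

Section null_complement.
Context {dT : measure_display} {T : measurableType dT} {R : realType}.
Variables (nu : {measure set T -> \bar R}) (D : set T).
Hypotheses (mD : measurable D) (n0 : nu (~` D) = 0%E).

Lemma integral_null_complement (f : T -> \bar R) : measurable_fun setT f ->
  (\int[nu]_(x in D) f x = \int[nu]_x f x)%E.
Proof.
move=> mf; rewrite integral_mkcond; apply: ae_eq_integral => //.
  by apply/(measurable_restrictT f) => //; exact: measurable_funTS.
exists (~` D); split=> //; first exact: measurableC.
move=> x /= /not_implyP[_]; rewrite patchE; case: ifPn => // + _.
by rewrite notin_setE.
Qed.

Lemma Rintegral_null_complement (f : T -> R) : measurable_fun setT f ->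
  \int[nu]_(x in D) f x = \int[nu]_x f x.
Proof.
by move=> mf; rewrite /Rintegral integral_null_complement//; exact/measurable_EFinP.
Qed.

Lemma integrable_null_complement (f : T -> R) : measurable_fun setT f ->
  nu.-integrable D (EFin \o f) <-> nu.-integrable setT (EFin \o f).
Proof.
move=> mf; have mE : measurable_fun setT (EFin \o f) by exact/measurable_EFinP.
have E : (\int[nu]_(x in D) `|(EFin \o f) x| = \int[nu]_x `|(EFin \o f) x|)%E.
  by apply: integral_null_complement; exact: measurableT_comp.
split=> /integrableP[_ fi]; apply/integrableP; split=> //.
- by rewrite -E.
- exact: measurable_funTS.
- by rewrite E.
Qed.

End null_complement.

(** * Images of half-line measures under squaring *)

Section half_line_images.
Context {R : realType}.
Implicit Types (nu rho : {measure set R -> \bar R}).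
Local Notation D := (`[0%R, +oo[%classic : set R).

Lemma half_line_compl : ~` D = `]-oo, 0[%classic.
Proof.
apply/seteqP; split => x /=; rewrite !in_itv/= andbT.
  by move=> /negP; rewrite -ltNge.
by move=> x0; apply/negP; rewrite -ltNge.
Qed.

Lemma half_line_Rintegral nu (f : R -> R) : nu `]-oo, 0[%classic = 0%E ->
  measurable_fun setT f -> \int[nu]_(x in D) f x = \int[nu]_x f x.
Proof. by move=> n0; apply: Rintegral_null_complement => //; rewrite half_line_compl. Qed.

Lemma half_line_integrable nu (f : R -> R) : nu `]-oo, 0[%classic = 0%E ->
  measurable_fun setT f ->
  nu.-integrable D (EFin \o f) <-> nu.-integrable setT (EFin \o f).
Proof. by move=> n0; apply: integrable_null_complement => //; rewrite half_line_compl. Qed.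

Lemma preimage_psi_lt0 : @psi R @^-1` `]-oo, 0[%classic = set0.
Proof.
apply/seteqP; split => // x /=; rewrite in_itv/= => /lt_le_trans/(_ (sqr_ge0 x)).
by rewrite ltxx.
Qed.

Lemma preimage_psi_half_line : @psi R @^-1` D = setT.
Proof. by apply/seteqP; split => // x _ /=; rewrite in_itv/= andbT sqr_ge0. Qed.

Lemma image_psi_lt0 rho : image_psi rho `]-oo, 0[%classic = 0%E.
Proof. by rewrite /image_psi /pushforward preimage_psi_lt0 measure0. Qed.

Lemma image_psi_integrable rho (f : R -> R) : measurable_fun setT f ->
  rho.-integrable setT (EFin \o (fun t => f (t ^+ 2))) ->
  (image_psi rho).-integrable D (EFin \o f).
Proof.
move=> mf fi.
have := @integrable_pushforward _ _ R R R (@psi R) (@measurable_psi R) rho D (EFin \o f).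
by apply => //; [exact/measurable_EFinP|rewrite preimage_psi_half_line].
Qed.

Lemma image_psi_Rintegral rho (f : R -> R) : measurable_fun setT f ->
  rho.-integrable setT (EFin \o (fun t => f (t ^+ 2))) ->
  \int[image_psi rho]_(r in D) f r = \int[rho]_t f (t ^+ 2).
Proof.
move=> mf fi; rewrite /Rintegral; congr fine.
have := @integral_pushforward _ _ R R R (@psi R) (@measurable_psi R) rho D (EFin \o f).
by rewrite preimage_psi_half_line; apply => //; exact/measurable_EFinP.
Qed.

Lemma measurable_polynomial (p : {poly R}) : measurable_fun setT (horner p).
Proof. by apply: continuous_measurable_fun; exact: continuous_horner. Qed.

Lemma half_line_moment_integrable nu n : half_line_moment_measure nu ->
  nu.-integrable setT (EFin \o (fun t => t ^+ n)).
Proof.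
move=> [m0 mp]; apply/half_line_integrable => //.
by have := mp 'X^n; congr (integrable _ _ _); apply/funext => t /=; rewrite hornerXn.
Qed.

Lemma half_line_moment_image_psi nu : half_line_moment_measure nu ->
  half_line_moment_measure (image_psi nu).
Proof.
move=> hnu; split=> [|p]; first exact: image_psi_lt0.
apply: image_psi_integrable; first exact: measurable_polynomial.
rewrite (_ : (fun t => _) = fun t => \sum_(j < size p) p`_j * t ^+ (2 * j)).
  apply: integrable_real_sum => // j; apply: integrable_realZ => //.
  exact: half_line_moment_integrable.
by apply/funext => t; rewrite horner_coef; apply: eq_bigr => j _; rewrite exprM.
Qed.

Lemma image_psi_moments nu n : half_line_moment_measure nu ->
  \int[image_psi nu]_(r in D) r ^+ n = \int[nu]_t t ^+ (2 * n).
Proof.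
move=> hnu; rewrite image_psi_Rintegral//; first by apply: eq_Rintegral => t _; rewrite exprM.
have := half_line_moment_integrable (2 * n) hnu.
by congr (integrable _ _ _); apply/funext => t /=; rewrite exprM.
Qed.

(** On the half-line, t < b means t^2 < b^2, so the mass of [0, b[ can be read off the image. *)
Lemma image_psi_inj nu rho : nu `]-oo, 0[%classic = 0%E ->
  rho `]-oo, 0[%classic = 0%E -> (nu setT < +oo)%E ->
  (forall A, measurable A -> image_psi nu A = image_psi rho A) ->
  forall A, measurable A -> nu A = rho A.
Proof.
move=> n0 r0 fin nr; apply: half_line_measure_ext => // b b0.
have E (m : {measure set R -> \bar R}) : m `]-oo, 0[%classic = 0%E ->
    m (`]-oo, b[ `&` D) = image_psi m `]-oo, b ^+ 2[%classic.
  move=> m0; rewrite /image_psi /pushforward.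
  rewrite -[RHS](half_line_measureE m0); last first.
    by rewrite -[X in measurable X]setTI; exact: measurable_psi.
  congr (m _); apply/seteqP; split => x /=; rewrite !in_itv/= andbT => -[xb x0].
    by rewrite ltr_pXn2r// nnegrE// ltW.
  by split=> //; move: xb; rewrite ltr_pXn2r// nnegrE// ltW.
by rewrite !E// nr.
Qed.

End half_line_images.

(** * Uniqueness when all image measures are determined *)

Section determined_case.
Context {R : realType} {d : nat}.
Hypothesis d0 : (0 < d)%N.
Variables (a : nat -> nat) (Y : forall k : nat, 'I_(a k) -> mpoly.mpoly d R).
Arguments Y : clear implicits.
Hypothesis hY : forall k : nat, orthonormal_harmonic_basis k (Y k).
Local Notation D := (`[0%R, +oo[%classic : set R).
Implicit Types (sigma mu : {charge set (d.-tuple R) -> \bar R}).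

(** Odd powers of |x| are not polynomials; the right-hand side is one, and so is integrable for a
    moment measure. *)
Lemma enormX_le n (x : d.-tuple R) : enorm x ^+ n <= (1 + enorm x ^+ 2) ^+ n.
Proof.
rewrite lerXn2r ?nnegrE ?enorm_ge0//; first by rewrite addr_ge0 ?exprn_ge0 ?enorm_ge0.
have := sqr_ge0 (enorm x - 1); have := enorm_ge0 x; rewrite sqrrB1; nra.
Qed.

Lemma integrable_enormXM sigma n p : moment_measure sigma ->
  charge_integrable sigma (fun x => enorm x ^+ n * peval p x).
Proof.
move=> /moment_measureP ms; have := ms ((1 + sqnorm) ^+ n * p).
move=> /integrable_norm => ip; apply: charge_integrable_bounded ip _.
  apply: measurable_funM; last exact: measurable_peval.
  by apply: measurable_funX; exact: measurable_enorm.
move=> x; rewrite /= pevalM pevalX peval_add1_sqnorm !normrM.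
rewrite ler_wpM2r// !ger0_norm ?enormX_le// ?exprn_ge0 ?enorm_ge0//.
by rewrite addr_ge0 ?exprn_ge0 ?enorm_ge0.
Qed.

Lemma integrable_radial sigma (g : R -> R) n p : moment_measure sigma ->
  measurable_fun setT g -> (forall t, 0 <= t -> `|g t| <= t ^+ n) ->
  charge_integrable sigma (fun x => g (enorm x) * peval p x).
Proof.
move=> ms mg gn; have ip := integrable_norm (integrable_enormXM n p ms).
apply: charge_integrable_bounded ip _.
  apply: measurable_funM; last exact: measurable_peval.
  by apply: measurableT_comp => //; exact: measurable_enorm.
move=> x; rewrite /= !normrM ler_wpM2r// (le_trans (gn _ (enorm_ge0 x)))//.
exact: ler_norm.
Qed.

Lemma component_exists sigma k l : moment_measure sigma -> pseudo_positive Y sigma ->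
  exists rho : {measure set R -> \bar R},
  [/\ half_line_moment_measure rho, rho.-integrable setT (EFin \o (fun=> 1 : R)) &
    forall (g : R -> R) n, measurable_fun setT g -> (forall t, 0 <= t -> `|g t| <= t ^+ n) ->
    rho.-integrable setT (EFin \o g) /\
    \int[rho]_t g t = charge_integral sigma (fun x => g (enorm x) * peval (Y k l) x)].
Proof.
move=> ms ps.
have [|h ch h0 [M hM]|rho [rho0 rhoE]] := @component_measure_exists _ _ _ sigma
    (@enorm R d) (peval (Y k l)) (@measurable_enorm R d) enorm_ge0 (measurable_peval _).
- by move=> n; exact: integrable_enormXM.
- apply: ps => //; first exact: continuous_subspaceT.
  by exists M => t _; exact: hM.
have n0 : rho `]-oo, 0[%classic = 0%E.
  apply: rho0 => //; apply/seteqP; split => // x /=.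
  by rewrite in_itv/= ltNge enorm_ge0.
have rhoX n : rho.-integrable setT (EFin \o (fun t => t ^+ n)).
  by have [] := rhoE (fun t => t ^+ n) (exprn_measurable n) (integrable_enormXM _ _ ms).
have rhop (p : {poly R}) : rho.-integrable setT (EFin \o horner p).
  rewrite (_ : horner p = fun t => \sum_(i < size p) p`_i * t ^+ i); last first.
    by apply/funext => t; rewrite horner_coef.
  by apply: integrable_real_sum => // i; exact: integrable_realZ.
exists rho; split.
- split=> // p; apply/(half_line_integrable n0) => //; exact: measurable_polynomial.
- by have := rhoX 0%N; congr (integrable _ _ _); apply/funext => t /=; rewrite expr0.
- by move=> g n mg gn; apply: rhoE => //; exact: integrable_radial gn.
Qed.

Lemma radial_square i k l (sigma : {charge set (d.-tuple R) -> \bar R}) :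
  charge_integral sigma (fun x => enorm x ^+ 2 ^+ i * peval (Y k l) x) =
  charge_integral sigma (peval (sqnorm ^+ i * Y k l)).
Proof.
by congr charge_integral; apply/funext => x; rewrite pevalM pevalX peval_sqnorm.
Qed.

Lemma determined_charge_eq mu (muc : forall k : nat, 'I_(a k) -> {measure set R -> \bar R})
    tau : moment_measure mu ->
  (forall k l, component_measure Y mu l (muc k l)) ->
  (forall k l, stieltjes_determined (image_psi (muc k l))) ->
  V_set Y mu tau -> charge_eq tau mu.
Proof.
move=> mmu hmuc det [mtau ptau /cintegral_peval tau_mu].
have comp k l (g : R -> R) i : continuous g -> (forall t, 0 <= t -> `|g t| <= t ^+ i) ->
    charge_integral tau (fun x => g (enorm x) * peval (Y k l) x) =
    charge_integral mu (fun x => g (enorm x) * peval (Y k l) x).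
  move=> cg gi; have [rho [hrho rho1 rhoE]] := component_exists l mtau ptau.
  have [[m0 mp] mE] := hmuc k l; have [rho0 rhop] := hrho.
  have gE (h : R -> R) n : continuous h -> (forall t, 0 <= t -> `|h t| <= t ^+ n) ->
      \int[muc k l]_t h t = charge_integral mu (fun x => h (enorm x) * peval (Y k l) x).
    move=> ch hn; rewrite -mE//.
    - by rewrite half_line_Rintegral//; exact: continuous_measurable_fun.
    - exact: continuous_subspaceT.
    - by exists 'X^n => t t0; rewrite hornerXn hn.
  have eq_sq n (t : R) : 0 <= t -> `|t ^+ (2 * n)| <= t ^+ (2 * n).
    by move=> t0; rewrite ger0_norm// exprn_ge0.
  have cX n : continuous (fun t : R => t ^+ n) by exact: exprn_continuous.
  (* The even moments of both measures are integrals of the polynomials |x|^(2n) Y, on which tau and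
     mu agree; determinacy identifies the images under psi, and [image_psi_inj] the measures. *)
  have rho_muc A : measurable A -> rho A = muc k l A.
    apply: image_psi_inj => //; first exact: half_line_moment_measure_lty.
    apply: (det k l).2 (half_line_moment_image_psi hrho) _ => n.
    rewrite !image_psi_moments//.
    have [_ ->] := rhoE (fun t => t ^+ (2 * n)) (2 * n)%N (exprn_measurable _) (eq_sq n).
    rewrite (gE _ (2 * n)%N (cX _) (eq_sq n)).
    have F (sigma : {charge set (d.-tuple R) -> \bar R}) :
        charge_integral sigma (fun x => enorm x ^+ (2 * n) * peval (Y k l) x) =
        charge_integral sigma (peval (sqnorm ^+ n * Y k l)).
      by rewrite -radial_square; congr charge_integral; apply/funext => x; rewrite exprM.
    by rewrite !F tau_mu.
  have [_ <-] := rhoE g i (continuous_measurable_fun cg) gi.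
  by rewrite (eq_Rintegral_measure _ rho_muc) (gE _ i).
apply: charge_eq_cutoff => // n p.
have [s sE] := harmonic_expansion d0 hY p.
(* The cutoff times a term of the harmonic expansion is a radial function times some Y, to which
   [comp] applies. *)
pose g i t := cutoff n t * (t : R) ^+ (2 * i).
have cg i : continuous (g i).
  by move=> t; apply: cvgM; [exact: continuous_cutoff|exact: exprn_continuous].
have gi i t : 0 <= t -> `|g i t| <= t ^+ (2 * i).
  move=> t0; rewrite normrM [`|t ^+ _|]ger0_norm ?exprn_ge0//.
  by rewrite ler_piMl ?exprn_ge0// cutoff_norm.
have E (sigma : {charge set (d.-tuple R) -> \bar R}) : moment_measure sigma ->
    charge_integral sigma (fun x => cutoff n (enorm x) * peval p x) =
    \sum_(e <- s) e.1.1 * charge_integral sigma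
      (fun x => g e.1.2 (enorm x) * peval (Y (tag e.2) (tagged e.2)) x).
  move=> ms; have ig (e : R * nat * {k : nat & 'I_(a k)}) : charge_integrable sigma
      (fun x => g e.1.2 (enorm x) * peval (Y (tag e.2) (tagged e.2)) x).
    apply: integrable_radial ms _ (gi _); exact: continuous_measurable_fun.
  transitivity (charge_integral sigma (fun x => \sum_(e <- s)
      e.1.1 * (g e.1.2 (enorm x) * peval (Y (tag e.2) (tagged e.2)) x))).
    congr charge_integral; apply/funext => x; rewrite sE mulr_sumr.
    by apply: eq_bigr => e _; rewrite /g; ring.
  rewrite charge_integral_sum; last by move=> e; exact: charge_integrableZ.
  by apply: eq_bigr => e _; rewrite charge_integralZ.
rewrite !E//; apply: eq_bigr => e _; congr (_ * _); exact: comp (gi _).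
Qed.

End determined_case.

(** * Orthogonality of spherical harmonics *)

Section product_integrals.
Context {d1 d2 : measure_display} {T1 : measurableType d1} {T2 : measurableType d2}
  {R : realType}.
Variables (m1 : {sigma_finite_measure set T1 -> \bar R})
  (m2 : {sigma_finite_measure set T2 -> \bar R}).

Lemma integrable_product (f : T1 -> R) (g : T2 -> R) :
  m1.-integrable setT (EFin \o f) -> m2.-integrable setT (EFin \o g) ->
  (m1 \x m2)%E.-integrable setT (EFin \o (fun z => f z.1 * g z.2)).
Proof.
move=> jf jg; have mf := measurable_int _ jf; have mg := measurable_int _ jg.
have mf' : measurable_fun setT f by exact/measurable_EFinP.
have mg' : measurable_fun setT g by exact/measurable_EFinP.
have mfg : measurable_fun setT (fun z : T1 * T2 => f z.1 * g z.2).
  by apply: measurable_funM; [exact: measurableT_comp|exact: measurableT_comp].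
apply/integrableP; split; first exact/measurable_EFinP.
have mnf : measurable_fun setT (fun x => `|f x|%:E).
  by apply/measurable_EFinP; exact: measurableT_comp.
have mng : measurable_fun setT (fun y => `|g y|%:E).
  by apply/measurable_EFinP; exact: measurableT_comp.
have /integrableP[_ fi] := jf; have /integrableP[_ gi] := jg.
rewrite fubini_tonelli1//; last by apply: measurableT_comp => //; exact/measurable_EFinP.
rewrite /fubini_F.
under eq_integral => x _.
  under eq_integral => y _ do rewrite /= normrM EFinM.
  rewrite ge0_integralZl//.
  over.
rewrite /= ge0_integralZr//; last exact: integral_ge0.
apply: lte_mul_pinfty => //; first exact: integral_ge0.
by rewrite ge0_fin_numE//; exact: integral_ge0.
Qed.

Lemma Rintegral_product (f : T1 -> R) (g : T2 -> R) :
  m1.-integrable setT (EFin \o f) -> m2.-integrable setT (EFin \o g) ->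
  \int[(m1 \x m2)%E]_z (f z.1 * g z.2) = (\int[m1]_x f x) * (\int[m2]_y g y).
Proof.
move=> jf jg; have jfg := integrable_product jf jg.
rewrite {1}/Rintegral -integral12_prod_meas1//.
have E x : fubini_F m2 (fun z => (f z.1 * g z.2)%:E) x = ((\int[m2]_y g y) * f x)%:E.
  have fg : (\int[m2]_y (g y)%:E)%E \is a fin_num := integrable_fin_num measurableT jg.
  rewrite /fubini_F /= mulrC EFinM /Rintegral fineK//.
  under [in LHS]eq_integral do rewrite EFinM.
  by rewrite integralZl.
under eq_integral do rewrite E.
rewrite -[LHS]/(\int[m1]_x ((\int[m2]_y g y) * f x)) RintegralZl// mulrC//.
Qed.

End product_integrals.

Section lebesgue_tuple_products.
Context {R : realType}.
Local Notation leb := (@lebesgue_measure R).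

Lemma lebesgue_tuple_prod n (f : 'I_n -> R -> R) :
  (forall i, leb.-integrable setT (EFin \o f i)) ->
  (lebesgue_tuple n).-integrable setT (EFin \o (fun x : n.-tuple R => \prod_i f i (tnth x i))) /\
  \int[lebesgue_tuple n]_x (\prod_i f i (tnth x i)) = \prod_i \int[leb]_t f i t.
Proof.
elim: n f => [|n IH] f jf.
  have E (x : 0.-tuple R) : \prod_i f i (tnth x i) = 1 by rewrite big_ord0.
  split.
    apply/integrableP; split.
      by apply/measurable_EFinP; under eq_fun do rewrite E; exact: measurable_cst.
    under eq_integral do rewrite /= E normr1.
    by rewrite /= integral_cst//= mul1e diracE mem_set// ltry.
  under eq_Rintegral do rewrite E.
  rewrite Rintegral_cst// mul1r big_ord0.
  by rewrite [X in fine X](_ : _ = 1%E)//; exact: diracT.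
have [IHi IHI] := IH (fun i => f (lift ord0 i)) (fun i => jf _).
have E (z : measurableTypeR R * n.-tuple R) :
    \prod_i f i (tnth (cons_pair z) i) =
    f ord0 z.1 * \prod_i f (lift ord0 i) (tnth z.2 i).
  rewrite big_ord_recl /cons_pair; congr (f _ _ * _).
  by apply: eq_bigr => i _; congr (f _ _); rewrite tnthS.
have mprod : measurable_fun setT (fun x : n.+1.-tuple R => \prod_i f i (tnth x i)).
  apply: measurable_prod => i _.
  have mfi : measurable_fun setT (f i).
    by apply/measurable_EFinP; exact: (measurable_int _ (jf i)).
  by apply: (measurableT_comp mfi); exact: measurable_tnth.
have jp : (leb \x lebesgue_tuple n)%E.-integrable setT
    (EFin \o (fun z => f ord0 z.1 * \prod_i f (lift ord0 i) (tnth z.2 i))).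
  exact: (@integrable_product _ _ _ _ _ leb (lebesgue_tuple n) (f ord0)
    (fun y => \prod_i f (lift ord0 i) (tnth y i)) (jf ord0) IHi).
have jp' : (leb \x lebesgue_tuple n)%E.-integrable (@cons_pair R n @^-1` setT)
    ((EFin \o (fun x : n.+1.-tuple R => \prod_i f i (tnth x i))) \o @cons_pair R n).
  rewrite preimage_setT; move: jp; congr (integrable _ _ _).
  by apply/funext => z; rewrite /= E.
split.
  have := integrable_pushforward (@measurable_cons_pair R n) _ jp'.
  by apply => //; exact/measurable_EFinP.
have := integral_pushforward (@measurable_cons_pair R n) _ jp' measurableT.
move=> /(_ (proj2 (measurable_EFinP _ _) mprod)) /(congr1 fine).
rewrite preimage_setT => H; rewrite big_ord_recl -IHI -Rintegral_product//.
rewrite {1}/Rintegral /= H /Rintegral; congr fine.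
by apply: eq_integral => z _ /=; rewrite E.
Qed.

End lebesgue_tuple_products.

(** * One-dimensional Gaussian moments *)

Section gaussian_moments.
Context {R : realType}.
Local Notation leb := (@lebesgue_measure R).

(** From exp(1 + t^2) >= (1 + t^2)^(n+1) / (n+1)!, one power of 1 + t^2 more than is needed to beat
    |t|^n. The factor e comes from expanding at 1 + t^2. *)
Lemma gauss_bound n (t : R) :
  `|t ^+ n * gauss_fun t| <= n.+1`!%:R * expR 1 * (1 + t ^+ 2)^-1.
Proof.
have u1 : 1 <= 1 + t ^+ 2 by rewrite lerDl sqr_ge0.
have u0 : 0 < 1 + t ^+ 2 by lra.
have tn : `|t| ^+ n <= (1 + t ^+ 2) ^+ n.
  rewrite lerXn2r ?nnegrE//; first exact: ltW.
  rewrite -[t ^+ 2]real_normK ?num_real//.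
  have := sqr_ge0 (`|t| - 1); have := normr_ge0 t; rewrite sqrrB1; nra.
have /(_ (ltW u0)) e := @expR_ge1Dxn R (1 + t ^+ 2) n.
have f0 : 0 < n.+1`!%:R :> R by rewrite ltr0n fact_gt0.
rewrite ler_pdivlMr// normrM normrX [`|gauss_fun t|]ger0_norm ?gauss_fun_ge0//.
rewrite /gauss_fun expRN mulrAC ler_pdivrMr ?expR_gt0// -mulrA -expRD.
apply: (@le_trans _ _ ((1 + t ^+ 2) ^+ n.+1)).
  by rewrite [leRHS]exprSr ler_wpM2r// ltW.
by rewrite -ler_pdivrMl// mulrC (le_trans _ e)// lerDr.
Qed.

Lemma integrable_oneDsqrV : leb.-integrable setT (EFin \o (fun t : R => (1 + t ^+ 2)^-1)).
Proof.
have p0 (t : R) : 0 <= (1 + t ^+ 2)^-1 by rewrite invr_ge0 addr_ge0// sqr_ge0.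
have c : continuous (fun t : R => (1 + t ^+ 2)^-1) by exact: continuous_oneDsqrV.
apply/integrableP; split.
  by apply/measurable_EFinP; exact: continuous_measurable_fun.
under eq_integral do rewrite /= ger0_norm//.
rewrite ge0_symfun_integralT//; last by move=> t /=; rewrite sqrrN.
rewrite (_ : [set x | _] = `[0, +oo[%classic); last first.
  by apply/seteqP; split=> x/=; rewrite in_itv/= andbT.
have := @integral0y_oneDsqr R; rewrite /oneDsqr => ->.
by rewrite -EFinM ltry.
Qed.

Lemma integrable_gauss n : leb.-integrable setT (EFin \o (fun t : R => t ^+ n * gauss_fun t)).
Proof.
apply: integrable_bounded_by (integrable_realZ (n.+1`!%:R * expR 1) _ integrable_oneDsqrV) _ => //.
  apply: measurable_funM; [exact: exprn_measurable|exact: measurable_gauss_fun].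
by move=> t _; exact: gauss_bound.
Qed.

Definition gauss_moment n := \int[leb]_t (t ^+ n * gauss_fun t).

Lemma is_derive_gauss n (t : R) : is_derive t 1 (fun t => t ^+ n * gauss_fun t)
  (n%:R * (t ^+ n.-1 * gauss_fun t) - 2 * (t ^+ n.+1 * gauss_fun t)).
Proof.
rewrite /gauss_fun.
have dX m : is_derive t 1 (fun t : R => t ^+ m) (m%:R * t ^+ m.-1).
  by apply: DeriveDef; [exact: exprn_derivable|rewrite exp_derive /GRing.scale/= mulr1].
have dN := @is_deriveN _ _ _ (fun t : R => t ^+ 2) t 1 _ (dX 2%N).
have dE := @is_derive1_comp R (@expR R) (fun t => - t ^+ 2) t _ _ (is_derive_expR _) dN.
have dM := @is_deriveM _ _ (fun t : R => t ^+ n) (fun t => expR (- t ^+ 2)) t 1 _ _ (dX n) dE.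
apply: (@is_derive_eq _ _ _ _ _ _ _ _ dM).
rewrite /GRing.scale /= (exprS t n).
by ring.
Qed.

(** The derivative of t^n exp(-t^2) has integral zero over R. For n = 0 the truncated predecessor is
    harmless, its coefficient being 0. *)
Lemma gauss_moment_rec n : 2 * gauss_moment n.+1 = n%:R * gauss_moment n.-1.
Proof.
pose F n (t : R) := t ^+ n * gauss_fun t.
pose f t := n%:R * F n.-1 t - 2 * F n.+1 t.
have cF m : continuous (F m).
  by move=> t; apply: cvgM; [exact: exprn_continuous|exact: continuous_gauss_fun].
have cf : continuous f.
  by move=> t; apply: cvgB; (apply: cvgM; [exact: cvg_cst|exact: cF]).
have jf : leb.-integrable setT (EFin \o f).
  by apply: integrable_realB => //; apply: integrable_realZ => //; exact: integrable_gauss.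
have intf : \int[leb]_t f t = n%:R * gauss_moment n.-1 - 2 * gauss_moment n.+1.
  rewrite RintegralB//; try by apply: integrable_realZ => //; exact: integrable_gauss.
  by rewrite !RintegralZl//; exact: integrable_gauss.
apply/esym/eqP; rewrite -subr_eq0 -intf; apply/eqP.
pose I m : set R := `[- m.+1%:R, m.+1%:R]%classic.
have FTC m : \int[leb]_t (\1_(I m) t * f t) = F n m.+1%:R - F n (- m.+1%:R).
  have m0 : - m.+1%:R < m.+1%:R :> R by rewrite gtrN.
  have := @continuous_FTC2 R f (F n) _ _ m0 (continuous_subspaceT cf).
  move=> /(_ _ _)/(congr1 fine); rewrite -EFinB /= => <-.
  - rewrite /Rintegral [in RHS]integral_mkcond; congr fine; apply: eq_integral => t _.
    by rewrite patchE indicE; case: (_ \in _); rewrite ?mul1r ?mul0r.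
  - split.
    + by move=> t _; have [] := is_derive_gauss n t.
    + by apply: cvg_at_right_filter; exact: cF.
    + by apply: cvg_at_left_filter; exact: cF.
  - by move=> t _; rewrite derive1E; have [_ ->] := is_derive_gauss n t.
have L1 : \int[leb]_t (\1_(I m) t * f t) @[m --> \oo] --> \int[leb]_t f t.
  have [||||_ //] := @Rdominated_convergence _ _ _ leb setT
    (fun m t => \1_(I m) t * f t) f (fun t => `|f t|) measurableT.
  - move=> m; apply: measurable_funM; last exact: continuous_measurable_fun.
    by apply: measurable_indic; exact: measurable_itv.
  - move=> t _; apply: cvg_near_cst; exists (Num.trunc `|t|).+1 => // m /= tm.
    rewrite indicE mem_set ?mul1r// /I /= in_itv/= -ler_norml ltW//.
    rewrite (lt_le_trans (truncnS_gt _))// ler_nat; exact: leqW.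
  - exact: integrable_norm.
  - move=> m t _; rewrite normrM ler_piMl//.
    by have /andP[? ?] := @indic01 _ R (I m) t; rewrite ger0_norm.
have L2 : F n m.+1%:R - F n (- m.+1%:R) @[m --> \oo] --> (0 : R).
  apply: norm_cvg0; apply: (@squeeze_cvgr _ _ _ _ (fun=> 0)
    (fun m : nat => 2 * (n.+1`!%:R * expR 1) * m.+1%:R^-1)).
  - apply: nearW => m; rewrite normr_ge0 /= (le_trans (ler_normB _ _))//.
    have b (t : R) : t ^+ 2 = m.+1%:R ^+ 2 -> `|F n t| <= n.+1`!%:R * expR 1 * m.+1%:R^-1.
      move=> tm; apply: le_trans (gauss_bound n t) _; rewrite tm.
      have m1 : 1 <= m.+1%:R :> R by rewrite ler1n.
      have m2 : 0 < 1 + m.+1%:R ^+ 2 :> R by nra.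
      by rewrite ler_wpM2l ?mulr_ge0 ?expR_ge0// lef_pV2 ?posrE ?ltr0n//; nra.
    rewrite -mulrA mulr_natl mulr2n; apply: lerD; apply: b => //.
    by rewrite sqrrN.
  - exact: cvg_cst.
  - rewrite -[X in _ --> X](mulr0 (2 * (n.+1`!%:R * expR 1))).
    by apply: cvgM; [exact: cvg_cst|exact: cvg_harmonic].
move: L1; under eq_fun do rewrite FTC.
by move/(cvg_unique _)/(_ L2); apply.
Qed.

End gaussian_moments.

Lemma integrable_indicP dT (T : measurableType dT) (R : realType)
    (mu : {measure set T -> \bar R}) A : measurable A ->
  mu.-integrable setT (EFin \o (\1_A : T -> R)) <-> (mu A < +oo)%E.
Proof.
move=> mA; have E : (\int[mu]_x `|(EFin \o \1_A) x| = mu A)%E.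
  rewrite (eq_integral (fun x => (\1_A x)%:E)%E); first by rewrite integral_indic// setIT.
  by move=> x _ /=; rewrite ger0_norm.
split=> [/integrableP[_]|fA]; first by rewrite E.
by apply/integrableP; split; [exact/measurable_EFinP|rewrite E].
Qed.

(** * Scaling of Lebesgue measure *)

Section lebesgue_scaling.
Context {R : realType} {d : nat}.
Local Notation leb := (@lebesgue_measure R).
Implicit Types (a b : 'I_d -> R) (x : d.-tuple R).

Definition brick a b : set (d.-tuple R) := [set x | forall i, a i < tnth x i <= b i].

Lemma indic_brick a b x :
  \1_(brick a b) x = \prod_(i < d) \1_(`]a i, b i]%classic) (tnth x i) :> R.
Proof.
rewrite indicE; have [xab|xab] := pselect (brick a b x).
  by rewrite mem_set// big1// => i _; rewrite indicE mem_set//= in_itv/= xab.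
rewrite memNset//; have /existsNP[i ai] := xab.
by rewrite (bigD1 i)//= indicE memNset ?mul0r//= in_itv.
Qed.

Lemma measurable_brick a b : measurable (brick a b).
Proof.
have -> : brick a b = \big[setI/setT]_(i < d) ((@tnth d R)^~ i @^-1` `]a i, b i]).
  apply/seteqP; split => x.
    by move=> xa; apply: (big_ind (fun A : set _ => A x)) => // i _; rewrite /= in_itv/= xa.
  by move=> + i; rewrite (bigD1 i)//= => -[/=]; rewrite in_itv/=.
apply: bigsetI_measurable => i _; rewrite -[X in measurable X]setTI.
by apply: (@measurable_tnth _ _ _ i).
Qed.

Lemma lebesgue_tuple_brick a b :
  lebesgue_tuple d (brick a b) = (\prod_(i < d) Num.max (b i - a i) 0)%:E.
Proof.
have fin i : (leb `]a i, b i]%classic < +oo)%E.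
  by rewrite lebesgue_measure_itv/=; case: ifP => // _; rewrite -EFinB ltry.
have [|ji jI] := @lebesgue_tuple_prod R d (fun i => \1_(`]a i, b i]%classic)).
  by move=> i; apply: (proj2 (integrable_indicP leb (measurable_itv _))) (fin i).
have E : (fun x : d.-tuple R => \prod_(i < d) \1_(`]a i, b i]%classic) (tnth x i)) =
    \1_(brick a b) :> (_ -> R).
  by apply/funext => x; rewrite indic_brick.
have mb := measurable_brick a b.
move: ji jI; rewrite E Rintegral_indic// setIT => ji jI.
have fb : lebesgue_tuple d (brick a b) \is a fin_num.
  by rewrite ge0_fin_numE//; exact/integrable_indicP.
rewrite -(fineK fb) jI; congr EFin; apply: eq_bigr => i _.
rewrite (Rintegral_indic leb measurableT (measurable_itv _)) setIT.
have := @lebesgue_measure_itv R `]a i, b i]; rewrite /= lte_fin => ->.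
by case: ifPn => ab; [rewrite /= max_l// subr_ge0 ltW|rewrite max_r// subr_le0 leNgt].
Qed.

Lemma measurable_tuple_brick : measurable =
  <<s [set A | exists a b, A = brick a b] >> :> set (set (d.-tuple R)).
Proof.
apply/seteqP; split; last first.
  apply: smallest_sub; first exact: sigma_algebra_measurable.
  by move=> _ [a [b ->]]; exact: measurable_brick.
rewrite measurable_tuple_box; apply: smallest_sub; first exact: smallest_sigma_algebra.
move=> _ [a _ <-].
rewrite (_ : box a = \bigcup_n brick a (fun=> n%:R)).
  by apply: sigma_algebra_bigcup => n; apply: sub_sigma_algebra; exists a, (fun=> n%:R).
apply/seteqP; split => x /=; last by move=> [n _ xn] i; have /andP[] := xn i.
move=> xa; exists (Num.trunc (\sum_(j < d) `|tnth x j|)).+1 => // j.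
rewrite xa ltW// (le_lt_trans _ (truncnS_gt _))// (bigD1 j)//=.
by rewrite -[leLHS]addr0 lerD ?sumr_ge0// ler_norm.
Qed.

Definition dilation (c : R) x : d.-tuple R := [tuple c * tnth x i | i < d].

Lemma measurable_dilation c : measurable_fun setT (dilation c).
Proof.
apply/measurable_fun_tnthP => i.
rewrite (_ : _ \o _ = (fun x : d.-tuple R => c * tnth x i)).
  by apply: measurable_funM => //; exact: measurable_tnth.
by apply/funext => x /=; rewrite tnth_mktuple.
Qed.

(** Dilates of bricks are bricks, so both sides agree on a generating family stable under
    intersection. *)
Lemma lebesgue_tuple_dilation c A : 0 < c -> measurable A ->
  lebesgue_tuple d (dilation c^-1 @^-1` A) = ((c ^+ d)%:E * lebesgue_tuple d A)%E.
Proof.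
move=> c0 mA; have cd0 : 0 <= c ^+ d by rewrite exprn_ge0// ltW.
pose m1' := pushforward (lebesgue_tuple d) (dilation c^-1) : {measure set (d.-tuple R) -> \bar R}.
pose m1 := m1' (measurable_dilation c^-1).
pose m2 : {measure set (d.-tuple R) -> \bar R} := mscale (NngNum cd0) (lebesgue_tuple d).
have pre a b : dilation c^-1 @^-1` (brick a b) = brick (fun i => c * a i) (fun i => c * b i).
  apply/seteqP; split => x /= xab i; have := xab i; rewrite tnth_mktuple;
    by rewrite ltr_pdivlMl// ler_pdivrMl.
have H a b : m1 (brick a b) = m2 (brick a b).
  rewrite /m1 /m2 /= /pushforward pre /mscale/= !lebesgue_tuple_brick -EFinM; congr EFin.
  transitivity (\prod_(i < d) (c * Num.max (b i - a i) 0)).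
    by apply: eq_bigr => i _; rewrite maxr_pMr ?(ltW c0)// mulr0 mulrBr.
  by rewrite big_split/= prodr_const card_ord.
apply: (@measure_unique _ _ _ [set A | exists a b, A = brick a b]
  (fun k => brick (fun=> - k%:R) (fun=> k%:R)) _ _ _ _ m1 m2) => //.
- exact: measurable_tuple_brick.
- move=> _ _ [a [b ->]] [a' [b' ->]].
  exists (fun i => Num.max (a i) (a' i)), (fun i => Num.min (b i) (b' i)).
  apply/seteqP; split => x /=.
    move=> [h1 h2] i; have /andP[? ?] := h1 i; have /andP[? ?] := h2 i.
    by rewrite gt_max le_min; apply/andP; split; apply/andP.
  move=> h; split=> i; have := h i; rewrite gt_max le_min => /andP[/andP[? ?] /andP[? ?]];
    exact/andP.
- by move=> k; exists (fun=> - k%:R), (fun=> k%:R).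
- apply/seteqP; split => // x _.
  exists (Num.trunc (\sum_(j < d) `|tnth x j|)).+1 => // j.
  have : `|tnth x j| < (Num.trunc (\sum_(j < d) `|tnth x j|)).+1%:R.
    rewrite (le_lt_trans _ (truncnS_gt _))// (bigD1 j)//=.
    by rewrite lerDl sumr_ge0.
  by rewrite ltr_norml => /andP[-> /ltW].
- by move=> _ [a [b ->]].
- by move=> k; rewrite H /m2 /= /mscale/= lebesgue_tuple_brick -EFinM ltry.
Qed.

End lebesgue_scaling.

(** * Gaussian integrals of polynomials *)

Section gaussian_integrals.
Context {R : realType} {d : nat}.
Local Notation leb := (@lebesgue_measure R).
Local Notation lam := (@lebesgue_tuple R d).
Implicit Types (p q : mpoly.mpoly d R) (x : d.-tuple R).
Local Notation homog n := (mpoly.ishomog1 n mpoly.mdeg).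
Local Notation "''x_' i" := (mpoly.mpolyX R (mpoly.mnm1 i)) (at level 8, i at level 2).

Lemma gauss_enorm x : gauss_fun (enorm x) = \prod_(i < d) gauss_fun (tnth x i).
Proof. by rewrite /gauss_fun sqr_enorm -sumrN expR_sum. Qed.

Definition gauss_integral p := \int[lam]_x (peval p x * gauss_fun (enorm x)).

Lemma gauss_integral_mpolyX m :
  lam.-integrable setT (EFin \o (fun x => peval (mpoly.mpolyX R m) x * gauss_fun (enorm x))) /\
  gauss_integral (mpoly.mpolyX R m) = \prod_(i < d) @gauss_moment R (m i).
Proof.
have [] := @lebesgue_tuple_prod R d (fun i t => t ^+ m i * gauss_fun t)
  (fun i => integrable_gauss (m i)).
have E : (fun x : d.-tuple R => \prod_i (tnth x i ^+ m i * gauss_fun (tnth x i))) =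
    (fun x => peval (mpoly.mpolyX R m) x * gauss_fun (enorm x)).
  by apply/funext => x; rewrite big_split /= gauss_enorm /peval mpoly.mevalX.
by rewrite E.
Qed.

Lemma gauss_integrable p :
  lam.-integrable setT (EFin \o (fun x => peval p x * gauss_fun (enorm x))).
Proof.
rewrite (_ : (fun x => _) = (fun x => \sum_(m <- mpoly.msupp p)
    mpoly.mcoeff m p * (peval (mpoly.mpolyX R m) x * gauss_fun (enorm x)))).
  apply: integrable_real_sum => // m; apply: integrable_realZ => //.
  by have [] := gauss_integral_mpolyX m.
apply/funext => x; rewrite {1}(mpoly.mpolyE p) peval_sum mulr_suml.
by apply: eq_bigr => m _; rewrite /peval mpoly.mevalZ mulrA.
Qed.

Lemma gauss_integral_linear c p q :
  gauss_integral (c *: p + q) = c * gauss_integral p + gauss_integral q.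
Proof.
rewrite /gauss_integral -RintegralZl//; last exact: gauss_integrable.
rewrite -RintegralD//; [|apply: integrable_realZ => //; exact: gauss_integrable|
  exact: gauss_integrable].
by apply: eq_Rintegral => x _; rewrite peval_linear mulrDl mulrA.
Qed.

Lemma gauss_integral0 : gauss_integral 0 = 0.
Proof.
rewrite /gauss_integral; under eq_Rintegral do rewrite /peval mpoly.meval0 mul0r.
by rewrite Rintegral_cst// mul0r.
Qed.

Lemma gauss_integralZ c p : gauss_integral (c *: p) = c * gauss_integral p.
Proof. by rewrite -[c *: p]addr0 gauss_integral_linear gauss_integral0 addr0. Qed.

Lemma gauss_integralD p q : gauss_integral (p + q) = gauss_integral p + gauss_integral q.
Proof. by rewrite -[p]scale1r gauss_integral_linear mul1r scale1r. Qed.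

Lemma gauss_integral_sum I (s : seq I) (F : I -> mpoly.mpoly d R) :
  gauss_integral (\sum_(i <- s) F i) = \sum_(i <- s) gauss_integral (F i).
Proof.
elim: s => [|i s IH]; first by rewrite !big_nil gauss_integral0.
by rewrite !big_cons gauss_integralD IH.
Qed.

Lemma gauss_integral_mderiv i p :
  gauss_integral (mpoly.mderiv i p) = 2 * gauss_integral ('x_i * p).
Proof.
rewrite (mpoly.mpolyE p) raddf_sum /= mulr_sumr !gauss_integral_sum mulr_sumr.
apply: eq_bigr => m _; rewrite mpoly.mderivZ -scalerAr !gauss_integralZ mulrCA.
congr (_ * _); rewrite mpoly.mderivX gauss_integralZ -mpoly.mpolyXD.
have [_ ->] := gauss_integral_mpolyX (mpoly.mnm_sub m (mpoly.mnm1 i)).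
have [_ ->] := gauss_integral_mpolyX (mpoly.mnm_add (mpoly.mnm1 i) m).
rewrite (bigD1 i)//= [in RHS](bigD1 i)//= !mulrA.
rewrite mpoly.mnmBE mpoly.mnmDE mpoly.mnm1E eqxx subn1 add1n -gauss_moment_rec.
congr (_ * _); apply: eq_bigr => j ji.
by rewrite mpoly.mnmBE mpoly.mnmDE mpoly.mnm1E eq_sym (negbTE ji) subn0 add0n.
Qed.

(* Integrating [sum_i d_i (p d_i q)] against the Gaussian weight gives
   [int grad p . grad q = 2 (deg q) int p q], whose left side is symmetric. *)
Lemma gauss_orthogonal n m p q : p \is homog n -> q \is homog m ->
  lap p = 0 -> lap q = 0 -> n != m -> gauss_integral (p * q) = 0.
Proof.
have G k (u v : mpoly.mpoly d R) : v \is homog k -> lap v = 0 ->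
    \sum_(i < d) gauss_integral (mpoly.mderiv i u * mpoly.mderiv i v) =
    2 * k%:R * gauss_integral (u * v).
  move=> vk v0.
  have <- : \sum_(i < d) gauss_integral (mpoly.mderiv i (u * mpoly.mderiv i v)) =
      \sum_(i < d) gauss_integral (mpoly.mderiv i u * mpoly.mderiv i v).
    under eq_bigr do rewrite mpoly.mderivM gauss_integralD.
    rewrite big_split /= -[X in _ + X]gauss_integral_sum -mulr_sumr -/(lap v) v0 mulr0.
    by rewrite gauss_integral0 addr0.
  under eq_bigr do rewrite gauss_integral_mderiv mulrCA.
  rewrite -mulr_sumr -gauss_integral_sum -mulr_sumr (euler_identity vk).
  by rewrite -scalerAr gauss_integralZ mulrA.
move=> pn qm p0 q0 nm; have := G m p q qm q0; have := G n q p pn p0.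
under eq_bigr do rewrite mulrC.
rewrite [q * p]mulrC => -> /eqP; rewrite -subr_eq0 -mulrBl -mulrBr !mulf_eq0.
rewrite pnatr_eq0 /= subr_eq0 eqr_nat (negbTE nm) /=.
by move/eqP.
Qed.

End gaussian_integrals.

(** * Radial and angular parts of Lebesgue measure *)

Section polar_coordinates.
Context {R : realType} {d : nat}.
Local Notation lam := (@lebesgue_tuple R d).
Implicit Types (x : d.-tuple R) (H : d.-tuple R -> R).

Lemma enorm_dilation c x : 0 <= c -> enorm (dilation c x) = c * enorm x.
Proof.
move=> c0; rewrite /enorm; under eq_bigr do rewrite tnth_mktuple exprMn.
by rewrite -mulr_sumr sqrtrM ?sqr_ge0// sqrtr_sqr ger0_norm.
Qed.

Lemma direction_dilation c x : 0 < c -> direction (dilation c x) = direction x.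
Proof.
move=> c0; apply/eq_from_tnth => i; rewrite !tnth_mktuple enorm_dilation ?(ltW c0)//.
by rewrite -mulf_div divff ?gt_eqF// mul1r.
Qed.

(** The function equal to H on the sphere and constant along rays, set to 0 at the origin, where
    [direction] takes a default value. *)
Definition cone H x := (enorm x != 0)%:R * H (direction x).

Lemma cone_dilation c H x : 0 < c -> cone H (dilation c x) = cone H x.
Proof.
move=> c0; rewrite /cone direction_dilation// enorm_dilation ?(ltW c0)//.
by rewrite mulf_eq0 gt_eqF.
Qed.

Lemma measurable_enorm_neq0 : measurable_fun setT (fun x => (enorm x != 0)%:R : R).
Proof.
rewrite (_ : (fun x => _) = \1_(@enorm R d @^-1` (~` [set 0]))).
  apply: measurable_indic; rewrite -[X in measurable X]setTI.
  by apply: measurable_enorm => //; apply: measurableC.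
apply/funext => x; rewrite indicE; congr (_%:R); congr (nat_of_bool _).
by apply/idP/idP; rewrite inE /= => /eqP.
Qed.

Lemma measurable_cone H : measurable_fun setT H -> measurable_fun setT (cone H).
Proof.
move=> mH; apply: measurable_funM; first exact: measurable_enorm_neq0.
by apply: measurableT_comp => //; exact: measurable_direction.
Qed.

Lemma measurable_open_ball t : measurable [set x : d.-tuple R | enorm x < t].
Proof.
rewrite (_ : [set x | _] = @enorm R d @^-1` `]-oo, t[); last first.
  by apply/seteqP; split => x /=; rewrite in_itv.
by rewrite -[X in measurable X]setTI; exact: measurable_enorm.
Qed.

Lemma brick_cover t : [set x : d.-tuple R | enorm x <= t] `<=` brick (fun=> - t - 1) (fun=> t).
Proof.
move=> x /= xt i.
have := le_trans (tnth_le_enorm x i) xt.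
rewrite ler_norml => /andP[h1 h2]; apply/andP; split=> //.
by rewrite ltrBlDr (le_lt_trans h1)// ltrDl.
Qed.

Lemma lebesgue_ball_lty t A : measurable A -> A `<=` [set x : d.-tuple R | enorm x <= t] ->
  (lam A < +oo)%E.
Proof.
move=> mA At; apply: (@le_lt_trans _ _ (lam (brick (fun=> - t - 1) (fun=> t)))).
  rewrite le_measure ?inE//; first exact: measurable_brick.
  exact: subset_trans At (@brick_cover t).
by rewrite lebesgue_tuple_brick ltry.
Qed.

Definition open_ball t : set (d.-tuple R) := [set x | enorm x < t].

(** Cones are invariant under dilations, so rescaling the ball produces just the Jacobian t^d. *)
Lemma cone_ball_scaling H (t : R) : measurable_fun setT H -> (forall x, 0 <= H x) -> 0 < t ->
  (\int[lam]_(x in open_ball t) (cone H x)%:E =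
   (t ^+ d)%:E * \int[lam]_(x in open_ball 1%R) (cone H x)%:E)%E.
Proof.
move=> mH H0 t0; have td0 : 0 <= t ^+ d by rewrite exprn_ge0// ltW.
have ti0 : 0 < t^-1 by rewrite invr_gt0.
have mc : measurable_fun setT (EFin \o cone H).
  by apply/measurable_EFinP; exact: measurable_cone.
have c0 x : (0 <= (cone H x)%:E)%E by rewrite lee_fin mulr_ge0.
have mb := measurable_open_ball 1.
rewrite -[t ^+ d]/((NngNum td0)%:num) -ge0_integral_mscale//; last exact: measurable_funTS.
pose m' := pushforward lam (dilation t^-1) : {measure set (d.-tuple R) -> \bar R}.
transitivity (\int[m' (measurable_dilation t^-1)]_(x in open_ball 1%R) (cone H x)%:E)%E;
  last first.
  apply: eq_measure_integral => A mA _; rewrite /= /mscale/= -lebesgue_tuple_dilation//.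
rewrite ge0_integral_pushforward//; [|exact: measurable_dilation|exact: measurable_funTS].
have -> : dilation t^-1 @^-1` (open_ball 1) = open_ball t.
  by apply/seteqP; split => x /=; rewrite /open_ball /= enorm_dilation ?(ltW ti0)//
    mulrC ltr_pdivrMr// mul1r.
by apply: eq_integral => x _; rewrite /= cone_dilation.
Qed.

Section bounded_densities.
Variables (H : d.-tuple R -> R) (C : R).
Hypotheses (mH : measurable_fun setT H) (H0 : forall x, 0 <= H x) (HC : forall x, H x <= C).

Let C0 : 0 <= C. Proof. by rewrite (le_trans (H0 [tuple of nseq d 0])). Qed.

Lemma cone_le x : 0 <= cone H x <= C.
Proof.
rewrite /cone mulr_ge0//=; case: (_ != 0); first by rewrite mul1r.
by rewrite mul0r.
Qed.

Lemma cone_ball_fin t : 0 < t -> (\int[lam]_(x in open_ball t) (cone H x)%:E < +oo)%E.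
Proof.
move=> t0; apply: (@le_lt_trans _ _ (\int[lam]_(x in open_ball t) C%:E)%E).
  apply: ge0_le_integral => //.
  - exact: measurable_open_ball.
  - by move=> x _; rewrite lee_fin; have /andP[] := cone_le x.
  - by apply/measurable_funTS/measurable_EFinP; exact: measurable_cone.
  - by move=> x _; rewrite lee_fin; have /andP[] := cone_le x.
rewrite integral_cst; last exact: measurable_open_ball.
rewrite lte_mul_pinfty ?lee_fin//.
by apply: (@lebesgue_ball_lty t) => [|x /ltW]; first exact: measurable_open_ball.
Qed.

Lemma cone_integrable (w : R -> R) : measurable_fun setT w ->
  lam.-integrable setT (EFin \o (fun x => w (enorm x))) ->
  lam.-integrable setT (EFin \o (fun x => w (enorm x) * cone H x)).
Proof.
move=> mw iw; apply: integrable_bounded_by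
  (integrable_realZ C measurableT (integrable_norm iw)) _ => //.
  apply: measurable_funM; last exact: measurable_cone.
  by apply: measurableT_comp => //; exact: measurable_enorm.
move=> x _; rewrite normrM mulrC /= ler_wpM2r//.
by have /andP[c0 c1] := cone_le x; rewrite ger0_norm.
Qed.

End bounded_densities.

(* The images of both measures under the norm give the mass [t^d M] to
   [0 < |x| < t], with the same [M]. *)
Lemma cone_radial_eq H1 H2 C (w : R -> R) :
  measurable_fun setT H1 -> measurable_fun setT H2 ->
  (forall x, 0 <= H1 x <= C) -> (forall x, 0 <= H2 x <= C) ->
  (\int[lam]_(x in open_ball 1%R) (cone H1 x)%:E =
   \int[lam]_(x in open_ball 1%R) (cone H2 x)%:E)%E ->
  measurable_fun setT w -> lam.-integrable setT (EFin \o (fun x => w (enorm x))) ->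
  \int[lam]_x (w (enorm x) * cone H1 x) = \int[lam]_x (w (enorm x) * cone H2 x).
Proof.
move=> mH1 mH2 H1C H2C E mw iw.
have H10 x : 0 <= H1 x by have /andP[] := H1C x.
have H20 x : 0 <= H2 x by have /andP[] := H2C x.
have H1l x : H1 x <= C by have /andP[] := H1C x.
have H2l x : H2 x <= C by have /andP[] := H2C x.
have c1 x : 0 <= cone H1 x by have /andP[] := cone_le H10 H1l x.
have c2 x : 0 <= cone H2 x by have /andP[] := cone_le H20 H2l x.
have [m1 [m1E _ m1I]] := image_density (@measurable_enorm R d) lam (measurable_cone mH1) c1.
have [m2 [m2E _ m2I]] := image_density (@measurable_enorm R d) lam (measurable_cone mH2) c2.
rewrite -m1I//; last exact: cone_integrable.
rewrite -m2I//; last exact: cone_integrable.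
have ball t : @enorm R d @^-1` `]-oo, t[ = open_ball t.
  by apply/seteqP; split => x /=; rewrite in_itv.
apply: eq_Rintegral_measure.
apply: (@measure_unique _ _ _ (@RGenInftyO.G R) (fun k => `]-oo, k.+1%:R[%classic)).
- exact: RGenInftyO.measurableE.
- move=> _ _ [x ->] [y ->]; exists (Num.min x y).
  apply/seteqP; split => z /=; rewrite !in_itv/= lt_min; last by move=> /andP.
  by move=> [-> ->].
- by move=> i; exists i.+1%:R.
- apply/seteqP; split => // x _; exists (Num.trunc `|x|) => //=.
  by rewrite in_itv/= (le_lt_trans (ler_norm x))// truncnS_gt.
- move=> _ [t ->]; rewrite m1E// m2E// !ball.
  have [t0|t0] := ltP 0 t; first by
    rewrite (cone_ball_scaling mH1 H10 t0) (cone_ball_scaling mH2 H20 t0) E.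
  rewrite (_ : open_ball t = set0) ?integral_set0//.
  by apply/seteqP; split => // x; rewrite /open_ball /= ltNge (le_trans t0)// enorm_ge0.
- by move=> k; rewrite m1E// ball; exact: cone_ball_fin.
Qed.

End polar_coordinates.

(** * Orthogonality on the sphere *)

Section sphere_integrals.
Context {R : realType} {d : nat}.
Hypothesis d0 : (0 < d)%N.
Local Notation lam := (@lebesgue_tuple R d).
Local Notation S := (sphere_measure R d).
Local Notation homog n := (mpoly.ishomog1 n mpoly.mdeg).
Implicit Types (x : d.-tuple R) (p q : mpoly.mpoly d R).

Lemma enorm_direction x : enorm x != 0 -> enorm (direction x) = 1.
Proof.
move=> x0; have -> : direction x = dilation (enorm x)^-1 x.
  by apply/eq_from_tnth => i; rewrite !tnth_mktuple mulrC.
by rewrite enorm_dilation ?invr_ge0 ?enorm_ge0// mulVf.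
Qed.

Lemma measurable_sphere : measurable (sphere R d).
Proof.
rewrite (_ : sphere R d = @enorm R d @^-1` [set 1]); last by apply/seteqP; split.
by rewrite -[X in measurable X]setTI; exact: measurable_enorm.
Qed.

Lemma sphere_measure_compl : S (~` sphere R d) = 0%E.
Proof.
rewrite /sphere_measure (_ : _ `&` _ = set0) ?measure0 ?mule0//.
apply/seteqP; split => // x [/= xs]; rewrite /punctured_ball /= => /andP[x0 _].
by apply: xs; rewrite /sphere /= enorm_direction// gt_eqF.
Qed.

Lemma sphere_measure_lty : (S setT < +oo)%E.
Proof.
rewrite /sphere_measure lte_mul_pinfty// preimage_setT setTI.
apply: (@lebesgue_ball_lty _ _ 1); first exact: measurable_punctured_ball.
by move=> x /= /andP[].
Qed.

Lemma sphere_integral_setT (f : d.-tuple R -> R) : measurable_fun setT f ->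
  \int[S]_(x in sphere R d) f x = \int[S]_x f x.
Proof.
apply: Rintegral_null_complement; first exact: measurable_sphere.
exact: sphere_measure_compl.
Qed.

Lemma enorm_direction_le1 x : enorm (direction x) <= 1.
Proof.
have [x0|x0] := eqVneq (enorm x) 0; last by rewrite enorm_direction.
rewrite /enorm big1 ?sqrtr0// => i _.
by rewrite tnth_mktuple x0 invr0 mulr0 expr0n.
Qed.

Lemma peval_bounded p : exists2 C, 0 <= C & forall x, enorm x <= 1 -> `|peval p x| <= C.
Proof.
exists (\sum_(m <- mpoly.msupp p) `|mpoly.mcoeff m p|).
  by apply: sumr_ge0.
move=> x x1; rewrite /peval mpoly.mevalE (le_trans (ler_norm_sum _ _ _))//.
apply: ler_sum => m _; rewrite normrM ler_piMr// normr_prod prodr_ile1// => i.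
rewrite normr_ge0 /= normrX exprn_ile1// (le_trans (tnth_le_enorm _ _))//.
Qed.

Lemma sphere_integrable p : S.-integrable setT (EFin \o peval p).
Proof.
have [C C0 pC] := peval_bounded p.
apply/(integrable_null_complement measurable_sphere sphere_measure_compl).
  exact: measurable_peval.
apply: (@integrable_bounded_by _ _ _ _ _ _ (fun=> C)).
- exact: measurable_sphere.
- by apply: measurable_funTS; exact: measurable_peval.
- apply: (@integrableS _ _ _ _ setT) => //; first exact: measurable_sphere.
  apply/integrableP; split; first exact/measurable_EFinP.
  by rewrite integral_cst// lte_mul_pinfty// sphere_measure_lty.
- by move=> x x1; apply: pC; rewrite x1.
Qed.

(** By definition [sphere_measure] is the image under [direction] of d times Lebesgue measure on the
    punctured ball. *)
Lemma sphere_integralE (f : d.-tuple R -> R) C : measurable_fun setT f ->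
  (forall x, `|f (direction x)| <= C) ->
  \int[S]_x f x = d%:R * \int[lam]_x (\1_(`]0, 1]%classic) (enorm x) * f (direction x)).
Proof.
move=> mf fC; pose b x : R := d%:R * \1_(punctured_ball R d) x.
have mb : measurable_fun setT b.
  apply: measurable_funM => //; apply: measurable_indic; exact: measurable_punctured_ball.
have b0 x : 0 <= b x by rewrite mulr_ge0.
have [m [mE mi mI]] := image_density (@measurable_direction R d) lam mb b0.
have fball : (lam (punctured_ball R d) < +oo)%E.
  apply: (@lebesgue_ball_lty _ _ 1); first exact: measurable_punctured_ball.
  by move=> x /= /andP[].
have Sm A : measurable A -> S A = m A.
  move=> mA; rewrite mE// /b.
  have mdA : measurable (@direction R d @^-1` A).
    by rewrite -[X in measurable X]setTI; exact: measurable_direction.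
  have mpb := @measurable_punctured_ball R d.
  under eq_integral do rewrite EFinM.
  rewrite ge0_integralZl//; last first.
    by apply: measurable_funTS; apply/measurable_EFinP; exact: measurable_indic.
  by rewrite integral_indic// setIC.
have ib : lam.-integrable setT (EFin \o b).
  by apply: integrable_realZ => //; exact/(integrable_indicP lam (@measurable_punctured_ball R d)).
have mfd : measurable_fun setT (fun x => f (direction x)).
  by apply: measurableT_comp => //; exact: measurable_direction.
have ifb : lam.-integrable setT (EFin \o (fun x => f (direction x) * b x)).
  apply: integrable_bounded_by (integrable_realZ C measurableT ib) _ => //.
    exact: measurable_funM.
  by move=> x _; rewrite normrM [`|b x|]ger0_norm// ler_wpM2r.
rewrite (eq_Rintegral_measure _ Sm) mI// -RintegralZl//.
  apply: eq_Rintegral => x _; rewrite /b mulrCA [f _ * _]mulrC; congr (_ * (_ * _)).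
have ib1 := proj2 (integrable_indicP lam (@measurable_punctured_ball R d)) fball.
apply: integrable_bounded_by (integrable_realZ C measurableT ib1) _ => //.
  apply: measurable_funM => //; apply: measurableT_comp; last exact: measurable_enorm.
  exact: measurable_indic.
move=> x _; rewrite normrM mulrC.
have -> : `|\1_`]0, 1]%classic (enorm x) : R| = \1_(punctured_ball R d) x.
  by rewrite !indicE ger0_norm.
by rewrite ler_wpM2r.
Qed.

(** Chosen so that d eps^2 < 1: the brick with sides ]eps/2, eps] lies in the open unit ball and
    away from the origin, and serves to show that radial integrals are positive. *)
Let eps : R := d.+1%:R^-1.

Lemma eps_gt0 : 0 < eps. Proof. by rewrite invr_gt0 ltr0n. Qed.

Definition small_brick := @brick R d (fun=> eps / 2) (fun=> eps).

Lemma small_brick_enorm x : small_brick x -> eps / 2 < enorm x < 1.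
Proof.
move=> xQ; have e0 := eps_gt0; apply/andP; split.
  have := xQ (Ordinal d0) => /andP[h _]; apply: lt_le_trans h _.
  by apply: le_trans (tnth_le_enorm _ _); exact: ler_norm.
rewrite -(ltr_pXn2r (n:=2))// ?nnegrE ?enorm_ge0// expr1n sqr_enorm.
apply: (@le_lt_trans _ _ (\sum_(i < d) eps ^+ 2)).
  apply: ler_sum => i _; have /andP[h1 h2] := xQ i.
  by rewrite ler_pXn2r// nnegrE; lra.
rewrite sumr_const card_ord -mulr_natl /eps exprVn ltr_pdivrMr ?exprn_gt0 ?ltr0n//.
rewrite mul1r expr2 -natrM ltr_nat; nia.
Qed.

Lemma small_brick_integral_gt0 (g : d.-tuple R -> R) c : 0 < c ->
  lam.-integrable setT (EFin \o g) -> (forall x, 0 <= g x) ->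
  (forall x, small_brick x -> c <= g x) -> 0 < \int[lam]_x g x.
Proof.
move=> c0 ig g0 gc; have mQ : measurable small_brick by exact: measurable_brick.
have lQ : lam small_brick = (\prod_(i < d) (eps / 2))%:E.
  rewrite /small_brick lebesgue_tuple_brick; congr EFin; apply: eq_bigr => i _.
  by have e0 := eps_gt0; rewrite max_l; lra.
have jQ : lam.-integrable setT (EFin \o (\1_small_brick : d.-tuple R -> R)).
  have fQ : (lam small_brick < +oo)%E by rewrite lQ ltry.
  exact: (proj2 (integrable_indicP lam mQ) fQ).
have iQ : lam.-integrable setT (EFin \o (fun x => c * \1_small_brick x)).
  exact: integrable_realZ.
apply: (@lt_le_trans _ _ (\int[lam]_x (c * \1_small_brick x))); last first.
  apply: le_Rintegral => // x _; have [xQ|xQ] := pselect (small_brick x).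
    by rewrite indicE mem_set// mulr1 gc.
  by rewrite indicE memNset// mulr0.
rewrite RintegralZl//.
have -> : \int[lam]_x \1_small_brick x = \prod_(i < d) (eps / 2).
  by rewrite Rintegral_indic// setIT; exact: (congr1 fine lQ).
rewrite mulr_gt0//= prodr_gt0// => i _.
by rewrite divr_gt0// eps_gt0.
Qed.

Lemma direction_idem x : enorm x != 0 -> direction (direction x) = direction x.
Proof.
move=> x0; rewrite (_ : direction x = dilation (enorm x)^-1 x); last first.
  by apply/eq_from_tnth => i; rewrite !tnth_mktuple mulrC.
rewrite direction_dilation// ?invr_gt0 ?lt_neqAle 1?eq_sym ?x0 ?enorm_ge0//.
by apply/eq_from_tnth => i; rewrite !tnth_mktuple mulrC.
Qed.

(** Let f be the angular part of p q. By [cone_radial_eq], integrating f against any radial weight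
    gives a fixed constant times the integral of the weight ([star]). The weight t^N exp(-t^2) turns
    this into the Gaussian integral of p q, which is 0, so the constant is 0; the indicator of ]0,
    1] then gives the sphere integral. *)
Lemma sphere_orthogonal n m p q : p \is homog n -> q \is homog m ->
  lap p = 0 -> lap q = 0 -> n != m -> \int[S]_x (peval p x * peval q x) = 0.
Proof.
move=> pn qm p0 q0 nm; set N := (n + m)%N.
(* As n <> m, the product has positive degree and vanishes at the origin, where polar coordinates
   break down. *)
have N0 : (0 < N)%N by rewrite /N; case: n m nm {pn qm N} => [|n] [|m].
have pqN : p * q \is homog N by exact: mpoly.dhomogM.
pose f x := peval (p * q) (direction x).
have [C C0 pC] := peval_bounded (p * q).
have fC x : `|f x| <= C by apply: pC; exact: enorm_direction_le1.
have mf : measurable_fun setT f.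
  by apply: measurableT_comp; [exact: measurable_peval|exact: measurable_direction].
pose w (t : R) : R := t ^+ N * gauss_fun t.
have mw : measurable_fun setT w.
  by apply: measurable_funM; [exact: exprn_measurable|exact: measurable_gauss_fun].
have w0 t : 0 <= t -> 0 <= w t by move=> t0; rewrite mulr_ge0 ?exprn_ge0 ?gauss_fun_ge0.
have iw : lam.-integrable setT (EFin \o (fun x => w (enorm x))).
  apply: integrable_bounded_by (gauss_integrable ((1 + sqnorm) ^+ N)) _ => //.
    by apply: measurableT_comp => //; exact: measurable_enorm.
  move=> x _; rewrite ger0_norm ?w0 ?enorm_ge0// pevalX ler_wpM2r ?gauss_fun_ge0//.
  by rewrite peval_add1_sqnorm; exact: enormX_le.
(* Adding C makes the density nonnegative, as [cone_radial_eq] requires. *)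
pose H1 x := f x + C.
have mH1 : measurable_fun setT H1 by exact: measurable_funD.
have mc (c : R) : measurable_fun setT (fun _ : d.-tuple R => c) by exact: measurable_cst.
have coneH1 x : cone H1 x = cone (fun=> 1) x * f x + C * cone (fun=> 1) x.
  rewrite /cone /H1 /f; case: eqVneq => [_|x0]; first by rewrite !mul0r mulr0 addr0.
  by rewrite !mul1r mulr1 direction_idem.
have coneC c x : cone (fun=> c) x = c * cone (fun=> 1) x.
  by rewrite /cone mulr1 mulrC.
have cone01 x : 0 <= (cone (fun=> 1) x : R) <= 1.
  by apply: (@cone_le _ _ (fun=> 1) 1) => // _; exact: ler01.
have H1b x : 0 <= H1 x <= 2 * C.
  by have := fC x; rewrite ler_norml /H1 => /andP[h1 h2]; apply/andP; split; lra.
pose u : R -> R := \1_(`]-oo, 1[%classic).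
have mball t : measurable (@open_ball R d t) by exact: measurable_open_ball.
have bE (H : d.-tuple R -> R) : measurable_fun setT H -> forall D, (forall x, 0 <= H x <= D) ->
    (\int[lam]_(x in open_ball 1%R) (cone H x)%:E)%E =
    (\int[lam]_x (u (enorm x) * cone H x))%:E /\
    lam.-integrable setT (EFin \o (fun x => u (enorm x) * cone H x)).
  move=> mH D HD; have H0 x : 0 <= H x by have /andP[] := HD x.
  have HDl x : H x <= D by have /andP[] := HD x.
  have iu : lam.-integrable setT (EFin \o (fun x => u (enorm x))).
    have -> : (fun x : d.-tuple R => u (enorm x)) = \1_(open_ball 1).
      by apply/funext => x; rewrite /u !indicE.
    apply/integrable_indicP => //; apply: (@lebesgue_ball_lty _ _ 1) => // x.
    by move=> /ltW.
  have mu_ : measurable_fun setT u by apply: measurable_indic; exact: measurable_itv.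
  have iuc := cone_integrable mH H0 HDl mu_ iu.
  split=> //; rewrite /Rintegral fineK; last exact: integrable_fin_num.
  rewrite [LHS]integral_mkcond; apply: eq_integral => x _; rewrite patchE /u indicE.
  have [xb|xb] := pselect (open_ball 1 x).
    by rewrite mem_set// mem_set ?mul1r//= in_itv.
  by rewrite memNset// memNset ?mul0r//= in_itv.
have one01 (x : d.-tuple R) : 0 <= (1 : R) <= 1 by rewrite ler01 lexx.
have [E1 i1] := bE _ mH1 _ H1b; have [E2 i2] := bE (fun=> 1) (mc 1) 1 one01.
set a := \int[lam]_x _ in E1; set b := \int[lam]_x _ in E2.
have u0 t : 0 <= u t by [].
have b0 : 0 < b.
  apply: (@small_brick_integral_gt0 _ 1) => // [x|x xQ].
    by rewrite mulr_ge0//; have /andP[] := cone01 x.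
  have /andP[x1 x2] := small_brick_enorm xQ.
  rewrite /u indicE mem_set ?mul1r/= ?in_itv//= /cone mulr1.
  by rewrite gt_eqF// (lt_trans _ x1)// divr_gt0// eps_gt0.
have a0 : 0 <= a.
  apply: Rintegral_ge0 => // x _; rewrite mulr_ge0// /cone mulr_ge0//.
  by have /andP[] := H1b (direction x).
(* The mean of H1: the constant density with the same mass as H1 on the unit ball. *)
pose kappa := a / b; have k0 : 0 <= kappa by rewrite divr_ge0// ltW.
have Ek : (\int[lam]_(x in open_ball 1%R) (cone (fun=> kappa) x)%:E = a%:E)%E.
  have kb (x : d.-tuple R) : 0 <= kappa <= kappa by rewrite k0 lexx.
  have [-> _] := bE (fun=> kappa) (mc kappa) kappa kb; congr EFin.
  transitivity (kappa * b); last by rewrite divfK ?gt_eqF.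
  by rewrite -RintegralZl//; apply: eq_Rintegral => x _; rewrite coneC mulrCA.
have star (v : R -> R) : measurable_fun setT v ->
    lam.-integrable setT (EFin \o (fun x => v (enorm x))) ->
    \int[lam]_x (v (enorm x) * (cone (fun=> 1) x * f x)) =
    (kappa - C) * \int[lam]_x (v (enorm x) * cone (fun=> 1) x).
  move=> mv iv; have H1b' x : 0 <= H1 x <= 2 * C + kappa.
    by have /andP[-> /le_trans->//] := H1b x; rewrite lerDl.
  have kb (x : d.-tuple R) : 0 <= kappa <= 2 * C + kappa.
    by rewrite k0 lerDr mulr_ge0.
  have := cone_radial_eq mH1 (mc kappa) H1b' kb (etrans E1 (esym Ek)) mv iv.
  have ivc : lam.-integrable setT (EFin \o (fun x => v (enorm x) * cone (fun=> 1) x)).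
    by apply: (@cone_integrable _ _ (fun=> 1) 1 _ _ _ v) => // x; rewrite ler01.
  have -> : \int[lam]_x (v (enorm x) * cone (fun=> kappa) x) =
      kappa * \int[lam]_x (v (enorm x) * cone (fun=> 1) x).
    by rewrite -RintegralZl//; apply: eq_Rintegral => x _; rewrite coneC mulrCA.
  have ivf : lam.-integrable setT (EFin \o (fun x => v (enorm x) * (cone (fun=> 1) x * f x))).
    apply: integrable_bounded_by (integrable_realZ C measurableT (integrable_norm iv)) _ => //.
      apply: measurable_funM; first by apply: measurableT_comp => //; exact: measurable_enorm.
      by apply: measurable_funM => //; exact: measurable_cone.
    move=> x _; rewrite normrM mulrC /= ler_wpM2r// normrM.
    have /andP[c0 c1] := cone01 x; rewrite ger0_norm// -[leRHS]mul1r.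
    by apply: ler_pM.
  have -> : \int[lam]_x (v (enorm x) * cone H1 x) =
      \int[lam]_x (v (enorm x) * (cone (fun=> 1) x * f x)) +
      C * \int[lam]_x (v (enorm x) * cone (fun=> 1) x).
    rewrite -RintegralZl// -RintegralD//; last exact: integrable_realZ.
    by apply: eq_Rintegral => x _; rewrite coneH1 mulrDr [X in _ + X]mulrCA.
  by move=> E; rewrite mulrBl -E addrK.
have kC : kappa = C.
  have W0 : 0 < \int[lam]_x (w (enorm x) * cone (fun=> 1) x).
    apply: (@small_brick_integral_gt0 _ ((eps / 2) ^+ N * gauss_fun 1)).
    - by rewrite mulr_gt0 ?exprn_gt0 ?divr_gt0 ?eps_gt0// expR_gt0.
    - by apply: (@cone_integrable _ _ (fun=> 1) 1 _ _ _ w) => // x; rewrite ler01.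
    - by move=> x; rewrite mulr_ge0 ?w0 ?enorm_ge0//; have /andP[] := cone01 x.
    - move=> x xQ; have /andP[x1 x2] := small_brick_enorm xQ.
      have e0 : 0 < eps / 2 by rewrite divr_gt0// eps_gt0.
      rewrite /cone gt_eqF ?(lt_trans e0)// !mulr1 /w.
      apply: ler_pM; rewrite ?exprn_ge0 ?gauss_fun_ge0 ?(ltW e0)//.
        by rewrite lerXn2r ?nnegrE ?enorm_ge0 ?ltW.
      rewrite /gauss_fun ler_expR lerN2 lerXn2r ?nnegrE ?enorm_ge0//.
      exact: ltW.
  have := star w mw iw.
  have -> : \int[lam]_x (w (enorm x) * (cone (fun=> 1) x * f x)) = gauss_integral (p * q).
    apply: eq_Rintegral => x _; rewrite /cone mulr1 [in RHS](peval_direction pqN); last by right.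
    case: eqVneq => [->|x0]; last by rewrite mul1r /w mulrAC.
    by rewrite /w expr0n gtn_eqF// !mul0r.
  rewrite (gauss_orthogonal pn qm p0 q0 nm) => /esym/eqP; rewrite mulf_eq0.
  by rewrite (gt_eqF W0) orbF subr_eq0 => /eqP.
have mE : measurable_fun setT (fun x => peval p x * peval q x).
  by apply: measurable_funM; exact: measurable_peval.
rewrite (@sphere_integralE _ C mE); last by move=> x; rewrite -pevalM; exact: fC.
have := star (\1_(`]0, 1]%classic)).
rewrite kC subrr mul0r => E; apply/eqP; rewrite mulf_eq0; apply/orP; right; apply/eqP.
rewrite -[RHS]E; last 2 first.
- by apply: measurable_indic; exact: measurable_itv.
- have -> : (fun x : d.-tuple R => \1_(`]0, 1]%classic) (enorm x)) =
      \1_(punctured_ball R d) :> (_ -> R).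
    by apply/funext => x; rewrite !indicE.
  apply/integrable_indicP; first exact: measurable_punctured_ball.
  apply: (@lebesgue_ball_lty _ _ 1); first exact: measurable_punctured_ball.
  by move=> x /= /andP[].
apply: eq_Rintegral => x _; rewrite /f pevalM /cone mulr1 indicE.
by case: eqVneq => [->|x0]; rewrite ?mul1r// memNset ?mul0r//= in_itv/= ltxx.
Qed.

End sphere_integrals.

Lemma finite_measure_exists dT (T : measurableType dT) (R : realType)
    (m : {measure set T -> \bar R}) : (m setT < +oo)%E ->
  exists m' : {finite_measure set T -> \bar R}, forall A, m' A = m A.
Proof.
move=> fin; have fm : fin_num_fun m.
  move=> A mA; rewrite ge0_fin_numE//; apply: le_lt_trans fin.
  by rewrite le_measure ?inE.
pose m1 A := m A.
have m0 : m1 set0 = 0%E by rewrite /m1.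
have m_ge0 A : (0 <= m1 A)%E by rewrite /m1.
have ms : semi_sigma_additive m1 by exact: measure_semi_sigma_additive.
pose m2 : {measure set T -> \bar R} := HB.pack m1 (isMeasure.Build _ _ _ m1 m0 m_ge0 ms).
have fm2 : fin_num_fun m2 by [].
by exists (HB.pack m1 m2 (Measure_isFinite.Build _ _ _ m2 fm2) : {finite_measure set T -> \bar R}).
Qed.

(** * Perturbation of one component *)

Section polar_product.
Context {R : realType} {d : nat}.
Hypothesis d0 : (0 < d)%N.
Local Notation S := (sphere_measure R d).
Local Notation D := (`[0%R, +oo[%classic : set R).
Local Notation homog n := (mpoly.ishomog1 n mpoly.mdeg).
Implicit Types (x : d.-tuple R) (q y : mpoly.mpoly d R).

Definition polar_map (z : R * d.-tuple R) : d.-tuple R := dilation z.1 z.2.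

Lemma measurable_polar_map : measurable_fun setT polar_map.
Proof.
apply/measurable_fun_tnthP => i.
rewrite (_ : _ \o _ = (fun z : R * d.-tuple R => z.1 * tnth z.2 i)).
  apply: measurable_funM; first exact: measurable_fst.
  exact: (measurableT_comp (measurable_tnth i) measurable_snd).
by apply/funext => x /=; rewrite tnth_mktuple.
Qed.

Section polar_image.
Variables (m : {finite_measure set R -> \bar R})
  (s : {finite_measure set (d.-tuple R) -> \bar R}).
Hypotheses (m0 : m `]-oo, 0[%classic = 0%E) (s0 : s (~` sphere R d) = 0%E).

Let mDS : measurable (D `*` sphere R d).
Proof. by apply: measurableX => //; exact: measurable_sphere. Qed.

Let DS0 : (m \x s)%E (~` (D `*` sphere R d)) = 0%E.
Proof.
have mS := @measurable_sphere R d; have mSC := measurableC mS.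
apply/eqP; rewrite -measure_le0.
apply: (@le_trans _ _ ((m \x s)%E ((`]-oo, 0[%classic `*` setT) `|` (setT `*` ~` sphere R d)))).
  rewrite le_measure ?inE//; first exact: measurableC.
    by apply: measurableU; exact: measurableX.
  move=> [t x] /= /not_andP[|xs]; last by right.
  by rewrite !in_itv/= andbT => /negP; rewrite -ltNge; left.
apply: (@le_trans _ _ ((m \x s)%E (`]-oo, 0%R[%classic `*` setT) +
    (m \x s)%E (setT `*` ~` sphere R d))%E).
  by apply: measureU2; exact: measurableX.
by rewrite !product_measure1E//= m0 s0 mul0e mule0 adde0.
Qed.

(** For r >= 0 and x on the sphere, |r x| = r and q(r x) = r^n q(x), so the integrand factors; all
    other pairs form a null set of the product. *)
Lemma polar_image : exists T : {measure set (d.-tuple R) -> \bar R},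
  (T setT < +oo)%E /\
  forall (g : R -> R) n q, measurable_fun setT g -> q \is homog n ->
    m.-integrable setT (EFin \o (fun t => g t * t ^+ n)) ->
    s.-integrable setT (EFin \o peval q) ->
    T.-integrable setT (EFin \o (fun x => g (enorm x) * peval q x)) /\
    \int[T]_x (g (enorm x) * peval q x) =
    (\int[m]_t (g t * t ^+ n)) * \int[s]_x peval q x.
Proof.
pose T' := pushforward (m \x s)%E polar_map : {measure set (d.-tuple R) -> \bar R}.
exists (T' measurable_polar_map); split.
  rewrite /T' /= /pushforward preimage_setT -[setT]setXTT product_measure1E//=.
  by rewrite lte_mul_pinfty// ?fin_num_measure// -ge0_fin_numE// fin_num_measure.
move=> g n q mg qn ig iq.
have ip := integrable_product ig iq.
pose F (z : R * d.-tuple R) := g (enorm (polar_map z)) * peval q (polar_map z).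
pose G (z : R * d.-tuple R) := (g z.1 * z.1 ^+ n) * peval q z.2.
have mf : measurable_fun setT (fun x => g (enorm x) * peval q x).
  apply: measurable_funM; last exact: measurable_peval.
  by apply: measurableT_comp => //; exact: measurable_enorm.
have mF : measurable_fun setT F by exact: (measurableT_comp mf measurable_polar_map).
have mG : measurable_fun setT G by apply/measurable_EFinP; exact: measurable_int ip.
have FG z : (D `*` sphere R d) z -> F z = G z.
  case: z => t x [/=]; rewrite in_itv/= andbT => t0 xs; rewrite /F /G /polar_map/=.
  rewrite enorm_dilation// xs mulr1 -mulrA; congr (_ * _).
  by apply: homog_scale qn _ => i; rewrite tnth_mktuple.
have iF : (m \x s)%E.-integrable setT (EFin \o F).
  apply/(integrable_null_complement mDS DS0 mF).
  have iG := (integrable_null_complement mDS DS0 mG).2 ip.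
  apply: integrable_bounded_by (integrable_norm iG) _ => //.
    exact: measurable_funTS.
  by move=> z /FG /= ->.
have iF' : (m \x s)%E.-integrable (polar_map @^-1` setT)
    ((EFin \o (fun x => g (enorm x) * peval q x)) \o polar_map).
  by rewrite preimage_setT.
have mfE : measurable_fun setT (EFin \o (fun x => g (enorm x) * peval q x)).
  exact/measurable_EFinP.
split; first exact: (integrable_pushforward measurable_polar_map mfE iF').
rewrite /Rintegral (integral_pushforward measurable_polar_map mfE iF' measurableT).
rewrite preimage_setT -[LHS]/(\int[(m \x s)%E]_z F z) -[RHS](Rintegral_product ig iq).
rewrite -(Rintegral_null_complement mDS DS0 mF) -(Rintegral_null_complement mDS DS0 mG).
by apply: eq_Rintegral => z; rewrite inE; exact: FG.
Qed.

End polar_image.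

(** Image of (r^-k rho) x (y dtheta) under (r, x) -> r x. The charge y dtheta is split into positive
    and negative parts because the product is one of measures; the absolute value in |t|^-k keeps
    the density nonnegative on all of R. *)
Lemma polar_product (rho : {measure set R -> \bar R}) k y :
  rho `]-oo, 0[%classic = 0%E ->
  rho.-integrable setT (EFin \o (fun t => `|t| ^- k)) ->
  exists Tp Tn : {measure set (d.-tuple R) -> \bar R},
  [/\ (Tp setT < +oo)%E, (Tn setT < +oo)%E &
  forall (g : R -> R) n q, measurable_fun setT g -> q \is homog n ->
    rho.-integrable setT (EFin \o (fun t => g t * t ^+ n * `|t| ^- k)) ->
    [/\ Tp.-integrable setT (EFin \o (fun x => g (enorm x) * peval q x)),
        Tn.-integrable setT (EFin \o (fun x => g (enorm x) * peval q x)) &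
    \int[Tp]_x (g (enorm x) * peval q x) - \int[Tn]_x (g (enorm x) * peval q x) =
    (\int[rho]_t (g t * t ^+ n * `|t| ^- k)) * \int[S]_x (peval q x * peval y x)]].
Proof.
move=> r0 irho.
have mw : measurable_fun setT (fun t : R => `|t| ^- k).
  by apply/measurable_EFinP; exact: measurable_int irho.
have w0 (t : R) : 0 <= `|t| ^- k by rewrite invr_ge0 exprn_ge0.
have fin1 dT (T : measurableType dT) (mu : {measure set T -> \bar R}) :
    mu.-integrable setT (EFin \o (fun=> 1 : R)) -> (mu setT < +oo)%E.
  move=> /integrableP[_]; under eq_integral do rewrite /= normr1.
  by rewrite integral_cst// mul1e.
have [m mE] := density_exists rho mw w0.
have mI := integrable_density mw w0 mE; have mR := Rintegral_density mw w0 mE.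
have [m' m'E] : exists m' : {finite_measure set R -> \bar R}, forall A, m' A = m A.
  apply/finite_measure_exists/fin1/mI => //.
  by move: irho; congr (integrable _ _ _); apply/funext => t /=; rewrite mul1r.
have m'0 : m' `]-oo, 0[%classic = 0%E.
  rewrite m'E mE; apply: null_set_integral => //.
  by apply/measurable_funTS/measurable_EFinP.
pose yp x := Num.max (peval y x) 0; pose yn x := Num.max (- peval y x) 0.
have my := measurable_peval y.
have myp : measurable_fun setT yp by exact: measurable_maxr.
have myn : measurable_fun setT yn by apply: measurable_maxr => //; exact: measurableT_comp.
have yp0 x : 0 <= yp x by have [_ /andP[]] := max_oppr (peval y x).
have yn0 x : 0 <= yn x by have [_ _ /andP[]] := max_oppr (peval y x).
have yE x : peval y x = yp x - yn x by have [] := max_oppr (peval y x).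
have ypy x : yp x <= `|peval y x| by have [_ /andP[]] := max_oppr (peval y x).
have yny x : yn x <= `|peval y x| by have [_ _ /andP[]] := max_oppr (peval y x).
have iqf (f : d.-tuple R -> R) q : measurable_fun setT f -> (forall x, 0 <= f x) ->
    (forall x, f x <= `|peval y x|) ->
    S.-integrable setT (EFin \o (fun x => peval q x * f x)).
  move=> mf f0 fy.
  apply: integrable_bounded_by (integrable_norm (sphere_integrable (q * y))) _ => //.
    by apply: measurable_funM => //; exact: measurable_peval.
  by move=> x _ /=; rewrite pevalM !normrM ler_wpM2l// ger0_norm// fy.
have part (f : d.-tuple R -> R) : measurable_fun setT f -> (forall x, 0 <= f x) ->
    (forall x, f x <= `|peval y x|) ->
    exists T : {measure set (d.-tuple R) -> \bar R}, (T setT < +oo)%E /\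
    forall (g : R -> R) n q, measurable_fun setT g -> q \is homog n ->
      rho.-integrable setT (EFin \o (fun t => g t * t ^+ n * `|t| ^- k)) ->
      T.-integrable setT (EFin \o (fun x => g (enorm x) * peval q x)) /\
      \int[T]_x (g (enorm x) * peval q x) =
      (\int[rho]_t (g t * t ^+ n * `|t| ^- k)) * \int[S]_x (peval q x * f x).
  move=> mf f0 fy; have [s sE] := density_exists S mf f0.
  have sI q := integrable_density mf f0 sE (measurable_peval q) (iqf f q mf f0 fy).
  have sR q := Rintegral_density mf f0 sE (measurable_peval q) (iqf f q mf f0 fy).
  have [s' s'E] : exists s' : {finite_measure set (d.-tuple R) -> \bar R}, forall A, s' A = s A.
    apply/finite_measure_exists/fin1.
    by have := sI 1; congr (integrable _ _ _); apply/funext => x; rewrite /= /peval mpoly.meval1.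
  have s'0 : s' (~` sphere R d) = 0%E.
    rewrite s'E sE; apply: null_set_integral => //.
    - by apply: measurableC; exact: measurable_sphere.
    - by apply/measurable_funTS/measurable_EFinP.
    - exact: sphere_measure_compl.
  have [T [finT TE]] := polar_image m'0 s'0.
  exists T; split=> // g n q mg qn ig.
  have mgn : measurable_fun setT (fun t => g t * t ^+ n).
    by apply: measurable_funM => //; exact: exprn_measurable.
  have im : m'.-integrable setT (EFin \o (fun t => g t * t ^+ n)).
    exact: (eq_integrable_measure (fun A _ => m'E A) (mI (fun t => g t * t ^+ n) mgn ig)).
  have is_ : s'.-integrable setT (EFin \o peval q).
    exact: (eq_integrable_measure (fun A _ => s'E A) (sI q)).
  have [iT ->] := TE g n q mg qn im is_; split=> //.
  rewrite -(mR (fun t => g t * t ^+ n) mgn ig) -(sR q).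
  congr (_ * _); [exact: (eq_Rintegral_measure _ (fun A _ => m'E A))|
    exact: (eq_Rintegral_measure _ (fun A _ => s'E A))].
have [Tp [finp Tpi]] := part yp myp yp0 ypy.
have [Tn [finn Tni]] := part yn myn yn0 yny.
exists Tp, Tn; split=> // g n q mg qn ig.
have [ip ->] := Tpi g n q mg qn ig; have [in_ ->] := Tni g n q mg qn ig.
split=> //; rewrite -mulrBr; congr (_ * _); rewrite -RintegralB//; try exact: iqf.
by apply: eq_Rintegral => x _; rewrite -mulrBr -yE.
Qed.

End polar_product.

(** * Replacing one component of a charge *)

Section perturbation.
Context {R : realType} {d : nat}.
Hypothesis d0 : (0 < d)%N.
Variables (a : nat -> nat) (Y : forall k : nat, 'I_(a k) -> mpoly.mpoly d R).
Arguments Y : clear implicits.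
Hypothesis hY : forall k : nat, orthonormal_harmonic_basis k (Y k).
Local Notation D := (`[0%R, +oo[%classic : set R).
Local Notation S := (sphere_measure R d).
Implicit Types (sigma mu : {charge set (d.-tuple R) -> \bar R}) (x : d.-tuple R).
Implicit Types (m : {measure set R -> \bar R}).

Section weight.
Variables (k0 : nat) (m : {measure set R -> \bar R}).
Hypotheses (hm : half_line_moment_measure m)
  (iw : m.-integrable setT (EFin \o (fun t => `|t| ^- k0)))
  (m0 : (0 < k0)%N -> m [set 0] = 0%E).

Lemma weight_integrable (g : R -> R) C j n : measurable_fun setT g -> 0 <= C ->
  (forall t, `|g t| <= C * `|t| ^+ j) ->
  m.-integrable setT (EFin \o (fun t => g t * t ^+ n * `|t| ^- k0)).
Proof.
move=> mg C0 gC.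
have mw : measurable_fun setT (fun t : R => `|t| ^- k0).
  by apply/measurable_EFinP; exact: measurable_int iw.
have ib := integrable_realZ C measurableT (integrable_realD measurableT
  (integrable_norm (half_line_moment_integrable (j + n) hm)) iw).
apply: integrable_bounded_by ib _ => //.
  by apply: measurable_funM => //; apply: measurable_funM => //; exact: exprn_measurable.
move=> t _ /=; rewrite !normrM !normrX (ger0_norm (x := `|t| ^- k0)) ?invr_ge0 ?exprn_ge0//.
apply: (@le_trans _ _ (C * (`|t| ^+ (j + n) * `|t| ^- k0))).
  by rewrite exprD !mulrA ler_wpM2r ?invr_ge0 ?exprn_ge0// ler_wpM2r ?exprn_ge0.
rewrite ler_wpM2l//; have w0 : 0 <= `|t| ^- k0 by rewrite invr_ge0 exprn_ge0.
have z0 : 0 <= `|t| ^+ (j + n) by rewrite exprn_ge0.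
(* Near 0 the weight |t|^-k0 is the majorant, far away the power |t|^(j+n). *)
have [t1|t1] := leP `|t| 1.
  by rewrite (@le_trans _ _ (`|t| ^- k0))// ?lerDr// ler_piMl// exprn_ile1.
rewrite (@le_trans _ _ (`|t| ^+ (j + n)))// ?lerDl// ler_piMr//.
rewrite invf_le1 ?exprn_gt0 ?(lt_trans ltr01)//; exact: exprn_ege1 (ltW t1).
Qed.

(** The inverse of 0 is 0 by convention, so for k0 > 0 the product t^k0 |t|^-k0 is 0 at the origin
    instead of 1; [m0] makes that point negligible. *)
Lemma weight_cancel (g : R -> R) : measurable_fun setT g ->
  \int[m]_t (g t * t ^+ k0 * `|t| ^- k0) = \int[m]_t g t.
Proof.
move=> mg; have [k00|k00] := posnP k0.
  by apply: eq_Rintegral => t _; rewrite k00 !expr0 invr1 !mulr1.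
have mP : measurable (`]0, +oo[%classic : set R) by exact: measurable_itv.
have mC : m (~` `]0, +oo[%classic) = 0%E.
  apply/eqP; rewrite -measure_le0.
  apply: (@le_trans _ _ (m `]-oo, 0%R[%classic + m [set 0%R])%E); last first.
    by rewrite (hm.1 : m _ = 0%E) m0// adde0.
  apply: le_trans (measureU2 _ _ _) => //.
  rewrite le_measure ?inE//; [exact: measurableC|exact: measurableU|].
  move=> t /=; rewrite !in_itv/= andbT => /negP; rewrite -leNgt le_eqVlt.
  by move=> /orP[/eqP ->|t0]; [right|left].
rewrite -[RHS](Rintegral_null_complement mP mC)//.
rewrite -(Rintegral_null_complement mP mC); last first.
  apply: measurable_funM; last by apply/measurable_EFinP; exact: measurable_int iw.
  by apply: measurable_funM => //; exact: exprn_measurable.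
apply: eq_Rintegral => t; rewrite inE /= in_itv/= andbT => t0.
by rewrite gtr0_norm// mulfK// expf_neq0// gt_eqF.
Qed.

End weight.

Lemma integrable_radialC sigma (g : R -> R) C j p : moment_measure sigma ->
  measurable_fun setT g -> 0 <= C -> (forall t, `|g t| <= C * `|t| ^+ j) ->
  charge_integrable sigma (fun x => g (enorm x) * peval p x).
Proof.
move=> ms mg C0 gC.
have ip := integrable_realZ C measurableT (integrable_norm (integrable_enormXM j p ms)).
apply: charge_integrable_bounded ip _.
  apply: measurable_funM; last exact: measurable_peval.
  by apply: measurableT_comp => //; exact: measurable_enorm.
move=> x /=; rewrite !normrM mulrA ler_wpM2r//.
by rewrite (le_trans (gC _))// normrX.
Qed.

Lemma charge_of_difference (P N : {measure set (d.-tuple R) -> \bar R}) :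
  (P setT < +oo)%E -> (N setT < +oo)%E ->
  exists sigma, forall f : d.-tuple R -> R, P.-integrable setT (EFin \o f) ->
    N.-integrable setT (EFin \o f) -> charge_integrable sigma f /\
    charge_integral sigma f = \int[P]_x f x - \int[N]_x f x.
Proof.
move=> /finite_measure_exists[P' P'E] /finite_measure_exists[N' N'E].
pose sigma : {charge set (d.-tuple R) -> \bar R} :=
  cadd (charge_of_finite_measure P') (copp (charge_of_finite_measure N')).
have sPN A : measurable A -> sigma A = (P' A - N' A)%E by [].
exists sigma => f iP iN.
have jP := eq_integrable_measure (fun A _ => P'E A) iP.
have jN := eq_integrable_measure (fun A _ => N'E A) iN.
have [jp jn] := charge_integrable_diff sPN jP jN.
split; first exact/charge_integrableP.
rewrite (charge_integral_diff sPN)//; congr (_ - _).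
  exact: (eq_Rintegral_measure _ (fun A _ => P'E A)).
exact: (eq_Rintegral_measure _ (fun A _ => N'E A)).
Qed.

Lemma charge_eq_integral sigma mu (f : d.-tuple R -> R) : charge_eq sigma mu ->
  charge_integrable mu f -> charge_integral sigma f = charge_integral mu f.
Proof.
move=> sm /charge_integrableP[jp jn].
rewrite (@charge_integral_diff _ _ _ sigma (charge_pos mu) (charge_neg mu))//.
by move=> A mA; rewrite sm// charge_decomp.
Qed.

(** Pairs (k, l) in one type, so that l and l0 can be compared although their types depend on k and
    k0. *)
Let index k (l : 'I_(a k)) : {k : nat & 'I_(a k)} := Tagged (fun k => 'I_(a k)) l.

Lemma orthonormal_sphere k l k0 l0 :
  \int[S]_x (peval (Y k l) x * peval (Y k0 l0) x) = (index l == index l0)%:R.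
Proof.
have [kk|kk] := eqVneq k k0; last first.
  rewrite (sphere_orthogonal d0 (Y_homog hY l) (Y_homog hY l0)
    (Y_harmonic hY l) (Y_harmonic hY l0) kk).
  by case: eqP => // /(congr1 tag) /= E; rewrite E eqxx in kk.
subst k0; have [_ _ /(_ l l0)] := hY k.
rewrite /index eq_Tagged /= => <-; rewrite sphere_integral_setT//.
by apply: measurable_funM; exact: measurable_peval.
Qed.

Section perturbed_solution.
Variables (mu : {charge set (d.-tuple R) -> \bar R}) (k0 : nat) (l0 : 'I_(a k0)).
Variables (nu rho : {measure set R -> \bar R}).
Hypotheses (hmu : moment_measure mu) (hpos : pseudo_positive Y mu).
Hypothesis hnu : component_measure Y mu l0 nu.
Hypothesis hrho : half_line_moment_measure rho.
Hypotheses (inu : nu.-integrable setT (EFin \o (fun t => `|t| ^- k0)))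
  (irho : rho.-integrable setT (EFin \o (fun t => `|t| ^- k0)))
  (nu0 : (0 < k0)%N -> nu [set 0] = 0%E) (rho0 : (0 < k0)%N -> rho [set 0] = 0%E).
Hypothesis same_moments : forall i, \int[rho]_t t ^+ (2 * i) = \int[nu]_t t ^+ (2 * i).

Lemma perturbed_charge : exists sigma, forall (g : R -> R) C j n q,
  measurable_fun setT g -> 0 <= C -> (forall t, `|g t| <= C * `|t| ^+ j) ->
  q \is mpoly.ishomog1 n mpoly.mdeg ->
  charge_integrable sigma (fun x => g (enorm x) * peval q x) /\
  charge_integral sigma (fun x => g (enorm x) * peval q x) =
  charge_integral mu (fun x => g (enorm x) * peval q x) +
  (\int[rho]_t (g t * t ^+ n * `|t| ^- k0) - \int[nu]_t (g t * t ^+ n * `|t| ^- k0)) *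
  \int[S]_x (peval q x * peval (Y k0 l0) x).
Proof.
have [hnu' _] := hnu.
have [Rp [Rn [finRp finRn RE]]] := polar_product (Y k0 l0) (hrho.1) irho.
have [Np [Nn [finNp finNn NE]]] := polar_product (Y k0 l0) (hnu'.1) inu.
(* The charge mu + (Rp - Rn) - (Np - Nn), regrouped by sign into P - N. *)
pose P := measure_add (charge_pos mu) (measure_add Rp Nn).
pose N := measure_add (charge_neg mu) (measure_add Rn Np).
have fin3 (m1 m2 m3 : {measure set (d.-tuple R) -> \bar R}) : (m1 setT < +oo)%E ->
    (m2 setT < +oo)%E -> (m3 setT < +oo)%E ->
    (measure_add m1 (measure_add m2 m3) setT < +oo)%E.
  move=> f1 f2 f3; rewrite [X in (X < _)%E]measure_addE lte_add_pinfty//.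
  by rewrite [X in (X < _)%E]measure_addE lte_add_pinfty.
have finP : (P setT < +oo)%E.
  by apply: fin3 => //; rewrite -ge0_fin_numE// charge_pos_fin.
have finN : (N setT < +oo)%E.
  by apply: fin3 => //; rewrite -ge0_fin_numE// charge_neg_fin.
have [sigma sigmaE] := charge_of_difference finP finN.
exists sigma => g C j n q mg C0 gC qn.
have [r1 r2 rE] := RE g n q mg qn (weight_integrable hrho irho n mg C0 gC).
have [n1 n2 nE] := NE g n q mg qn (weight_integrable hnu' inu n mg C0 gC).
have /charge_integrableP[mp mn] := integrable_radialC q hmu mg C0 gC.
have iP := integrable_measure_add mp (integrable_measure_add r1 n2).
have iN := integrable_measure_add mn (integrable_measure_add r2 n1).
have [-> ->] := sigmaE _ iP iN; split=> //.
rewrite !Rintegral_measure_add//; try exact: integrable_measure_add.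
by rewrite mulrBl -rE -nE /charge_integral; ring.
Qed.

(** Orthonormality confines the change to the component (k0, l0), where rho replaces nu ([sYE]).
    Pseudo-positivity follows from rho >= 0; the moments agree because the harmonic expansion
    involves even powers of |x|; and indicators as test functions recover rho from sigma. *)
Lemma perturbed_solution : exists sigma, V_set Y mu sigma /\
  (charge_eq sigma mu -> forall A, measurable A -> rho A = nu A).
Proof.
have [sigma sE] := perturbed_charge; have [hnu' nuE] := hnu.
have one (t : R) : `|1| <= 1 * `|t| ^+ 0 :> R by rewrite normr1 mulr1.
have isig p : charge_integrable sigma (peval p).
  rewrite (_ : peval p = fun x => \sum_(m <- mpoly.msupp p)
    mpoly.mcoeff m p * (1 * peval (mpoly.mpolyX R m) x)); last first.
    apply/funext => x; rewrite {1}(mpoly.mpolyE p) peval_sum.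
    by apply: eq_bigr => m _; rewrite mul1r /peval mpoly.mevalZ.
  apply: charge_integrable_sum => m; apply: charge_integrableZ.
  have hm : mpoly.mpolyX R m \is mpoly.ishomog1 (mpoly.mdeg m) mpoly.mdeg.
    by rewrite mpoly.dhomogX.
  by have [] := sE (fun=> 1) 1 0%N _ _ (measurable_cst _) ler01 one hm.
have sYE (g : R -> R) C j k l : measurable_fun setT g -> 0 <= C ->
    (forall t, `|g t| <= C * `|t| ^+ j) ->
    charge_integral sigma (fun x => g (enorm x) * peval (Y k l) x) =
    charge_integral mu (fun x => g (enorm x) * peval (Y k l) x) +
    (\int[rho]_t g t - \int[nu]_t g t) * (index l == index l0)%:R.
  move=> mg C0 gC; have [_ ->] := sE g C j _ _ mg C0 gC (Y_homog hY l).
  rewrite orthonormal_sphere; congr (_ + _).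
  have [E|] := eqVneq (index l) (index l0); last by rewrite !mulr0.
  by have /= -> := congr1 tag E; rewrite !weight_cancel.
exists sigma; split; last first.
  move=> sm A mA.
  have mg : measurable_fun setT (\1_A : R -> R) by exact: measurable_indic.
  have gC (t : R) : `|\1_A t : R| <= 1 * `|t| ^+ 0.
    by have /andP[? ?] := @indic01 _ R A t; rewrite mul1r expr0 ger0_norm.
  have := sYE _ _ _ _ l0 mg ler01 gC.
  rewrite (charge_eq_integral sm (integrable_radialC _ hmu mg ler01 gC)).
  rewrite eqxx mulr1 -[X in X = _]addr0 => /addrI/esym/eqP.
  rewrite subr_eq0 !Rintegral_indic// !setIT => /eqP E.
  have fin (m : {measure set R -> \bar R}) : half_line_moment_measure m -> m A \is a fin_num.
    move=> hm; rewrite ge0_fin_numE//.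
    apply: le_lt_trans (half_line_moment_measure_lty hm).
    by rewrite le_measure ?inE.
  by rewrite -(fineK (fin _ hrho)) E fineK// fin.
split.
- exact/moment_measureP.
- move=> h ch h0 [M hM] k l.
  (* The test function is constrained on [0, +oo[ alone; composing with the absolute value makes it
     measurable and bounded on R without changing it at |x|. *)
  pose g (t : R) := h `|t|.
  have mD : measurable D by exact: measurable_itv.
  have mg : measurable_fun setT g.
    have mh : measurable_fun D h by exact: subspace_continuous_measurable_fun.
    apply: (@measurable_comp _ _ _ _ _ _ D h setT (fun t : R => `|t|)) => //.
    by move=> _ [t _ <-] /=; rewrite in_itv/= andbT.
  have [C [C0 gC]] : exists C, 0 <= C /\ forall t, `|g t| <= C * `|t| ^+ 0.
    have [c _ hc] : exists2 c, c \in `[0, `|M|] & forall t, t \in `[0, `|M|] -> h t <= h c.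
      apply: EVT_max => //; apply: continuous_subspaceW ch.
      by move=> t /=; rewrite !in_itv/= andbT => /andP[].
    have hc0 : 0 <= h c.
      by apply: le_trans (h0 0 (lexx _)) (hc 0 _); rewrite in_itv/= lexx normr_ge0.
    exists (h c); split=> // t; rewrite expr0 mulr1 /g ger0_norm ?h0//.
    have [tM|tM] := leP `|t| `|M|; first by apply: hc; rewrite in_itv/= normr_ge0.
    by rewrite hM// (le_trans (ler_norm M))// ltW.
  have gE (nu' : {charge set (d.-tuple R) -> \bar R}) :
      charge_integral nu' (fun x => h (enorm x) * peval (Y k l) x) =
      charge_integral nu' (fun x => g (enorm x) * peval (Y k l) x).
    congr charge_integral; apply/funext => x.
    by rewrite /g ger0_norm ?enorm_ge0.
  rewrite gE (sYE g C 0%N)// -gE.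
  have [E|_] := eqVneq (index l) (index l0); last first.
    by rewrite mulr0 addr0; apply: hpos => //; exists M.
  have -> : charge_integral mu (fun x => h (enorm x) * peval (Y k l) x) =
      charge_integral mu (fun x => h (enorm x) * peval (Y k0 l0) x).
    suff -> : Y k l = Y k0 l0 by [].
    by have := congr1 (fun u : {k : nat & 'I_(a k)} => Y (tag u) (tagged u)) E.
  rewrite -nuE//; last first.
    exists C%:P => t t0; rewrite hornerC.
    by have := gC t; rewrite /g expr0 mulr1 (ger0_norm t0).
  have -> : \int[nu]_(t in D) h t = \int[nu]_t g t.
    rewrite -(half_line_Rintegral hnu'.1 mg); apply: eq_Rintegral => t.
    by rewrite inE /= in_itv/= andbT => t0; rewrite /g ger0_norm.
  rewrite mulr1 addrC subrK; apply: Rintegral_ge0 => // t _; exact: h0.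
- apply/cintegral_peval => p; have [s pE] := harmonic_expansion d0 hY p.
  have gX i (t : R) : `|t ^+ i| <= 1 * `|t| ^+ i by rewrite mul1r normrX.
  have E (nu' : {charge set (d.-tuple R) -> \bar R}) : moment_measure nu' ->
      charge_integral nu' (peval p) = \sum_(e <- s) e.1.1 * charge_integral nu'
      (fun x => enorm x ^+ (2 * e.1.2) * peval (Y (tag e.2) (tagged e.2)) x).
    move=> mnu; have ie (e : R * nat * {k : nat & 'I_(a k)}) : charge_integrable nu'
        (fun x => enorm x ^+ (2 * e.1.2) * peval (Y (tag e.2) (tagged e.2)) x).
      exact: integrable_enormXM.
    transitivity (charge_integral nu' (fun x => \sum_(e <- s)
        e.1.1 * (enorm x ^+ (2 * e.1.2) * peval (Y (tag e.2) (tagged e.2)) x))).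
      by congr charge_integral; apply/funext => x; rewrite pE.
    rewrite charge_integral_sum; last by move=> e; exact: charge_integrableZ.
    by apply: eq_bigr => e _; rewrite charge_integralZ.
  rewrite !E//; last exact/moment_measureP.
  apply: eq_bigr => e _; congr (_ * _).
  rewrite (sYE (fun t => t ^+ (2 * e.1.2)) 1 _ _ _ (exprn_measurable _) ler01 (gX _)).
  by rewrite same_moments subrr mul0r addr0.
Qed.

End perturbed_solution.

End perturbation.

(** * Pulling a measure back under squaring *)

Section square_root_image.
Context {R : realType}.
Local Notation D := (`[0%R, +oo[%classic : set R).
Implicit Types (nu s rho : {measure set R -> \bar R}).

Lemma measurable_sqrt : measurable_fun setT (@Num.sqrt R).
Proof. by apply: continuous_measurable_fun; exact: sqrt_continuous. Qed.

Lemma measurable_norm_expV k : measurable_fun setT (fun t : R => `|t| ^- k).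
Proof.
apply: (measurableT_comp measurable_inv); apply: measurable_funX.
exact: normr_measurable.
Qed.

(** psi after the square root is the identity on the half-line, so rho is the image of s under the
    square root. If s lives on [x, +oo[, the powers |t|^-k are bounded where rho lives. *)
Lemma square_root_image s : half_line_moment_measure s ->
  exists rho, [/\ half_line_moment_measure rho,
    forall A, measurable A -> image_psi rho A = s A,
    s [set 0] = 0%E -> rho [set 0] = 0%E &
    forall k x, 0 < x -> s `]-oo, x[%classic = 0%E ->
      rho.-integrable setT (EFin \o (fun t => `|t| ^- k))].
Proof.
move=> hs; have [s0 sp] := hs.
pose r' := pushforward s (@Num.sqrt R) : {measure set R -> \bar R}.
pose rho := r' measurable_sqrt.
have push (f : R -> R) : measurable_fun setT f ->
    s.-integrable setT (EFin \o (fun t => f (Num.sqrt t))) ->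
    rho.-integrable setT (EFin \o f).
  move=> mf jf; apply: (integrable_pushforward measurable_sqrt); rewrite ?preimage_setT//.
  exact/measurable_EFinP.
have rho0 : rho `]-oo, 0[%classic = 0%E.
  rewrite /rho /r' /= /pushforward (_ : _ @^-1` _ = set0) ?measure0//.
  by apply/seteqP; split => // t /=; rewrite in_itv/= ltNge sqrtr_ge0.
have rhoX n : rho.-integrable setT (EFin \o (fun t => t ^+ n)).
  apply: push; first exact: exprn_measurable.
  have msq : measurable_fun setT (fun t : R => Num.sqrt t ^+ n).
    by apply: measurable_funX; exact: measurable_sqrt.
  apply/(half_line_integrable s0) => //.
  apply: integrable_bounded_by (sp (('X + 1) ^+ n)) _ => //; first exact: measurable_funTS.
  move=> t; rewrite /= in_itv/= andbT => t0; rewrite horner_exp !hornerE.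
  rewrite ger0_norm ?exprn_ge0 ?sqrtr_ge0// lerXn2r ?nnegrE ?sqrtr_ge0//; first lra.
  have := sqr_sqrtr t0; have := sqr_ge0 (Num.sqrt t - 1); have := sqrtr_ge0 t.
  by rewrite sqrrB1; nra.
exists rho; split.
- split=> // p; apply/half_line_integrable => //; first exact: measurable_polynomial.
  rewrite (_ : horner p = fun t => \sum_(i < size p) p`_i * t ^+ i); last first.
    by apply/funext => t; rewrite horner_coef.
  by apply: integrable_real_sum => // i; exact: integrable_realZ.
- move=> A mA; rewrite -(half_line_measureE s0 mA) /image_psi /rho /r' /= /pushforward.
  have mpA : measurable (@Num.sqrt R @^-1` (@psi R @^-1` A)).
    rewrite -[X in measurable X]setTI; apply: measurable_sqrt => //.
    by rewrite -[X in measurable X]setTI; exact: measurable_psi.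
  rewrite -(half_line_measureE s0 mpA); congr (s _).
  apply/seteqP; split => t /= []; rewrite in_itv/= andbT /psi => h t0; split=> //.
    by rewrite -(sqr_sqrtr t0).
  by rewrite sqr_sqrtr.
(* The square root of a negative number is 0 by convention, so the preimage of {0} is ]-oo, 0]. *)
- move=> s00; rewrite /rho /r' /= /pushforward; apply/eqP; rewrite -measure_le0.
  apply: (@le_trans _ _ (s `]-oo, 0%R[%classic + s [set 0%R])%E).
    apply: le_trans (measureU2 _ _ _) => //.
    rewrite le_measure ?inE//; last first.
    + move=> t /= /eqP; rewrite sqrtr_eq0 le_eqVlt => /orP[/eqP|]; first by right.
      by rewrite in_itv; left.
    + exact: measurableU.
    + by rewrite -[X in measurable X]setTI; exact: measurable_sqrt.
  by rewrite s0 s00 adde0.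
- move=> k x x0 sx; apply: push; first exact: measurable_norm_expV.
  have mI : measurable (`[x, +oo[%classic : set R) by exact: measurable_itv.
  have sI : s (~` `[x, +oo[%classic) = 0%E.
    rewrite (_ : ~` _ = `]-oo, x[%classic)//; apply/seteqP; split => t /=;
      rewrite !in_itv/= andbT; first by move=> /negP; rewrite -ltNge.
    by move=> tx; apply/negP; rewrite -ltNge.
  have mf : measurable_fun setT (fun t : R => `|Num.sqrt t| ^- k).
    exact: (measurableT_comp (measurable_norm_expV k) measurable_sqrt).
  apply/(integrable_null_complement mI sI mf).
  apply: (@integrable_bounded_by _ _ _ _ _ _ (fun=> Num.sqrt x ^- k)) => //.
  + exact: measurable_funTS.
  + apply/integrableP; split; first exact/measurable_EFinP.
    rewrite integral_cst// lte_mul_pinfty//.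
    apply: le_lt_trans (half_line_moment_measure_lty hs).
    by rewrite le_measure ?inE.
  + move=> t; rewrite /= in_itv/= andbT => xt.
    have q0 : 0 < Num.sqrt x by rewrite sqrtr_gt0.
    have q1 : Num.sqrt x <= Num.sqrt t by exact: ler_wsqrtr.
    have q2 : 0 < Num.sqrt t by exact: lt_le_trans q0 q1.
    rewrite ger0_norm ?invr_ge0 ?exprn_ge0// gtr0_norm//.
    by rewrite lef_pV2 ?posrE ?exprn_gt0// lerXn2r// nnegrE ltW.
Qed.

End square_root_image.

(** * Consequences of the summability condition for one component *)

Section negative_moments.
Context {R : realType}.
Local Notation D := (`[0%R, +oo[%classic : set R).
Variables (nu : {measure set R -> \bar R}) (k : nat).
Hypothesis hnu : half_line_moment_measure nu.
Hypothesis fin : (\int[nu]_(r in D) shifted_power 0 k r < +oo)%E.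

Let mS : (0 < k)%N -> measurable_fun setT (@shifted_power R 0 k).
Proof.
move=> k0; rewrite (_ : shifted_power 0 k = fun r : R =>
    if r == 0 then +oo%E else (r ^- k)%:E); last first.
  by apply/funext => r; rewrite /shifted_power leqNgt k0 subn0.
apply: measurable_fun_ifT => //; first exact: measurable_fun_eqr.
apply/measurable_EFinP; apply: (measurableT_comp measurable_inv).
exact: exprn_measurable.
Qed.

Let S0 (r : R) : D r -> (0 <= shifted_power 0 k r)%E.
Proof.
rewrite /= in_itv/= andbT => r0; rewrite /shifted_power; case: ifP => _.
  by rewrite lee_fin exprn_ge0.
by case: eqP => // _; rewrite lee_fin invr_ge0 exprn_ge0.
Qed.

(** For k > 0, [shifted_power] dominates |t|^-k on the half-line; they differ at 0, where the former
    is +oo and the latter 0. *)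
Lemma negative_moment_integrable : nu.-integrable setT (EFin \o (fun t => `|t| ^- k)).
Proof.
have [k0|k0] := posnP k.
  have := half_line_moment_integrable 0 hnu; congr (integrable _ _ _).
  by apply/funext => t; rewrite /= k0 !expr0 invr1.
have [n0 _] := hnu; have mw := @measurable_norm_expV R k.
apply/(half_line_integrable n0 mw)/integrableP; split.
  by apply: measurable_funTS; exact/measurable_EFinP.
apply: le_lt_trans fin; apply: ge0_le_integral => //.
- by apply: measurable_funTS; apply: measurableT_comp => //; exact/measurable_EFinP.
- by apply: measurable_funTS; exact: mS.
- move=> r; rewrite /= in_itv/= andbT => r0; rewrite /shifted_power leqNgt k0 /=.
  case: eqP => [_|/eqP rn0]; first exact: leey.
  by rewrite lee_fin subn0 ger0_norm ?invr_ge0 ?exprn_ge0// ger0_norm.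
Qed.

(** The value +oo of [shifted_power] at 0 turns any mass there into an infinite integral. *)
Lemma negative_moment_zero : (0 < k)%N -> nu [set 0] = 0%E.
Proof.
move=> k0; apply/eqP; rewrite -measure_le0 leNgt; apply/negP => nu0.
have : (\int[nu]_(r in [set 0%R]) shifted_power 0 k r < +oo)%E.
  apply: le_lt_trans fin; apply: ge0_subset_integral => //.
  - by apply: measurable_funTS; exact: mS.
  - by move=> r /= ->; rewrite in_itv/= lexx.
rewrite (eq_integral (fun=> +oo%E)); last first.
  by move=> r; rewrite inE /= => ->; rewrite /shifted_power leqNgt k0 eqxx.
by rewrite integral_cst// gt0_mulye// ltxx.
Qed.

End negative_moments.

(** * Non-uniqueness when one image measure is not determined *)

Section undetermined_case.
Context {R : realType}.
Local Notation D := (`[0%R, +oo[%classic : set R).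
Implicit Types (nu s tau : {measure set R -> \bar R}).

Lemma wint_moments nu p : half_line_moment_measure nu ->
  wint nu 0 p = \sum_(i < size p) p`_i * \int[nu]_(r in D) r ^+ i.
Proof.
move=> hnu; rewrite wint0E.
have iX i : nu.-integrable D (EFin \o (fun t => t ^+ i)).
  apply/half_line_integrable; [exact: hnu.1|exact: exprn_measurable|].
  exact: half_line_moment_integrable.
transitivity (\int[nu]_(t in D) (\sum_(i < size p) p`_i * t ^+ i)).
  by apply: eq_Rintegral => t _; rewrite horner_coef.
rewrite Rintegral_sum//; last by move=> i; exact: integrable_realZ.
by apply: eq_bigr => i _; rewrite RintegralZl.
Qed.

(** For k = 0 the weight r^-k is trivial and any second solution serves; for k > 0 one supported
    away from 0 is taken from [second_moment_solution]. *)
Lemma undetermined_solution nu (k : nat) : half_line_moment_measure nu ->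
  ((0 < k)%N -> nu [set 0] = 0%E) -> ~ stieltjes_determined nu ->
  exists s, [/\ half_line_moment_measure s,
    forall m : nat, \int[s]_(r in D) r ^+ m = \int[nu]_(r in D) r ^+ m,
    ~ (forall A, measurable A -> nu A = s A) &
    (0 < k)%N -> exists2 x, 0 < x & s `]-oo, x[%classic = 0%E].
Proof.
move=> hnu nu0 ndet.
have [tau [htau mtau netau]] : exists tau, [/\ half_line_moment_measure tau,
    forall m : nat, \int[tau]_(r in D) r ^+ m = \int[nu]_(r in D) r ^+ m &
    ~ (forall A, measurable A -> nu A = tau A)].
  apply: contrapT => H; apply: ndet; split=> // tau htau mtau A mA.
  apply: contrapT => nA; apply: H; exists tau; split=> // E.
  by apply: nA; rewrite E.
have [k0|k0] := posnP k.
  by exists tau; split=> //; rewrite k0.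
have nu_tau p : wint nu 0 p = wint tau 0 p.
  by rewrite !wint_moments//; apply: eq_bigr => i _; rewrite mtau.
have [s [x [x0 hs sx smom sne]]] :=
  second_moment_solution hnu htau nu_tau netau (nu0 k0).
exists s; split=> [//|m|E|_]; last by exists x.
  have := smom 'X^m; rewrite !wint0E.
  by under eq_Rintegral do rewrite hornerXn; under [in RHS]eq_Rintegral do rewrite hornerXn.
move/eqP: sne; apply; rewrite /wint /Rintegral; congr fine.
by apply: eq_measure_integral => A mA _; rewrite E.
Qed.

End undetermined_case.

Section unique_case.
Context {R : realType} {d : nat}.
Hypothesis d0 : (0 < d)%N.
Variables (a : nat -> nat) (Y : forall k : nat, 'I_(a k) -> mpoly.mpoly d R).
Arguments Y : clear implicits.
Hypothesis hY : forall k : nat, orthonormal_harmonic_basis k (Y k).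
Local Notation D := (`[0%R, +oo[%classic : set R).

Lemma undetermined_not_unique (mu : {charge set (d.-tuple R) -> \bar R})
    (k : nat) (l : 'I_(a k)) (nu : {measure set R -> \bar R}) :
  moment_measure mu -> pseudo_positive Y mu -> component_measure Y mu l nu ->
  (\int[nu]_(r in D) shifted_power 0 k r < +oo)%E ->
  ~ stieltjes_determined (image_psi nu) ->
  exists sigma, V_set Y mu sigma /\ ~ charge_eq sigma mu.
Proof.
move=> hmu hpos hnu fin ndet; have [hnu' _] := hnu.
have inu := negative_moment_integrable hnu' fin.
have nu0 := negative_moment_zero fin.
have psi0 : (0 < k)%N -> image_psi nu [set 0] = 0%E.
  move=> k0; rewrite -(nu0 k0) /image_psi /pushforward; congr (nu _).
  apply/seteqP; split => t /=; rewrite /psi; last by move=> ->; rewrite expr0n.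
  by move=> /eqP; rewrite sqrf_eq0 => /eqP.
have [s [hs smom sne sx]] :=
  undetermined_solution (half_line_moment_image_psi hnu') psi0 ndet.
have [rho [hrho rhoE rho0 irho]] := square_root_image hs.
have s00 : (0 < k)%N -> s [set 0] = 0%E.
  move=> /sx[x x0 sx0]; apply/eqP; rewrite -measure_le0 -sx0 le_measure ?inE//.
  by move=> t /= ->; rewrite in_itv.
have irho' : rho.-integrable setT (EFin \o (fun t => `|t| ^- k)).
  have [k0|k0] := posnP k; last by have [x x0 sx0] := sx k0; exact: irho sx0.
  have := half_line_moment_integrable 0 hrho; congr (integrable _ _ _).
  by apply/funext => t; rewrite /= k0 !expr0 invr1.
have mom i : \int[rho]_t t ^+ (2 * i) = \int[nu]_t t ^+ (2 * i).
  rewrite -!image_psi_moments// -smom /Rintegral; congr fine.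
  by apply: eq_measure_integral => A mA _; exact: rhoE.
have [sigma [Vsigma sne']] := perturbed_solution d0 hY hmu hpos hnu hrho inu irho' nu0
  (fun k0 => rho0 (s00 k0)) mom.
exists sigma; split=> // E; apply: sne => A mA; rewrite -rhoE//.
rewrite /image_psi /pushforward sne'//.
by rewrite -[X in measurable X]setTI; exact: measurable_psi.
Qed.

End unique_case.

Unset Implicit Arguments.

Theorem theorem18 (R : realType) (d : nat) (hd : (0 < d)%N)
    (a : nat -> nat) (Y : forall k : nat, 'I_(a k) -> mpoly.mpoly d R)
    (hY : forall k : nat, orthonormal_harmonic_basis k (Y k))
    (mu : {charge set (d.-tuple R) -> \bar R})
    (hmu : moment_measure mu) (hpos : pseudo_positive Y mu)
    (muc : forall k : nat, 'I_(a k) -> {measure set R -> \bar R})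
    (hmuc : forall (k : nat) (l : 'I_(a k)),
      component_measure Y mu l (muc k l))
    (hsum : forall N : nat,
      (\sum_(0 <= k <oo) \sum_(l < a k)
         \int[muc k l]_(r in `[0%R, +oo[) shifted_power N k r < +oo)%E) :
  (exists sigma : {charge set (d.-tuple R) -> \bar R},
     V_set Y mu sigma /\
     forall tau : {charge set (d.-tuple R) -> \bar R},
       V_set Y mu tau -> charge_eq tau sigma)
  <-> (forall (k : nat) (l : 'I_(a k)), stieltjes_determined (image_psi (muc k l))).
Proof.
have Vmu : V_set Y mu mu by [].
split=> [[sigma [_ uniq]] k l|det]; last first.
  by exists mu; split=> // tau; exact: (determined_charge_eq hd hY hmu hmuc det).
apply: contrapT => ndet.
have S0 j i : (0 <= \int[muc j i]_(r in `[0%R, +oo[) shifted_power 0 j r)%E.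
  apply: integral_ge0 => r; rewrite /= in_itv/= andbT => r0; rewrite /shifted_power.
  case: ifP => _; first by rewrite lee_fin exprn_ge0.
  by case: eqP => // _; rewrite lee_fin invr_ge0 exprn_ge0.
(* One term of the convergent nonnegative series with N = 0. *)
have fin : (\int[muc k l]_(r in `[0%R, +oo[) shifted_power 0 k r < +oo)%E.
  apply: le_lt_trans (hsum 0%N).
  have := @nneseries_lim_ge R (fun j => \sum_(i < a j)
    \int[muc j i]_(r in `[0%R, +oo[) shifted_power 0 j r)%E xpredT 0%N k.+1.
  move=> /(_ (fun j _ _ => sume_ge0 (fun i _ => S0 j i) _)); apply: le_trans.
  rewrite big_nat_recr//= (bigD1 l)//= addeCA leeDl// adde_ge0 ?sume_ge0//.
  by move=> j _; exact: sume_ge0.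
have [tau [Vtau ntau]] := undetermined_not_unique hd hY hmu hpos (hmuc k l) fin ndet.
(* Both tau and mu lie in [V_set], so each would equal sigma. *)
by apply: ntau => A mA; rewrite (uniq tau Vtau)// (uniq mu Vmu).
Qed.
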